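(* Assume that $\mu(\tau>t)=\ell(t)t^{-\beta}$ where $\beta\in[0,1]$, and that hypothesis (H) (stated in the context) holds. Let $A,B\subset Y$ be measurable with $1_A\in\mathcal{B}$. Then $$\lim_{t\to\infty}t^{-1}m(t)\,U_{A,B}(t)=D_{\beta}\,\mu(A)\mu(B),$$ where $D_\beta=\{\Gamma(1-\beta)\Gamma(1+\beta)\}^{-1}$ if $\beta\in(0,1)$ and $D_0=D_1=1$.
   Context: $(Y,\mu)$ is a probability space, $F:Y\to Y$ is an ergodic and mixing measure-preserving transformation, and $\tau:Y\to\mathbb{R}^+$ is a measurable nonintegrable function with $\operatorname{ess\,inf}\tau>1$. The function $\ell:[0,\infty)\to[0,\infty)$ is measurable and slowly varying, i.e. $\lim_{t\to\infty}\ell(\lambda t)/\ell(t)=1$ for all $\lambda>0$. Write $\tau_n=\sum_{j=0}^{n-1}\tau\circ F^j$. For measurable $A,B\subset Y$ define the renewal measure $U_{A,B}(I)=\sum_{n=0}^\infty\mu(y\in A\cap F^{-n}B:\tau_n(y)\in I)$ for intervals $I\subset\mathbb{R}$, and $U_{A,B}(x)=U_{A,B}([0,x])$ for $x>0$. $m(t)=\ell(t)t^{1-\beta}$ if $\beta<1$, and $m(t)=\int_1^t\ell(s)s^{-1}\,ds$ if $\beta=1$. Operators: $\overline{\mathbb{H}}=\{s\in\mathbb{C}:\operatorname{Re}s\ge0\}$; for $\delta,L>0$, $\mathbb{H}_{\delta,L}=(\overline{\mathbb{H}}\cap B_\delta(0))\cup\{ib:|b|\le L\}$. $R:L^1(Y)\to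 L^1(Y)$ is the transfer operator of $F$: $\int_Y Rv\,w\,d\mu=\int_Y v\,w\circ F\,d\mu$ for $v\in L^1(Y)$, $w\in L^\infty(Y)$. For $s\in\overline{\mathbb{H}}$, $\hat R(s):L^1(Y)\to L^1(Y)$, $\hat R(s)v=R(e^{-s\tau}v)$. $|\cdot|_p$ is the $L^p(Y,\mu)$ norm. Hypothesis (H): there exists $p_0\ge1$, and for each $p\in(p_0,\infty)$, $\gamma\in(0,\beta)$ and $L>0$ there exists a Banach space $\mathcal{B}=\mathcal{B}(Y)$ containing constant functions, with norm $\|\cdot\|_{\mathcal{B}}$, and constants $\delta\in(0,L)$, $\alpha_0\in(0,1)$, $C>0$ such that (i) $\mathcal{B}$ is compactly embedded in $L^p$; (ii) $\|\hat R(s)^nv\|_{\mathcal{B}}\le C(|v|_p+\alpha_0^n\|v\|_{\mathcal{B}})$ for all $s\in\mathbb{H}_{\delta,L}$, $v\in\mathcal{B}$, $n\ge1$; (iii) $|R(\tau^\gamma v)|_p\le C\|v\|_{\mathcal{B}}$ for all $v\in\mathcal{B}$. In the condition $1_A\in\mathcal{B}$, $\mathcal{B}$ is the Banach space in (H).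
   Formalization: The case β=0 (D_0=1) is not covered: there γ∈(0,β) is empty, so (H) provides no space B and ''1_A∈B'' has no meaning; the result is proved for β∈(0,1], with 1_A in the space B for some admissible (p,γ,L). *)

(* Defs.v *)
From HB Require Import structures.
From mathcomp Require Import all_boot all_order all_algebra.
From mathcomp Require Import complex.
From mathcomp Require Import all_classical all_reals all_analysis.

Set Implicit Arguments.
Unset Strict Implicit.
Unset Printing Implicit Defensive.

Import Order.TTheory GRing.Theory Num.Theory.
Import numFieldNormedType.Exports.

Local Open Scope classical_set_scope.
Local Open Scope ring_scope.
Local Open Scope complex_scope.

Section Dynamics.
Context {R : realType} {d : measure_display} {Y : measurableType d}.
Variable mu : probability Y R.

Definition measure_preserving (F : Y -> Y) : Prop :=
  measurable_fun [set: Y] F /\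
  forall A : set Y, measurable A -> mu (F @^-1` A) = mu A.

Definition ergodic (F : Y -> Y) : Prop :=
  forall A : set Y, measurable A -> F @^-1` A = A ->
    (mu A = 0 \/ mu A = 1)%E.

Definition mixing (F : Y -> Y) : Prop :=
  forall A B : set Y, measurable A -> measurable B ->
    (fun n => mu (A `&` (iter n F) @^-1` B)) @ \oo --> (mu A * mu B)%E.

Definition birkhoff_sum (F : Y -> Y) (tau : Y -> R) (n : nat) (y : Y) : R :=
  \sum_(j < n) tau (iter j F y).

Definition renewal_measure (F : Y -> Y) (tau : Y -> R) (A B : set Y)
    (I : interval R) : \bar R :=
  (\sum_(0 <= n <oo)
     mu (A `&` (iter n F) @^-1` B `&`
         [set y | birkhoff_sum F tau n y \in I]))%E.

Definition renewal_fun (F : Y -> Y) (tau : Y -> R) (A B : set Y) (x : R)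
    : \bar R :=
  renewal_measure F tau A B `[0, x].

End Dynamics.

Section Asymptotics.
Context {R : realType}.

Definition slowly_varying (ell : R -> R) : Prop :=
  forall lambda : R, 0 < lambda ->
    ell (lambda * t) / ell t @[t --> +oo] --> (1 : R).

Definition mfun_ell (beta : R) (ell : R -> R) (t : R) : R :=
  if beta < 1 then ell t * t `^ (1 - beta)
  else \int[lebesgue_measure]_(s in `[1, t]) (ell s * s^-1).

Definition Gamma (x : R) : R :=
  \int[lebesgue_measure]_(u in `]0, +oo[) (u `^ (x - 1) * expR (- u)).

Definition Dconst (beta : R) : R :=
  if (0 < beta) && (beta < 1) then (Gamma (1 - beta) * Gamma (1 + beta))^-1
  else 1.

End Asymptotics.

(* Complex-valued functions on Y are identified when they agree almost
   everywhere, so every relation between elements of an L^p space below is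
   stated modulo mu-a.e. equality of representatives. *)
Section ComplexFunctions.
Context {R : realType} {d : measure_display} {Y : measurableType d}.
Variable mu : probability Y R.
Implicit Types v w : Y -> R[i].

Definition cmeasurable v : Prop :=
  measurable_fun [set: Y] (fun y => complex.Re (v y)) /\
  measurable_fun [set: Y] (fun y => complex.Im (v y)).

Definition cLnorm (p : \bar R) v : \bar R :=
  Lnorm mu p (fun y => (Normc.normc (v y))%:E).

Definition in_Lp (p : \bar R) v : Prop :=
  cmeasurable v /\ (cLnorm p v < +oo)%E.

Definition cintegral v : R[i] :=
  (\int[mu]_y complex.Re (v y)) +i* (\int[mu]_y complex.Im (v y)).

Definition cexp (z : R[i]) : R[i] :=
  (expR (complex.Re z))%:C * (cos (complex.Im z) +i* sin (complex.Im z)).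

Definition transfer_operator (F : Y -> Y)
    (P : (Y -> R[i]) -> (Y -> R[i])) : Prop :=
  forall v, in_Lp 1 v ->
    in_Lp 1 (P v) /\
    forall w, in_Lp +oo w ->
      cintegral (fun y => P v y * w y) = cintegral (fun y => v y * w (F y)).

Definition Rhat (P : (Y -> R[i]) -> (Y -> R[i])) (tau : Y -> R) (s : R[i]) v
    : Y -> R[i] :=
  P (fun y => cexp (- s * (tau y)%:C) * v y).

(* A complex Banach space whose elements are (a.e. classes of) measurable
   complex functions on Y: [fs_fun u] is a representative of the class of u. *)
Record function_space := FunctionSpace {
  fs_sort :> completeNormedModType R[i];
  fs_fun : fs_sort -> Y -> R[i];
  fs_measurable : forall u, cmeasurable (fs_fun u);
  fs_linear : forall (a : R[i]) (u v : fs_sort),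
    ae_eq mu [set: Y] (fs_fun (a *: u + v))
                      (fun y => a * fs_fun u y + fs_fun v y);
  fs_inj : forall u v : fs_sort,
    ae_eq mu [set: Y] (fs_fun u) (fs_fun v) -> u = v
}.

(* The norm of a normed module over R[i] takes values in R[i]; it is a
   nonnegative real number, recovered by its real part. *)
Definition fs_norm (B : function_space) (u : B) : R := complex.Re `|u|.

Definition in_space (B : function_space) v : Prop :=
  exists u : B, ae_eq mu [set: Y] (fs_fun u) v.

Definition contains_constants (B : function_space) : Prop :=
  forall c : R[i], in_space B (cst c).

Definition compactly_embedded (B : function_space) (p : R) : Prop :=
  (forall u : B, in_Lp p%:E (fs_fun u)) /\
  forall u_ : nat -> B,
    (exists M : R, forall n, fs_norm (u_ n) <= M) ->
    exists (phi : nat -> nat) (w : Y -> R[i]),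
      {homo phi : m n / (m < n)%N} /\ in_Lp p%:E w /\
      cLnorm p%:E (fun y => fs_fun (u_ (phi n)) y - w y) @[n --> \oo]
        --> (0 : \bar R).

Definition Hregion (delta L : R) : set (R[i]) :=
  [set s | 0 <= complex.Re s /\ Normc.normc s < delta] `|`
  [set s | exists2 b : R, `|b| <= L & s = 0 +i* b].

Definition lasota_yorke (P : (Y -> R[i]) -> (Y -> R[i])) (tau : Y -> R)
    (B : function_space) (p L delta alpha0 C : R) : Prop :=
  forall (s : R[i]) (u : B) (n : nat), Hregion delta L s -> (1 <= n)%N ->
    exists2 w : B,
      ae_eq mu [set: Y] (fs_fun w) (iter n (Rhat P tau s) (fs_fun u)) &
      ((fs_norm w)%:E <=
        C%:E * (cLnorm p%:E (fs_fun u) + (alpha0 ^+ n * fs_norm u)%:E))%E.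

(* P acts on L^1 only, so tau^gamma v \in L^1 is part of the condition. *)
Definition moment_bound (P : (Y -> R[i]) -> (Y -> R[i])) (tau : Y -> R)
    (B : function_space) (p gamma C : R) : Prop :=
  forall u : B,
    let tv := fun y => (tau y `^ gamma)%:C * fs_fun u y in
    in_Lp 1 tv /\ (cLnorm p%:E (P tv) <= (C * fs_norm u)%:E)%E.

Definition admissible (p0 beta p gamma L : R) : Prop :=
  p0 < p /\ 0 < gamma < beta /\ 0 < L.

(* The space asserted to exist for each (p, gamma, L) is given as a family:
   [B p gamma L] is the space chosen for these parameters. *)
Definition hypothesis_H (P : (Y -> R[i]) -> (Y -> R[i])) (tau : Y -> R)
    (beta p0 : R) (B : R -> R -> R -> function_space) : Prop :=
  1 <= p0 /\
  forall p gamma L : R, admissible p0 beta p gamma L ->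
    contains_constants (B p gamma L) /\
    exists delta alpha0 C : R,
      [/\ 0 < delta < L, 0 < alpha0 < 1 & 0 < C] /\
      [/\ compactly_embedded (B p gamma L) p,
          lasota_yorke P tau (B p gamma L) p L delta alpha0 C &
          moment_bound P tau (B p gamma L) p gamma C].

End ComplexFunctions.

(* Main.v *)
(** Everything reduces to bounded real functions and real [s > 0]. Put
    [Phi s = E (1 - exp (- s tau))] and let [vN s N] be the sum over [k < N] of
    the [k]-th iterates of [f |-> R (exp (- s tau) f)] at the constant [1].
    The Lasota-Yorke inequality, the compact embedding in [L^p] and mixing give
    a spectral gap at [s = 0], so that [vN s N] stays close in [L^p] to the
    constant [E (vN s N)], with relative error [O (s ^ (gamma / 2))]; for [p]
    large, Chebyshev's inequality turns the identity
    [E ((1 - exp (- s tau)) vN) = 1 - E (exp (- s tau_N))] into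
    [E (vN s N) * Phi s -> 1].
    An [L^2] bound on the sums of [exp (- s tau_k) 1_B o F^k], together with
    the convergence of [R^n 1_A] to [mu A] in [L^1], then shows that the Laplace
    transform [H] of the renewal measure satisfies
    [H s * Phi s -> mu A * mu B]. Karamata's Tauberian theorem gives the
    asymptotics of [U], and Abelian estimates of [Phi] identify the constant.
    The case [beta = 0] is vacuous, since then no [gamma] is admissible. *)

Require Import Defs.
From HB Require Import structures.
From mathcomp Require Import all_boot all_order all_algebra.
From mathcomp Require Import complex.
From mathcomp Require Import all_classical all_reals all_analysis.
From mathcomp Require Import ess_sup_inf.
From mathcomp Require Import measurable_realfun.
From mathcomp Require Import lra ring.
Import Order.TTheory GRing.Theory Num.Theory.
Import numFieldNormedType.Exports.
Local Open Scope classical_set_scope.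
Local Open Scope ring_scope.
Local Open Scope complex_scope.

Set Implicit Arguments.
Unset Strict Implicit.
Unset Printing Implicit Defensive.

(** * Expectations and norms of bounded functions *)

Section BoundedFunctions.
Context {R : realType} {d : measure_display} {Y : measurableType d}.
Variable mu : probability Y R.
Implicit Types f g h w : Y -> R.

(** The obstacle is that the twisted operators are compared with the one at [s = 0] only from the
    Banach space to [L^p], with loss [s ^ gamma], so the leading eigenvalue is not perturbed
    directly. Instead, the gap of the untwisted operator is applied to the centered part of [vN],
    which is almost invariant: after [k] blocks of steps the gap leaves a term of order [1 / k],
    while the lack of invariance costs [k * s ^ gamma]. Balancing the two gives the exponent
    [gamma / 2]. No inverse of the identity minus the twisted operator is formed: [N] stays finite
    with [s * N] large, and [tau_N >= N] bounds what is cut off by [exp (- s N)]. The Chebyshev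
    error is of order [s ^ (p * gamma / 2)], which must be negligible before [Phi s], of index
    [beta]; hence the condition [p * gamma / 2 > beta]. The parameters meeting it need not be those
    for which [1_A] lies in the Banach space, so [A] enters only through the [L^1] decay of the
    iterates of [1_A], proved in its own space. *)

Definition bmf f : Prop :=
  measurable_fun [set: Y] f /\ exists M, forall y, `|f y| <= M.

Lemma measurable_ltset f g : measurable_fun [set: Y] f ->
  measurable_fun [set: Y] g -> measurable [set y | f y < g y].
Proof.
move=> mf mg; have := measurable_fun_ltr mf mg measurableT (Y := [set true]).
by rewrite setTI; apply.
Qed.

Lemma measurable_leset f g : measurable_fun [set: Y] f ->
  measurable_fun [set: Y] g -> measurable [set y | f y <= g y].
Proof.
move=> mf mg; have := measurable_fun_ler mf mg measurableT (Y := [set true]).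
by rewrite setTI; apply.
Qed.

Lemma measurable_sg f : measurable_fun [set: Y] f ->
  measurable_fun [set: Y] (fun y => Num.sg (f y)).
Proof.
move=> mf; have -> : (fun y => Num.sg (f y)) =
    (fun y => \1_[set y | 0 < f y] y - \1_[set y | f y < 0] y).
  apply/funext => y; rewrite !indicE /in_mem/= /mem/= /in_set !asboolb.
  by case: (ltrgtP (f y) 0) => h; rewrite ?(ltr0_sg h) ?(gtr0_sg h) ?h
    ?sgr0 ?subrr ?sub0r ?subr0.
by apply: measurable_funB; apply: measurable_indic; apply: measurable_ltset.
Qed.

(* Sealed, so that conversion never unfolds an integral. *)
Fact E_seal : {g : (Y -> R) -> R | g = fun f => \int[mu]_y f y}.
Proof. by exists (fun f => \int[mu]_y f y). Qed.

Definition E f : R := sval E_seal f.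

Lemma EE f : E f = \int[mu]_y f y.
Proof. by rewrite /E (svalP E_seal). Qed.

Definition aeq f g : Prop := {ae mu, forall y, f y = g y}.

Definition ale f g : Prop := {ae mu, forall y, f y <= g y}.

Lemma bmf_cst c : bmf (fun=> c).
Proof. by split; [exact: measurable_cst | exists `|c|]. Qed.

Lemma bmf_add f g : bmf f -> bmf g -> bmf (fun y => f y + g y).
Proof.
move=> [mf [M fM]] [mg [K gK]]; split; first exact: measurable_funD.
by exists (M + K) => y; rewrite (le_trans (ler_normD _ _))// lerD.
Qed.

Lemma bmf_mul f g : bmf f -> bmf g -> bmf (fun y => f y * g y).
Proof.
move=> [mf [M fM]] [mg [K gK]]; split; first exact: measurable_funM.
by exists (M * K) => y; rewrite normrM ler_pM.
Qed.

Lemma bmf_opp f : bmf f -> bmf (fun y => - f y).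
Proof.
move=> [mf [M fM]]; split; first exact: measurableT_comp.
by exists M => y; rewrite normrN.
Qed.

Lemma bmf_sub f g : bmf f -> bmf g -> bmf (fun y => f y - g y).
Proof. by move=> bf bg; apply: bmf_add => //; exact: bmf_opp. Qed.

Lemma bmf_abs f : bmf f -> bmf (fun y => `|f y|).
Proof.
move=> [mf [M fM]]; split; first exact: measurableT_comp.
by exists M => y; rewrite normr_id.
Qed.

Lemma bmf_exp f n : bmf f -> bmf (fun y => f y ^+ n).
Proof.
move=> bf; elim: n => [|n IH]; first exact: bmf_cst.
by under eq_fun do rewrite exprS; exact: bmf_mul.
Qed.

Lemma bmf_comp f (G : Y -> Y) : measurable_fun [set: Y] G -> bmf f ->
  bmf (fun y => f (G y)).
Proof. by move=> mG [mf [M fM]]; split; [exact: measurableT_comp | exists M]. Qed.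

Lemma bmf_sum (I : Type) (r : seq I) (P : pred I) (f : I -> Y -> R) :
  (forall i, P i -> bmf (f i)) -> bmf (fun y => \sum_(i <- r | P i) f i y).
Proof.
move=> bf; elim: r => [|i r IH].
  by under eq_fun do rewrite big_nil; exact: bmf_cst.
under eq_fun do rewrite big_cons.
by case Pi: (P i) => //; apply: bmf_add => //; exact: bf.
Qed.

Lemma bmf_indic (A : set Y) : measurable A -> bmf (fun y => \1_A y).
Proof.
move=> mA; split; first exact: measurable_indic.
by exists 1 => y; rewrite indicE ger0_norm ?ler0n// lern1 leq_b1.
Qed.

Lemma bmf_expRN f : measurable_fun [set: Y] f -> (forall y, 0 <= f y) ->
  bmf (fun y => expR (- f y)).
Proof.
move=> mf f0; split; first exact/measurableT_comp/measurableT_comp.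
by exists 1 => y; rewrite ger0_norm ?expR_ge0// -expR0 ler_expR oppr_le0.
Qed.

Lemma bmf_max f g : bmf f -> bmf g -> bmf (fun y => Num.max (f y) (g y)).
Proof.
move=> [mf [M fM]] [mg [K gK]]; split; first exact: measurable_maxr.
exists (M + K) => y; have M0 := le_trans (normr_ge0 _) (fM y).
have K0 := le_trans (normr_ge0 _) (gK y).
case: (leP (f y) (g y)) => _; first by rewrite (le_trans (gK y))// lerDr.
by rewrite (le_trans (fM y))// lerDl.
Qed.

Lemma bmf_integrable f : bmf f -> mu.-integrable [set: Y] (EFin \o f).
Proof.
move=> [mf [M fM]]; apply: (@measurable_bounded_integrable _ _ _ mu) => //.
  by rewrite (le_lt_trans (probability_le1 _ _))// ltry.
exists M; split; first by rewrite num_real.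
by move=> x Mx y _ /=; rewrite (le_trans (fM y))// ltW.
Qed.
Hint Resolve bmf_integrable : core.

Lemma E_add f g : bmf f -> bmf g -> E (fun y => f y + g y) = E f + E g.
Proof. by move=> bf bg; rewrite !EE RintegralD//; exact: bmf_integrable. Qed.

Lemma E_sub f g : bmf f -> bmf g -> E (fun y => f y - g y) = E f - E g.
Proof. by move=> bf bg; rewrite !EE RintegralB//; exact: bmf_integrable. Qed.

Lemma E_scale a f : bmf f -> E (fun y => a * f y) = a * E f.
Proof. by move=> bf; rewrite !EE RintegralZl//; exact: bmf_integrable. Qed.

Lemma E_cst c : E (fun=> c) = c.
Proof.
rewrite !EE Rintegral_cst//.
transitivity (c * fine (1%E : \bar R)); last by rewrite mulr1.
by congr (c * fine _); exact: probability_setT.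
Qed.

Lemma E_indic (A : set Y) : measurable A -> E (fun y => \1_A y) = fine (mu A).
Proof. by move=> mA; rewrite !EE /Rintegral integral_indic// setIT. Qed.

Lemma E_EFin f : bmf f -> (\int[mu]_y (f y)%:E)%E = (E f)%:E.
Proof.
move=> bf; rewrite !EE /Rintegral fineK//.
exact: (integrable_fin_num measurableT (bmf_integrable bf)).
Qed.

Lemma E_le_ae f g : bmf f -> bmf g -> ale f g -> E f <= E g.
Proof.
move=> bf bg fg; rewrite -subr_ge0 -E_sub//; set h := fun y => _.
have bh : bmf h by exact: bmf_sub.
rewrite -lee_fin -E_EFin//.
have -> : (\int[mu]_y (h y)%:E = \int[mu]_y `|h y|%:E)%E.
  apply: ae_eq_integral => //.
  - exact/measurable_EFinP/(proj1 bh).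
  - exact/measurable_EFinP/(proj1 (bmf_abs bh)).
  - by apply: filterS fg => y fgy _; rewrite /= ger0_norm // /h subr_ge0.
by apply: integral_ge0 => y _; rewrite lee_fin.
Qed.

Lemma E_le f g : bmf f -> bmf g -> (forall y, f y <= g y) -> E f <= E g.
Proof. by move=> bf bg fg; apply: E_le_ae => //; exact: aeW. Qed.

Lemma E_ge0 f : (forall y, 0 <= f y) -> 0 <= E f.
Proof. by move=> f0; rewrite EE; apply: Rintegral_ge0. Qed.

Lemma aeq_ale f g : aeq f g -> ale f g.
Proof. by apply: filterS => y ->. Qed.

Lemma aeq_sym f g : aeq f g -> aeq g f.
Proof. by apply: filterS => y ->. Qed.

Lemma aeq_trans f g h : aeq f g -> aeq g h -> aeq f h.
Proof. by apply: filterS2 => y -> ->. Qed.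

Lemma E_aeq f g : bmf f -> bmf g -> aeq f g -> E f = E g.
Proof.
move=> bf bg fg; apply/eqP; rewrite eq_le !E_le_ae//.
  exact/aeq_ale/aeq_sym.
exact: aeq_ale.
Qed.

Lemma E_ext f g : (forall y, f y = g y) -> E f = E g.
Proof. by move=> fg; congr (E _); exact/funext. Qed.

Lemma E_sum (I : Type) (r : seq I) (P : pred I) (f : I -> Y -> R) :
  (forall i, P i -> bmf (f i)) ->
  E (fun y => \sum_(i <- r | P i) f i y) = \sum_(i <- r | P i) E (f i).
Proof.
move=> bf; elim: r => [|i r IH].
  by rewrite big_nil -[RHS](E_cst 0); apply: E_ext => y; rewrite big_nil.
rewrite big_cons; case: ifPn => Pi.
  rewrite -IH -E_add//; [|exact: bf|exact: bmf_sum].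
  by apply: E_ext => y; rewrite big_cons Pi.
by rewrite -IH; apply: E_ext => y; rewrite big_cons (negbTE Pi).
Qed.

Lemma E_norm f : bmf f -> `|E f| <= E (fun y => `|f y|).
Proof. by move=> bf; rewrite !EE; apply: le_normr_Rintegral => //; exact: bmf_integrable. Qed.

Lemma E_eq0 f : bmf f -> ale (fun=> 0) f -> E f = 0 -> aeq f (fun=> 0).
Proof.
move=> bf f0 Ef0; have ba := bmf_abs bf.
have /(ae_eq_integral_abs mu measurableT) : measurable_fun [set: Y] (EFin \o f).
  exact/measurable_EFinP/(proj1 bf).
move=> [] H _; have {H}/H : (\int[mu]_y `|(EFin \o f) y| = 0)%E.
  rewrite (_ : (fun y => _) = (fun y => `|f y|%:E))//.
  transitivity (E f)%:E; last by rewrite Ef0.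
  rewrite E_EFin//; congr EFin; apply: E_aeq => //.
  by apply: filterS f0 => y /ger0_norm.
by apply: filterS => y /(_ I)[].
Qed.

(** The test is the positive part [w] of [f - g]: then [E (w ^ 2) = E ((f - g) * w) <= 0], so [w]
    vanishes almost everywhere. Facts about transfer operators, which are known through duality, are
    obtained from such tests. *)
Lemma ale_test f g : bmf f -> bmf g ->
  (forall w, bmf w -> (forall y, 0 <= w y) ->
    E (fun y => f y * w y) <= E (fun y => g y * w y)) -> ale f g.
Proof.
move=> bf bg H; pose w y := Num.max (f y - g y) 0.
have bw : bmf w by apply: bmf_max; [exact: bmf_sub|exact: bmf_cst].
have w0 y : 0 <= w y by rewrite le_max lexx orbT.
have bw2 : bmf (fun y => w y ^+ 2) by exact: bmf_exp.
have : E (fun y => w y ^+ 2) <= 0.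
  rewrite (_ : (fun y => _) = (fun y => f y * w y - g y * w y)).
    by rewrite E_sub ?subr_le0 ?H//; exact: bmf_mul.
  apply/funext => y; rewrite -mulrBl expr2 /w.
  by case: (leP (f y - g y) 0) => // _; rewrite !mulr0.
move=> Ew; have : E (fun y => w y ^+ 2) = 0.
  by apply/eqP; rewrite eq_le Ew E_ge0// => y; exact: sqr_ge0.
move=> /(E_eq0 bw2 _); have w20 : ale (fun=> 0) (fun y => w y ^+ 2).
  by apply: aeW => y; exact: sqr_ge0.
move=> /(_ w20); apply: filterS => y /eqP; rewrite sqrf_eq0 /w.
by case: (leP (f y - g y) 0) => [|fg /eqP e]; [rewrite subr_le0|rewrite e ltxx in fg].
Qed.

Lemma aeq_test f g : bmf f -> bmf g ->
  (forall w, bmf w -> E (fun y => f y * w y) = E (fun y => g y * w y)) ->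
  aeq f g.
Proof.
move=> bf bg H; have fg : ale f g by apply: ale_test => // w bw _; rewrite H.
have gf : ale g f by apply: ale_test => // w bw _; rewrite H.
by apply: filterS2 fg gf => y ? ?; apply/eqP; rewrite eq_le; apply/andP.
Qed.

Lemma E_sq_ge0 f : 0 <= E (fun y => f y ^+ 2).
Proof. by apply: E_ge0 => y; exact: sqr_ge0. Qed.

Lemma cauchy_schwarz f g : bmf f -> bmf g ->
  `|E (fun y => f y * g y)| <=
    Num.sqrt (E (fun y => f y ^+ 2)) * Num.sqrt (E (fun y => g y ^+ 2)).
Proof.
move=> bf bg; have bf2 := bmf_exp 2 bf; have bg2 := bmf_exp 2 bg.
have bfg := bmf_mul bf bg.
set a := E (fun y => f y ^+ 2); set b := E (fun y => g y ^+ 2).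
set c := E (fun y => f y * g y).
have a0 : 0 <= a by exact: E_sq_ge0.
have b0 : 0 <= b by exact: E_sq_ge0.
have H x z : 0 <= x ^+ 2 * a + 2 * x * z * c + z ^+ 2 * b.
  have -> : x ^+ 2 * a + 2 * x * z * c + z ^+ 2 * b =
      E (fun y => (x * f y + z * g y) ^+ 2); last exact: E_sq_ge0.
  rewrite -!E_scale// -!E_add; first (by apply: E_ext => y; ring);
  rewrite ?/a; do ?[exact: bmf_add]; do ?[apply: bmf_mul => //; exact: bmf_cst].
  by apply: bmf_add; apply: bmf_mul => //; exact: bmf_cst.
rewrite -sqrtrM// -sqrtr_sqr ler_sqrt ?mulr_ge0//.
(* The choice [x = b], [z = - c] turns the quadratic form into [b * (a * b - c ^ 2)]. When [b = 0]
   this says nothing; then [x = - c], [z = a + 1] gives [- c ^ 2 * (a + 2) >= 0], which forces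
   [c = 0]. *)
have [b1|b1] := eqVneq b 0.
  have := H (- c) (a + 1); have := H c 1; have := H 1 (-c); have := H 1 c; have := H c (a+1).
  rewrite b1; nra.
have := H b (- c); have : 0 < b by rewrite lt_def b1.
move=> bp; rewrite (_ : _ + _ = b * (a * b - c ^+ 2)); last by ring.
by rewrite pmulr_rge0// subr_ge0.
Qed.

Lemma E_bounded_cvg (f_ : nat -> Y -> R) f (M : R) :
  (forall n, measurable_fun [set: Y] (f_ n)) -> measurable_fun [set: Y] f ->
  (forall n y, `|f_ n y| <= M) -> (forall y, f_ n y @[n --> \oo] --> f y) ->
  E (f_ n) @[n --> \oo] --> E f.
Proof.
move=> mf_ mf fM cf.
have bf_ n : bmf (f_ n) by split; [exact: mf_|exists M => y; exact: fM].
have bf : bmf f.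
  split => //; exists M => y.
  have cn : `|f_ n y| @[n --> \oo] --> `|f y| by apply: cvg_norm; exact: cf.
  rewrite -(cvg_lim (@Rhausdorff R) cn); apply: limr_le.
    by apply/cvg_ex; exists `|f y|.
  exact: nearW.
have [] := @dominated_convergence _ Y R mu setT measurableT
  (fun n y => (f_ n y)%:E) (fun y => (f y)%:E) (fun=> M%:E).
- by move=> n; exact/measurable_EFinP.
- exact/measurable_EFinP.
- by apply: aeW => y _; apply: cvg_EFin; [exact: nearW|exact: cf].
- exact: (bmf_integrable (bmf_cst M)).
- by apply: aeW => y n _; rewrite lee_fin.
move=> _ _; rewrite E_EFin// => h.
have : (E (f_ n))%:E @[n --> \oo] --> (E f)%:E.
  move: h; rewrite (_ : [sequence _]_n = fun n => (E (f_ n))%:E)//.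
  by apply/funext => n; rewrite /= E_EFin.
by move/fine_cvg.
Qed.

End BoundedFunctions.

(** * The [L^p] norm of bounded functions *)

Section LpNorm.
Context {R : realType} {d : measure_display} {Y : measurableType d}.
Variable mu : probability Y R.
Variable p : R.
Hypothesis p1 : 1 <= p.
Implicit Types f g h w : Y -> R.
Local Notation E := (E mu).
Local Notation aeq := (aeq mu).
Local Notation ale := (ale mu).

Let p0 : 0 < p. Proof. exact: lt_le_trans ltr01 p1. Qed.

Fact Np_seal :
  {g : (Y -> R) -> R | g = fun f => (E (fun y => `|f y| `^ p)) `^ p^-1}.
Proof. by exists (fun f => (E (fun y => `|f y| `^ p)) `^ p^-1). Qed.

Definition Np f : R := sval Np_seal f.

Lemma Np_def f : Np f = (E (fun y => `|f y| `^ p)) `^ p^-1.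
Proof. by rewrite /Np (svalP Np_seal). Qed.

Lemma bmf_powR f (r : R) : 0 <= r -> bmf f -> bmf (fun y => `|f y| `^ r).
Proof.
move=> r0 [mf [M fM]]; split.
  by apply: (measurableT_comp (measurable_powR r)); exact: measurableT_comp.
exists (M `^ r) => y; rewrite ger0_norm ?powR_ge0//.
by apply: ge0_ler_powR => //; rewrite nnegrE// (le_trans _ (fM y)).
Qed.

Lemma NpE f : bmf f -> ('N[mu]_p%:E[EFin \o f] = (Np f)%:E)%E.
Proof.
move=> bf; rewrite unlock Np_def -poweR_EFin -E_EFin; last exact/bmf_powR/bf/ltW.
by congr (_ `^ _)%E; apply: eq_integral => y _; rewrite -poweR_EFin abse_EFin.
Qed.

Lemma Np_ge0 f : 0 <= Np f.
Proof. by rewrite Np_def powR_ge0. Qed.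

Lemma Np_powR f : Np f `^ p = E (fun y => `|f y| `^ p).
Proof.
rewrite !Np_def -powRrM mulVf ?gt_eqF// powRr1//.
by apply: E_ge0 => y; exact: powR_ge0.
Qed.

Lemma Np_add f g : bmf f -> bmf g -> Np (fun y => f y + g y) <= Np f + Np g.
Proof.
move=> bf bg.
have := @minkowski_EFin _ _ _ mu f g p (proj1 bf) (proj1 bg) p1.
by rewrite (NpE bf) (NpE bg) (NpE (bmf_add bf bg)) -EFinD lee_fin.
Qed.

Lemma Np_ale f g : bmf f -> bmf g ->
  {ae mu, forall y, `|f y| <= `|g y|} -> Np f <= Np g.
Proof.
move=> bf bg fg; rewrite !Np_def.
apply: ge0_ler_powR; first (by rewrite invr_ge0 ltW); rewrite ?nnegrE.
- by apply: E_ge0 => y; exact: powR_ge0.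
- by apply: E_ge0 => y; exact: powR_ge0.
apply: E_le_ae; try exact/bmf_powR/bf/ltW; try exact/bmf_powR/bg/ltW.
apply: filterS fg => y fgy.
by apply: ge0_ler_powR => //; exact: ltW.
Qed.

Lemma Np_le f g : bmf f -> bmf g -> (forall y, `|f y| <= `|g y|) -> Np f <= Np g.
Proof. by move=> bf bg fg; apply: Np_ale => //; exact: aeW. Qed.

Lemma Np_aeq f g : bmf f -> bmf g -> aeq f g -> Np f = Np g.
Proof.
move=> bf bg fg; apply: le_anti; apply/andP; split; apply: Np_ale.
- exact: bf.
- exact: bg.
- by apply: filterS fg => y ->.
- exact: bg.
- exact: bf.
- by apply: filterS fg => y ->.
Qed.

Lemma Np_eqabs f g : (forall y, `|f y| = `|g y|) -> Np f = Np g.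
Proof.
move=> fg; rewrite !Np_def.
by rewrite (E_ext mu (fun y => f_equal (fun z => z `^ p) (fg y))).
Qed.

Lemma Np_scale a f : bmf f -> Np (fun y => a * f y) = `|a| * Np f.
Proof.
move=> bf; rewrite !Np_def.
rewrite (_ : E _ = `|a| `^ p * E (fun y => `|f y| `^ p)).
  rewrite powRM ?powR_ge0//; last by apply: E_ge0 => y; exact: powR_ge0.
  by rewrite -powRrM mulfV ?gt_eqF// powRr1.
rewrite -E_scale; last exact/bmf_powR/bf/ltW.
by apply: E_ext => y; rewrite normrM powRM.
Qed.

Lemma Np_opp f : Np (fun y => - f y) = Np f.
Proof. by apply: Np_eqabs => y; rewrite normrN. Qed.

Lemma Np_sub f g : bmf f -> bmf g -> Np (fun y => f y - g y) <= Np f + Np g.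
Proof. by move=> bf bg; rewrite -(Np_opp g) Np_add//; exact: bmf_opp. Qed.

Lemma Np_cst c : Np (fun=> c) = `|c|.
Proof. by rewrite !Np_def E_cst -powRrM mulfV ?gt_eqF// powRr1. Qed.

Lemma E_abs_le_Np f : bmf f -> E (fun y => `|f y|) <= Np f.
Proof.
move=> bf; have baf := bmf_abs bf.
(* Hoelder's inequality against the constant [1] is used with a finite conjugate exponent, so
   [p = 1] is treated apart. *)
move: p1; rewrite le_eqVlt => /predU1P[p1'|p1'].
  rewrite !Np_def -p1' invr1 powRr1; last by apply: E_ge0 => y; exact: powR_ge0.
  by rewrite (E_ext _ (fun y => powRr1 (normr_ge0 (f y)))).
pose q := (1 - p^-1)^-1.
have q0 : 0 < q by rewrite invr_gt0 subr_gt0 invf_lt1.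
have pq : p^-1 + q^-1 = 1 by rewrite invrK addrC subrK.
have := @hoelder _ _ _ mu (fun y => `|f y|) (cst 1) p q
  (proj1 baf) (measurable_cst _) p0 q0 pq.
rewrite NpE// Lnorm1 [in X in (_ <= _ * X)%E -> _](_ : EFin \o cst 1 = cst 1%E)//.
have -> : ('N[mu]_q%:E[cst 1] = 1)%E.
  rewrite Lnorm_cst1 -[RHS](poweR1r q^-1); congr (_ `^ _)%E.
  exact: probability_setT.
rewrite mule1 (_ : \int[mu]_x _ = (E (fun y => `|f y|))%:E)%E.
  rewrite lee_fin => /le_trans; apply.
  by rewrite Np_le// => y; rewrite normr_id.
by rewrite -E_EFin//; apply: eq_integral => y _; rewrite /= mulr1 normr_id.
Qed.

Lemma E_le_Np f w : bmf f -> bmf w -> (forall y, `|w y| <= 1) ->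
  `|E (fun y => f y * w y)| <= Np f.
Proof.
move=> bf bw w1; have bfw := bmf_mul bf bw.
apply: (le_trans (E_norm mu bfw)).
apply: le_trans (E_abs_le_Np bf); apply: E_le; do ?exact: bmf_abs.
by move=> y; rewrite normrM ler_piMr.
Qed.

(** Where [|f| <= eta] the integrand is at most [eta * Psi]; elsewhere
    [|f| <= eta ^ (1 - p) * |f| ^ p]. This form of Chebyshev's inequality keeps the weight in the
    main term: for [Psi = 1 - exp (- s tau)] that term is a multiple of [Phi s]. *)
Lemma E_tail_le f Psi (eta : R) : bmf f -> bmf Psi -> (forall y, 0 <= Psi y <= 1) ->
  0 < eta ->
  E (fun y => Psi y * `|f y|) <= eta * E Psi + eta `^ (1 - p) * Np f `^ p.
Proof.
move=> bf bP P01 eta0.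
have bp := bmf_powR (ltW p0) bf.
rewrite Np_powR -!E_scale// -E_add; do ?[by apply: bmf_mul => //; exact: bmf_cst].
apply: E_le; first exact/bmf_mul/bmf_abs.
  by apply: bmf_add; apply: bmf_mul => //; exact: bmf_cst.
move=> y; have /andP[P0 P1] := P01 y.
have [fe|fe] := leP `|f y| eta.
  rewrite [in leRHS]mulrC (le_trans (ler_wpM2l P0 fe))// lerDl.
  by rewrite mulr_ge0 ?powR_ge0.
apply: (@le_trans _ _ `|f y|); first by rewrite ler_piMl.
rewrite ler_wpDl//; first by rewrite mulr_ge0 ?(ltW eta0).
have f0 : 0 < `|f y| by exact: lt_trans fe.
rewrite -(mulr_powRB1 (ltW f0) p0) -(opprB p 1) powRN mulrC.
rewrite ler_pdivlMr ?powR_gt0// ler_wpM2l//.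
by apply: ge0_ler_powR; rewrite ?nnegrE ?subr_ge0 ?(ltW f0) ?(ltW eta0) ?(ltW fe).
Qed.

(** From [|f| ^ p <= M ^ (p - 1) * |f|]: for functions with a common bound, smallness in [L^1]
    passes to [L^p]. *)
Lemma Np_le_bounded f M : bmf f -> {ae mu, forall y, `|f y| <= M} ->
  Np f `^ p <= M `^ (p - 1) * E (fun y => `|f y|).
Proof.
move=> bf fM; have baf := bmf_abs bf.
rewrite Np_powR -E_scale//; apply: E_le_ae.
- exact/bmf_powR/bf/ltW.
- by apply: bmf_mul => //; exact: bmf_cst.
apply: filterS fM => y fM; rewrite -(mulr_powRB1 (normr_ge0 _) p0) mulrC ler_wpM2r//.
by apply: ge0_ler_powR; rewrite ?nnegrE ?subr_ge0// (le_trans _ fM).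
Qed.

End LpNorm.

Section L2Lp.
Context {R : realType} {d : measure_display} {Y : measurableType d}.
Variable mu : probability Y R.

Lemma E_sq_le_Np (p : R) (f : Y -> R) : 2 <= p -> bmf f ->
  E mu (fun y => f y ^+ 2) <= Np mu p f ^+ 2.
Proof.
move=> p2 bf; have p0 : 0 < p by exact: lt_le_trans p2.
have bf2 := bmf_exp 2 bf.
have h1 : 1 <= p / 2 by rewrite ler_pdivlMr// mul1r.
have := E_abs_le_Np mu h1 bf2.
rewrite (@E_ext _ _ _ _ (fun y => `|f y ^+ 2|) (fun y => f y ^+ 2)); last first.
  by move=> y; rewrite ger0_norm ?sqr_ge0.
move=> /le_trans; apply; rewrite !Np_def.
rewrite (@E_ext _ _ _ _ _ (fun y => `|f y| `^ p)).
  by rewrite -powR_mulrn ?powR_ge0// -powRrM invf_div mulrC.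
move=> y; rewrite normrX -powR_mulrn// -powRrM.
by rewrite mulrCA mulfV ?mulr1.
Qed.

End L2Lp.
(** * Transfer operators on bounded functions *)

Section TransferOperator.
Context {R : realType} {d : measure_display} {Y : measurableType d}.
Variable mu : probability Y R.
Variables (F : Y -> Y) (Q : (Y -> R) -> Y -> R).
Implicit Types f g h w : Y -> R.
Local Notation E := (E mu).
Local Notation aeq := (aeq mu).
Local Notation ale := (ale mu).

(** The interface through which the analysis sees the transfer operator. Duality determines [Q f]
    only almost everywhere, so linearity, positivity and [Q 1 = 1], all derived from it, hold up to
    null sets. *)
Definition bounded_transfer : Prop :=
  [/\ measurable_fun [set: Y] F,
      forall f, bmf f -> E (fun y => f (F y)) = E f,
      forall f, bmf f -> bmf (Q f) &
      forall f w, bmf f -> bmf w ->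
        E (fun y => Q f y * w y) = E (fun y => f y * w (F y))].

Hypothesis HQ : bounded_transfer.

Lemma tr_meas : measurable_fun [set: Y] F. Proof. by case: HQ. Qed.

Lemma tr_inv f : bmf f -> E (fun y => f (F y)) = E f.
Proof. by case: HQ => _ + _ _; exact. Qed.

Lemma tr_bmf f : bmf f -> bmf (Q f).
Proof. by case: HQ => _ _ + _; exact. Qed.

Lemma tr_dual f w : bmf f -> bmf w ->
  E (fun y => Q f y * w y) = E (fun y => f y * w (F y)).
Proof. by case: HQ => _ _ _; exact. Qed.

Lemma bmf_F f : bmf f -> bmf (fun y => f (F y)).
Proof. exact: bmf_comp tr_meas. Qed.

Lemma measurable_iter n : measurable_fun [set: Y] (iter n F).
Proof.
elim: n => [|n IH]; first exact: measurable_id.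
exact: (measurableT_comp tr_meas IH).
Qed.

Lemma bmf_iterF n f : bmf f -> bmf (fun y => f (iter n F y)).
Proof. exact/bmf_comp/measurable_iter. Qed.

Lemma tr_inv_iter n f : bmf f -> E (fun y => f (iter n F y)) = E f.
Proof.
move=> bf; elim: n => [|n IH]//=.
rewrite -[RHS]IH -(tr_inv (bmf_iterF n bf)).
by apply: E_ext => y; rewrite -iterSr.
Qed.

Lemma bmf_iterQ n f : bmf f -> bmf (iter n Q f).
Proof. by move=> bf; elim: n => [|n IH]//=; exact: tr_bmf. Qed.

Lemma tr_dual_iter n f w : bmf f -> bmf w ->
  E (fun y => iter n Q f y * w y) = E (fun y => f y * w (iter n F y)).
Proof.
move=> bf; elim: n w => [|n IH] w bw//=.
rewrite tr_dual//; last exact: bmf_iterQ.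
by rewrite (IH (fun y => w (F y)))//; exact: bmf_F.
Qed.

Lemma tr_E f : bmf f -> E (Q f) = E f.
Proof.
move=> bf; have := tr_dual bf (bmf_cst 1).
rewrite (E_ext mu (fun y => mulr1 (Q f y))).
by rewrite (E_ext mu (fun y => mulr1 (f y))).
Qed.

Lemma tr_ale f g : bmf f -> bmf g -> ale f g -> ale (Q f) (Q g).
Proof.
move=> bf bg fg; apply: ale_test; [exact: tr_bmf|exact: tr_bmf|move=> w bw w0].
rewrite !tr_dual//; have bwF := bmf_F bw.
apply: E_le_ae; [exact: bmf_mul|exact: bmf_mul|].
by apply: filterS fg => y fgy; rewrite ler_wpM2r.
Qed.

Lemma tr_aeq f g : bmf f -> bmf g -> aeq f g -> aeq (Q f) (Q g).
Proof.
move=> bf bg fg; apply: aeq_test; [exact: tr_bmf|exact: tr_bmf|move=> w bw].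
rewrite !tr_dual//; have bwF := bmf_F bw.
apply: E_aeq; [exact: bmf_mul|exact: bmf_mul|].
by apply: filterS fg => y ->.
Qed.

Lemma tr_lin a f g : bmf f -> bmf g ->
  aeq (Q (fun y => a * f y + g y)) (fun y => a * Q f y + Q g y).
Proof.
move=> bf bg; have bQf := tr_bmf bf; have bQg := tr_bmf bg.
have baf : bmf (fun y => a * f y) by apply: bmf_mul => //; exact: bmf_cst.
have baQf : bmf (fun y => a * Q f y) by apply: bmf_mul => //; exact: bmf_cst.
have bl : bmf (fun y => a * f y + g y) by exact: bmf_add.
apply: aeq_test; [exact: tr_bmf|exact: bmf_add|move=> w bw].
rewrite tr_dual//; have bwF := bmf_F bw.
transitivity (E (fun y => a * (f y * w (F y)) + g y * w (F y))).
  by apply: E_ext => y; rewrite mulrDl mulrA.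
rewrite E_add; [|by apply: bmf_mul; [exact: bmf_cst|exact: bmf_mul]
  |exact: bmf_mul].
rewrite E_scale; last exact: bmf_mul.
rewrite -!tr_dual// -E_scale; last exact: bmf_mul.
rewrite -E_add; [|by apply: bmf_mul; [exact: bmf_cst|exact: bmf_mul]
  |exact: bmf_mul].
by apply: E_ext => y; rewrite mulrDl mulrA.
Qed.

Lemma tr_add f g : bmf f -> bmf g ->
  aeq (Q (fun y => f y + g y)) (fun y => Q f y + Q g y).
Proof.
move=> bf bg; have := tr_lin 1 bf bg.
rewrite (_ : (fun y => 1 * f y + g y) = fun y => f y + g y).
  by apply: filterS => y; rewrite mul1r.
by apply/funext => y; rewrite mul1r.
Qed.

Lemma tr_sub f g : bmf f -> bmf g ->
  aeq (Q (fun y => f y - g y)) (fun y => Q f y - Q g y).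
Proof.
move=> bf bg; have := tr_lin (-1) bg bf.
rewrite (_ : (fun y => -1 * g y + f y) = fun y => f y - g y).
  by apply: filterS => y ->; rewrite mulN1r addrC.
by apply/funext => y; rewrite mulN1r addrC.
Qed.

Lemma tr_scale a f : bmf f -> aeq (Q (fun y => a * f y)) (fun y => a * Q f y).
Proof.
move=> bf; have baf : bmf (fun y => a * f y) by apply: bmf_mul => //; exact: bmf_cst.
have baQf : bmf (fun y => a * Q f y).
  by apply: bmf_mul; [exact: bmf_cst|exact: tr_bmf].
apply: aeq_test => //; first exact: tr_bmf.
move=> w bw; rewrite tr_dual//; have bwF := bmf_F bw.
transitivity (a * E (fun y => f y * w (F y))).
  rewrite -E_scale; last exact: bmf_mul.
  by apply: E_ext => y; rewrite mulrA.
rewrite -tr_dual// -E_scale; last by apply: bmf_mul => //; exact: tr_bmf.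
by apply: E_ext => y; rewrite mulrA.
Qed.

Lemma tr_cst c : aeq (Q (fun=> c)) (fun=> c).
Proof.
have bc := @bmf_cst R _ Y c.
apply: aeq_test => //; first exact: tr_bmf.
move=> w bw; rewrite tr_dual// E_scale; last exact: bmf_F.
by rewrite tr_inv// E_scale.
Qed.

Lemma tr_iter_cst n c : aeq (iter n Q (fun=> c)) (fun=> c).
Proof.
have bc := @bmf_cst R _ Y c.
elim: n => [|n IH]; first exact: aeW.
by apply: aeq_trans (tr_cst c) => /=; apply: tr_aeq => //; exact: bmf_iterQ.
Qed.

Lemma tr_iter_sub n f g : bmf f -> bmf g ->
  aeq (iter n Q (fun y => f y - g y)) (fun y => iter n Q f y - iter n Q g y).
Proof.
move=> bf bg; elim: n => [|n IH]; first exact: aeW.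
have bfn := bmf_iterQ n bf; have bgn := bmf_iterQ n bg.
apply: aeq_trans (tr_sub bfn bgn) => /=; apply: tr_aeq => //.
  exact/bmf_iterQ/bmf_sub.
exact: bmf_sub.
Qed.

Lemma tr_iter_ale n f g : bmf f -> bmf g -> ale f g ->
  ale (iter n Q f) (iter n Q g).
Proof.
move=> bf bg fg; elim: n => [|n IH]//=.
by apply: tr_ale => //; exact: bmf_iterQ.
Qed.

(** Positivity squeezes the iterate between the images of the constants [- M] and [M], which are
    fixed by [Q]. *)
Lemma tr_iter_bound n f M : bmf f -> (forall y, `|f y| <= M) ->
  {ae mu, forall y, `|iter n Q f y| <= M}.
Proof.
move=> bf fM; have bM := @bmf_cst R _ Y M; have bNM := @bmf_cst R _ Y (- M).
have H1 : ale (iter n Q f) (iter n Q (fun=> M)).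
  by apply: tr_iter_ale => //; apply: aeW => y; exact: le_trans (ler_norm _) (fM y).
have H2 : ale (iter n Q (fun=> - M)) (iter n Q f).
  by apply: tr_iter_ale => //; apply: aeW => y; have := fM y; rewrite ler_norml => /andP[].
apply: filterS2 (filterI H1 H2) (filterI (tr_iter_cst n M) (tr_iter_cst n (- M))).
by move=> y [h1 h2] [e1 e2]; rewrite ler_norml -e2 h2/= -[leRHS]e1.
Qed.

Lemma tr_iter_E n f : bmf f -> E (iter n Q f) = E f.
Proof.
by move=> bf; elim: n => [|n IH]//=; rewrite tr_E//; exact: bmf_iterQ.
Qed.

(* Duality with [sgn (Q f) |Q f|^(p-1)] and Young's inequality. *)
Lemma Np_tr (p : R) f : 1 < p -> bmf f -> Np mu p (Q f) <= Np mu p f.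
Proof.
move=> p1 bf; have bQf := tr_bmf bf.
have p0 : 0 < p by exact: lt_trans p1.
have p10 : 0 <= p - 1 by rewrite subr_ge0 ltW.
pose q := (1 - p^-1)^-1.
have q0 : 0 < q by rewrite invr_gt0 subr_gt0 invf_lt1.
have pq : p^-1 + q^-1 = 1 by rewrite invrK addrC subrK.
have pq1 : (p - 1) * q = p.
  by rewrite /q; field; rewrite (gt_eqF p0) subr_eq0 gt_eqF.
pose a y := `|Q f y| `^ (p - 1).
have ba : bmf a by exact: bmf_powR.
pose w y := Num.sg (Q f y) * a y.
have bw : bmf w.
  split.
    apply: measurable_funM; last exact: (proj1 ba).
    exact/measurable_sg/(proj1 bQf).
  case: (ba) => _ [M aM]; exists M => y; rewrite normrM.
  rewrite (le_trans _ (aM y))// ler_piMl//.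
  by rewrite normr_sg lern1 leq_b1.
have Qw y : Q f y * w y = `|Q f y| `^ p.
  by rewrite /w mulrA -[X in X * _]mulrC -normrEsg mulr_powRB1.
have bfp := bmf_powR (ltW p0) bf; have bQfp := bmf_powR (ltW p0) bQf.
have baF := bmf_F ba; have bwF := bmf_F bw.
have bqF : bmf (fun y => `|Q f (F y)| `^ p) by exact: (bmf_F bQfp).
have K : E (fun y => `|Q f y| `^ p) <=
    p^-1 * E (fun y => `|f y| `^ p) + q^-1 * E (fun y => `|Q f y| `^ p).
  rewrite -[leLHS](E_ext mu Qw) tr_dual//.
  rewrite -[X in _ <= _ + _ * X](tr_inv bQfp) -!E_scale//.
  rewrite -E_add; try by apply: bmf_mul => //; exact: bmf_cst.
  apply: E_le.
  - exact: bmf_mul.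
  - by apply: bmf_add; apply: bmf_mul => //; exact: bmf_cst.
  move=> y; apply: (le_trans (ler_norm _)); rewrite normrM.
  apply: (@le_trans _ _ (`|f y| * a (F y))).
    rewrite ler_wpM2l// /w normrM (ger0_norm (powR_ge0 _ _)) ler_piMl ?powR_ge0//.
    by rewrite normr_sg lern1 leq_b1.
  have := conjugate_powR (normr_ge0 (f y)) (powR_ge0 `|Q f (F y)| (p - 1)) p0 q0 pq.
  by rewrite -powRrM pq1 mulrC [X in _ <= _ + X]mulrC [X in _ <= X + _]mulrC mulrC.
have K2 : E (fun y => `|Q f y| `^ p) <= E (fun y => `|f y| `^ p).
  have : p^-1 * E (fun y => `|Q f y| `^ p) <= p^-1 * E (fun y => `|f y| `^ p).
    have -> : p^-1 = 1 - q^-1 by rewrite -pq addrK.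
    rewrite [leLHS]mulrBl mul1r lerBlDr -pq addrK; exact: K.
  by rewrite ler_pM2l ?invr_gt0.
rewrite !Np_def; apply: ge0_ler_powR; rewrite ?invr_ge0 ?nnegrE//; first exact: ltW.
  by apply: E_ge0 => y; exact: powR_ge0.
by apply: E_ge0 => y; exact: powR_ge0.
Qed.

Lemma Np_iter_tr (p : R) n f : 1 < p -> bmf f ->
  Np mu p (iter n Q f) <= Np mu p f.
Proof.
move=> p1 bf; elim: n => [|n IH] //=.
by apply: le_trans IH; apply: Np_tr => //; exact: bmf_iterQ.
Qed.

End TransferOperator.

(** * Spectral gap of the untwisted operator on centered functions *)

Section SpectralGap.
Context {R : realType} {d : measure_display} {Y : measurableType d}.
Variable mu : probability Y R.
Variables (F : Y -> Y) (Q : (Y -> R) -> Y -> R).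
Implicit Types f g h w : Y -> R.
Local Notation E := (E mu).
Local Notation aeq := (aeq mu).
Local Notation ale := (ale mu).

Definition bmf_mixing : Prop := forall f w, bmf f -> bmf w ->
  E (fun y => f y * w (iter n F y)) @[n --> \oo] --> E f * E w.

(* [BN f x]: the bounded real function [f] represents an element of the
   Banach space whose norm is at most [x]. [BN_absorb] holds because [f]
   represents only one element: apply it to the exact norm [x], which then
   satisfies [x <= a + b * x]. [BN_cauchy] is the compact embedding in [L^p]. *)
Record banach_bound (p : R) (BN : (Y -> R) -> R -> Prop) := BanachBound {
  BN_aeq : forall f g x, aeq f g -> BN f x -> BN g x ;
  BN_le : forall f x z, BN f x -> x <= z -> BN f z ;
  BN_ge0 : forall f x, BN f x -> 0 <= x ;
  BN_add : forall f g x z, BN f x -> BN g z -> BN (fun y => f y + g y) (x + z) ;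
  BN_scale : forall a f x, BN f x -> BN (fun y => a * f y) (`|a| * x) ;
  BN_one : exists K, BN (fun=> 1) K ;
  BN_absorb : forall f a b x0, 0 <= a -> b <= 2^-1 -> BN f x0 ->
    (forall x, BN f x -> BN f (a + b * x)) -> BN f (2 * a) ;
  BN_cauchy : forall (f_ : nat -> Y -> R) M, (forall n, bmf (f_ n)) ->
    (forall n, BN (f_ n) M) ->
    exists phi : nat -> nat, {homo phi : m n / (m < n)%N} /\
      forall e, 0 < e -> exists n0, forall m n, (n0 <= m)%N -> (n0 <= n)%N ->
        Np mu p (fun y => f_ (phi m) y - f_ (phi n) y) <= e
}.

Variables (p : R) (BN : (Y -> R) -> R -> Prop).
Variables (C alpha : R).
Hypothesis p1 : 1 < p.
Hypothesis HQ : bounded_transfer mu F Q.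
Hypothesis mixF : bmf_mixing.
Hypothesis HB : banach_bound p BN.
Hypothesis C0 : 0 < C.
Hypothesis alpha01 : 0 < alpha < 1.
Hypothesis LY : forall f x n, bmf f -> BN f x -> (1 <= n)%N ->
  BN (iter n Q f) (C * (Np mu p f + alpha ^+ n * x)).

Local Notation Np := (Np mu p).

Let p1' : 1 <= p. Proof. exact: ltW. Qed.
Let alpha0 : 0 <= alpha. Proof. by case/andP: alpha01 => /ltW. Qed.
Let alpha1 : alpha <= 1. Proof. by case/andP: alpha01 => _ /ltW. Qed.

Lemma homo_leq_id (phi : nat -> nat) : {homo phi : m n / (m < n)%N} ->
  forall n, (n <= phi n)%N.
Proof.
move=> hphi; elim=> [//|n IH]; exact: leq_ltn_trans IH (hphi _ _ (ltnSn n)).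
Qed.

(** Compactness gives a Cauchy subsequence of the iterates. For a late term [g] of it, [E |g|] is
    the pairing of [g] with its own sign [s]; replacing [g] by a later term costs little, and mixing
    sends the pairing of later iterates with the fixed [s] to [E f * E s = 0]. The common bound [M]
    passes from [L^1] to [L^p], and contraction covers all later times. *)
Lemma Np_decay f x (e : R) : bmf f -> BN f x -> E f = 0 -> 0 < e ->
  exists n, forall m, (n <= m)%N -> Np (iter m Q f) <= e.
Proof.
move=> bf Bf Ef0 e0; have [M fM] := (proj2 bf).
have M0 : 0 <= M by apply: le_trans (fM point).
pose f_ k := iter k.+1 Q f.
have bf_ k : bmf (f_ k) by exact: (bmf_iterQ HQ).
have Bf_ k : BN (f_ k) (C * (Np f + x)).
  apply: (BN_le HB (LY bf Bf (ltn0Sn k))).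
  rewrite ler_pM2l// lerD2l ler_piMl ?(BN_ge0 HB Bf)//.
  by rewrite exprn_ile1.
have [phi [hphi cauchy]] := BN_cauchy HB bf_ Bf_.
(* Chosen so that [M ^ (p - 1) * e1 <= e ^ p]; the [+ 1] keeps the denominator positive when
   [M = 0]. *)
pose e1 := e `^ p / (M `^ (p - 1) + 1).
have den0 : 0 < M `^ (p - 1) + 1 by rewrite ltr_wpDl ?powR_ge0.
have e10 : 0 < e1 by rewrite divr_gt0 ?powR_gt0.
have [n0 Hn0] := cauchy (e1 / 2) ltac:(by rewrite divr_gt0).
pose g := f_ (phi n0).
pose s y := Num.sg (g y).
have bg : bmf g by exact: bf_.
have bs : bmf s.
  split; first exact/measurable_sg/(proj1 bg).
  by exists 1 => y; rewrite normr_sg lern1 leq_b1.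
have s1 y : `|s y| <= 1 by rewrite normr_sg lern1 leq_b1.
have Eg : E (fun y => `|g y|) <= e1.
  have : (E (fun y => f y * s (iter n F y))) @[n --> \oo] --> (0 : R).
    by have := mixF bf bs; rewrite Ef0 mul0r.
  move=> /cvgrPdist_le /(_ (e1 / 2)); rewrite divr_gt0// => /(_ isT)[N _ HN].
  pose j := maxn n0 N.
  have jphi : (N <= (phi j).+1)%N.
    by apply: (leq_trans (leq_maxr n0 N)); apply: leqW; exact: homo_leq_id.
  have := HN _ jphi; rewrite sub0r normrN -(tr_dual_iter HQ _ bf bs) => H1.
  have -> : E (fun y => `|g y|) = E (fun y => (g y - f_ (phi j) y) * s y)
      + E (fun y => f_ (phi j) y * s y).
    rewrite -E_add; [|by apply: bmf_mul => //; exact: bmf_sub|exact: bmf_mul].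
    by apply: E_ext => y; rewrite -mulrDl subrK /s mulrC normrEsg.
  rewrite [leRHS]splitr; apply: lerD; last exact: le_trans (ler_norm _) H1.
  apply: (le_trans (ler_norm _)).
  apply: (le_trans (E_le_Np mu p1' (bmf_sub bg (bf_ (phi j))) bs s1)).
  by apply: Hn0 => //; exact: leq_maxl.
have Ng : Np g <= e.
  have gM := tr_iter_bound HQ (phi n0).+1 bf fM.
  have := Np_le_bounded p1' bg gM => H.
  have H2 : Np g `^ p <= e `^ p.
    apply: (le_trans H); apply: (@le_trans _ _ ((M `^ (p - 1) + 1) * e1)).
      rewrite ler_pM ?powR_ge0//; last by rewrite lerDl.
      by apply: E_ge0 => y.
    by rewrite /e1 mulrC divfK// gt_eqF.
  rewrite leNgt; apply/negP => eN; move: H2; rewrite leNgt => /negP; apply.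
  by apply: gt0_ltr_powR; rewrite ?nnegrE ?(ltW e0) ?Np_ge0// (lt_trans _ p1).
exists (phi n0).+1 => m mn; rewrite -(subnK mn) iterD.
by apply: le_trans Ng; apply: (Np_iter_tr HQ).
Qed.

Lemma BN_sub f g x z : BN f x -> BN g z -> BN (fun y => f y - g y) (x + z).
Proof.
move=> Bf Bg; have := BN_add HB Bf (BN_scale HB (-1) Bg).
rewrite normrN1 mul1r.
by under eq_fun do rewrite mulN1r.
Qed.

(** Compactness yields the embedding constant: otherwise there are elements of norm at most [1] with
    [L^p] norm at least [n], and a Cauchy subsequence of them would be bounded. *)
Lemma Np_embed : exists2 K, 0 < K &
  forall f x, bmf f -> 0 < x -> BN f x -> Np f <= K * x.
Proof.
apply: contrapT => H.
have H1 n : exists f, [/\ bmf f, BN f 1 & n%:R <= Np f].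
  apply: contrapT => Hn; apply: H; exists n.+1%:R => // f x bf x0 Bf.
  rewrite leNgt; apply/negP => lt; apply: Hn; exists (fun y => x^-1 * f y).
  have bxf : bmf (fun y => x^-1 * f y) by apply: bmf_mul => //; exact: bmf_cst.
  split => //.
    have := BN_scale HB x^-1 Bf.
    by rewrite gtr0_norm ?invr_gt0// mulVf ?gt_eqF.
  rewrite Np_scale// gtr0_norm ?invr_gt0// ler_pdivlMl//.
  rewrite (le_trans _ (ltW lt))// mulrC ler_wpM2r ?(ltW x0)// ler_nat//.
have [f_ Hf] := choice H1.
have bf_ n : bmf (f_ n) by case: (Hf n).
have [phi [hphi cauchy]] := BN_cauchy HB bf_ (fun n => let: And3 _ b _ := Hf n in b).
have [n0 Hn0] := cauchy 1 ltr01.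
pose B := Np (f_ (phi n0)) + 1.
have NB m : (n0 <= m)%N -> Np (f_ (phi m)) <= B.
  move=> mn; rewrite /B addrC.
  have := Np_add mu p1' (bmf_sub (bf_ (phi m)) (bf_ (phi n0))) (bf_ (phi n0)).
  under eq_fun do rewrite subrK.
  by move=> /le_trans; apply; rewrite lerD2r Hn0.
pose m := maxn n0 (Num.truncn B).+1.
have := NB m (leq_maxl _ _); apply/negP; rewrite -ltNge.
have [_ _] := Hf (phi m); apply: lt_le_trans.
apply: (@lt_le_trans _ _ (Num.truncn B).+1%:R); first exact: truncnS_gt.
by rewrite ler_nat (leq_trans (leq_maxr n0 _))// homo_leq_id.
Qed.

(** Decay of each element becomes uniform on the unit ball: among counterexamples indexed by the
    time [n], a subsequence stays close to one of its terms [g]. Since [g] decays and the iterates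
    of [Q] do not increase the distance to [g], a late counterexample decays as well. *)
Lemma Np_decay_unif (e : R) : 0 < e -> exists n, forall f, bmf f -> BN f 1 ->
  E f = 0 -> Np (iter n Q f) <= e.
Proof.
move=> e0; apply: contrapT => H.
have H1 n : exists f, [/\ bmf f, BN f 1, E f = 0 & e < Np (iter n Q f)].
  apply: contrapT => Hn; apply: H; exists n => f bf Bf Ef.
  by rewrite leNgt; apply/negP => lt; apply: Hn; exists f.
have [f_ Hf] := choice H1.
have bf_ n : bmf (f_ n) by case: (Hf n).
have [phi [hphi cauchy]] := BN_cauchy HB bf_ (fun n => let: And4 _ b _ _ := Hf n in b).
have [n0 Hn0] := cauchy (e / 2) ltac:(by rewrite divr_gt0).
have [_ Bg Eg _] := Hf (phi n0).
have [N HN] := Np_decay (bf_ (phi n0)) Bg Eg (e := e / 2) ltac:(by rewrite divr_gt0).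
pose j := maxn n0 N.
have [_ _ _] := Hf (phi j); apply/negP; rewrite -leNgt.
set k := phi j; set g := f_ (phi n0).
have bg : bmf g by exact: bf_.
have bd : bmf (fun y => f_ k y - g y) by exact: bmf_sub.
have -> : Np (iter k Q (f_ k)) =
    Np (fun y => iter k Q (fun z => f_ k z - g z) y + iter k Q g y).
  apply: Np_aeq => //.
  - exact: (bmf_iterQ HQ).
  - by apply: bmf_add; exact: (bmf_iterQ HQ).
  - apply: filterS (tr_iter_sub HQ k (bf_ k) bg) => y ->.
    by rewrite subrK.
have H2 := Np_add mu p1' (bmf_iterQ HQ k bd) (bmf_iterQ HQ k bg).
apply: (le_trans H2).
rewrite [leRHS]splitr lerD//.
  apply: (le_trans (Np_iter_tr HQ k p1 bd)).
  by apply: Hn0 => //; exact: leq_maxl.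
by apply: HN; apply: (leq_trans (leq_maxr n0 N)); exact: homo_leq_id.
Qed.

(** The Lasota-Yorke inequality converts decay in [L^p] into decay in the Banach norm: after [m.+1]
    steps the [L^p] norm is at most [x / (4 * C)], and [N.+1] further steps make the term in the
    Banach norm at most [x / 4] as well. *)
Lemma BN_gap : exists2 n0 : nat, (0 < n0)%N & forall f x, bmf f -> 0 < x ->
  BN f x -> E f = 0 -> BN (iter n0 Q f) (x / 2).
Proof.
have [K K0 embed] := Np_embed.
have [m Hm] := Np_decay_unif (e := (4 * C)^-1) ltac:(by rewrite invr_gt0 mulr_gt0).
(* [A * x] bounds the Banach norm after [m.+1] steps, by one use of Lasota-Yorke and the embedding
   constant [K]. *)
pose A := C * (K + 1) + 1.
have A0 : 0 < A by rewrite ltr_wpDl// mulr_ge0 ?(ltW C0)// addr_ge0 ?(ltW K0).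
have : alpha ^+ n @[n --> \oo] --> (0 : R).
  by apply: cvg_expr; rewrite ger0_norm//; case/andP: alpha01.
move=> /cvgrPdist_le /(_ (4 * C * A)^-1); rewrite invr_gt0 !mulr_gt0// => /(_ isT).
case=> N _ /(_ N (leqnn N)); rewrite sub0r normrN ger0_norm ?exprn_ge0// => HN.
exists (N.+1 + m.+1)%N => // f x bf x0 Bf Ef0.
have xn0 : x != 0 by rewrite gt_eqF.
rewrite iterD; set g := iter m.+1 Q f.
have bg : bmf g by exact: (bmf_iterQ HQ).
have Bg : BN g (A * x).
  apply: (BN_le HB (LY bf Bf (ltn0Sn m))).
  apply: (@le_trans _ _ (C * (K * x + x))).
    rewrite ler_pM2l// lerD ?embed// ler_piMl ?(ltW x0)//.
    by rewrite exprn_ile1.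
  by rewrite -[X in _ + X]mul1r -mulrDl mulrA ler_wpM2r ?(ltW x0)// lerDl.
have Ng : Np g <= (4 * C)^-1 * x.
  have bxf : bmf (fun y => x^-1 * f y) by apply: bmf_mul => //; exact: bmf_cst.
  have Bxf : BN (fun y => x^-1 * f y) 1.
    have := BN_scale HB x^-1 Bf.
    by rewrite gtr0_norm ?invr_gt0// mulVf.
  have Exf : E (fun y => x^-1 * f y) = 0 by rewrite E_scale// Ef0 mulr0.
  have := Hm _ bxf Bxf Exf.
  have bfm := bmf_iterQ HQ m bf.
  have -> : Np (iter m Q (fun y => x^-1 * f y)) = x^-1 * Np (iter m Q f).
    rewrite -[x^-1 in RHS]gtr0_norm ?invr_gt0// -Np_scale//.
    apply: Np_aeq => //; first exact: (bmf_iterQ HQ).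
      by apply: bmf_mul => //; exact: bmf_cst.
    elim: (m) => [|k IH]; first exact: aeW.
    have bfk := bmf_iterQ HQ k bf.
    apply: aeq_trans (tr_scale HQ x^-1 bfk) => /=.
    apply: (tr_aeq HQ) => //; first exact: (bmf_iterQ HQ).
    by apply: bmf_mul => //; exact: bmf_cst.
  rewrite ler_pdivrMl// mulrC => /(le_trans _); apply.
  exact: (Np_tr HQ).
apply: (BN_le HB (LY bg Bg (ltn0Sn N))).
apply: (@le_trans _ _ (C * ((4 * C)^-1 * x + (4 * C * A)^-1 * (A * x)))).
  rewrite ler_pM2l// lerD// ler_wpM2r//.
    by rewrite mulr_ge0// ltW.
  apply: le_trans HN; rewrite exprS ler_piMl ?exprn_ge0//.
rewrite le_eqVlt; apply/orP; left; apply/eqP.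
by field; rewrite !gt_eqF.
Qed.

(** The gap halves the norm every [n0] steps. The rate [2 ^ - k] is relaxed to [1 / k.+1], to be
    played against a cost that grows linearly in [k]. *)
Lemma Np_decay_rate : exists n0 K, [/\ (0 < n0)%N, 0 < K &
  forall k f x, bmf f -> 0 < x -> BN f x -> E f = 0 ->
    Np (iter (k * n0) Q f) <= K * x / k.+1%:R].
Proof.
have [K K0 embed] := Np_embed.
have [n0 n00 gap] := BN_gap.
exists n0, K; split => // k f x bf x0 Bf Ef0.
have : BN (iter (k * n0) Q f) (x / 2 ^+ k).
  elim: k => [|k IH]; first by rewrite mul0n expr0 divr1.
  rewrite mulSn iterD exprS invfM mulrA mulrAC.
  apply: gap => //; first exact: (bmf_iterQ HQ).
    by rewrite divr_gt0// exprn_gt0.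
  by rewrite (tr_iter_E HQ).
move=> /embed => /(_ (bmf_iterQ HQ _ bf)).
rewrite divr_gt0 ?exprn_gt0// => /(_ isT)/le_trans; apply.
rewrite mulrA ler_wpM2l ?mulr_ge0 ?(ltW K0) ?(ltW x0)//.
rewrite lef_pV2 ?posrE ?exprn_gt0// -natrX ler_nat.
exact: ltn_expl.
Qed.

End SpectralGap.
(** * Resolvent sums of the twisted transfer operator *)

Lemma powR_small {R : realType} (g e : R) : 0 < g -> 0 < e ->
  exists2 s0 : R, 0 < s0 & forall s : R, 0 < s < s0 -> s `^ g <= e.
Proof.
move=> g0 e0; exists (e `^ g^-1); first exact: powR_gt0.
move=> s /andP[s0 se]; have e1 : e = (e `^ g^-1) `^ g.
  by rewrite -powRrM mulVf ?gt_eqF// powRr1// ltW.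
rewrite [leRHS]e1; apply: ge0_ler_powR; rewrite ?nnegrE ?powR_ge0 ?(ltW s0)//.
  exact: ltW.
exact: ltW.
Qed.

Section TwistedTransfer.
Context {R : realType} {d : measure_display} {Y : measurableType d}.
Variable mu : probability Y R.
Variables (F : Y -> Y) (Q : (Y -> R) -> Y -> R) (tau : Y -> R).
Implicit Types f g h w : Y -> R.
Local Notation E := (E mu).
Local Notation aeq := (aeq mu).
Local Notation ale := (ale mu).

Hypothesis HQ : bounded_transfer mu F Q.
Hypothesis mtau : measurable_fun [set: Y] tau.
Hypothesis tau0 : forall y, 0 <= tau y.

Definition etau (s : R) y : R := expR (- (s * tau y)).
Definition Qs (s : R) f : Y -> R := Q (fun y => etau s y * f y).
Definition eS (s : R) k y : R := expR (- (s * birkhoff_sum F tau k y)).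
Definition gk (s : R) k : Y -> R := iter k (Qs s) (fun=> 1).
Definition vN (s : R) N y : R := \sum_(k < N) gk s k y.
Definition Phi (s : R) : R := E (fun y => 1 - etau s y).

Lemma measurable_birkhoff k : measurable_fun [set: Y] (birkhoff_sum F tau k).
Proof.
rewrite /birkhoff_sum; under eq_fun do rewrite -(big_mkord xpredT (fun j => tau (iter j F _))).
apply: measurable_sum => j.
exact/(measurableT_comp mtau)/(measurable_iter HQ).
Qed.

Lemma birkhoff_ge0 k y : 0 <= birkhoff_sum F tau k y.
Proof. by apply: sumr_ge0. Qed.

Lemma bmf_eS s k : 0 <= s -> bmf (eS s k).
Proof.
move=> s0; apply: bmf_expRN; last by move=> y; rewrite mulr_ge0 ?birkhoff_ge0.
by apply: measurable_funM; [exact: measurable_cst|exact: measurable_birkhoff].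
Qed.

Lemma bmf_etau s : 0 <= s -> bmf (etau s).
Proof.
move=> s0; apply: bmf_expRN; last by move=> y; rewrite mulr_ge0.
by apply: measurable_funM; [exact: measurable_cst|exact: mtau].
Qed.

Lemma etau_ge0 s y : 0 <= etau s y. Proof. exact: expR_ge0. Qed.

Lemma etau_le1 s y : 0 <= s -> etau s y <= 1.
Proof. by move=> s0; rewrite -expR0 ler_expR oppr_le0 mulr_ge0. Qed.

Lemma eS_ge0 s k y : 0 <= eS s k y. Proof. exact: expR_ge0. Qed.

Lemma eS_le1 s k y : 0 <= s -> eS s k y <= 1.
Proof. by move=> s0; rewrite -expR0 ler_expR oppr_le0 mulr_ge0 ?birkhoff_ge0. Qed.

Lemma eS0 s y : eS s 0 y = 1.
Proof. by rewrite /eS /birkhoff_sum big_ord0 mulr0 oppr0 expR0. Qed.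

Lemma birkhoffD j k y : birkhoff_sum F tau (j + k) y =
  birkhoff_sum F tau j y + birkhoff_sum F tau k (iter j F y).
Proof.
rewrite /birkhoff_sum big_split_ord/=; congr (_ + _).
by apply: eq_bigr => i _; rewrite addnC iterD.
Qed.

Lemma eSD s j k y : eS s (j + k) y = eS s j y * eS s k (iter j F y).
Proof. by rewrite /eS birkhoffD mulrDr opprD expRD. Qed.

Lemma eS1 s y : eS s 1 y = etau s y.
Proof. by rewrite /eS /birkhoff_sum big_ord_recr big_ord0/= add0r. Qed.

Lemma bmf_Qs s f : 0 <= s -> bmf f -> bmf (Qs s f).
Proof.
by move=> s0 bf; apply: (tr_bmf HQ); apply: bmf_mul => //; exact: bmf_etau.
Qed.

Lemma bmf_iterQs s n f : 0 <= s -> bmf f -> bmf (iter n (Qs s) f).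
Proof. by move=> s0 bf; elim: n => [|n IH]//=; exact: bmf_Qs. Qed.

Lemma bmf_gk s k : 0 <= s -> bmf (gk s k).
Proof. by move=> s0; apply: bmf_iterQs => //; exact: bmf_cst. Qed.

Lemma bmf_vN s N : 0 <= s -> bmf (vN s N).
Proof. by move=> s0; apply: bmf_sum => i _; exact: bmf_gk. Qed.

(** One application of [Qs] replaces the test [w] by [etau s] times [w] composed with [F]; the
    cocycle identity [eSD] collects the successive weights into [eS s k]. *)
Lemma iterQs_dual s k f w : 0 <= s -> bmf f -> bmf w ->
  E (fun y => iter k (Qs s) f y * w y) =
  E (fun y => f y * (eS s k y * w (iter k F y))).
Proof.
move=> s0 bf; elim: k w => [|k IH] w bw.
  by apply: E_ext => y; rewrite eS0 mul1r.
have be := bmf_etau s0; have bfk := bmf_iterQs k s0 bf; have bwF := bmf_F HQ bw.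
rewrite /= (tr_dual HQ)//; last exact: bmf_mul.
transitivity (E (fun y => iter k (Qs s) f y * (etau s y * w (F y)))).
  by apply: E_ext => y; rewrite mulrA [_ * etau s y]mulrC.
rewrite (IH (fun y => etau s y * w (F y)))//; last exact: bmf_mul.
by apply: E_ext => y; rewrite -addn1 eSD eS1 -!mulrA.
Qed.

Lemma gk_dual s k w : 0 <= s -> bmf w ->
  E (fun y => gk s k y * w y) = E (fun y => eS s k y * w (iter k F y)).
Proof.
move=> s0 bw; rewrite iterQs_dual//; last exact: bmf_cst.
by apply: E_ext => y; rewrite mul1r.
Qed.

Lemma vN_dual s N w : 0 <= s -> bmf w ->
  E (fun y => vN s N y * w y) = \sum_(k < N) E (fun y => eS s k y * w (iter k F y)).
Proof.
move=> s0 bw; rewrite -(eq_bigr _ (fun (k : 'I_N) _ => gk_dual k s0 bw)) -E_sum.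
  by apply: E_ext => y; rewrite /vN mulr_suml.
by move=> k _; apply: bmf_mul => //; exact: bmf_gk.
Qed.

Lemma Qs_ale s f g : 0 <= s -> bmf f -> bmf g -> ale f g -> ale (Qs s f) (Qs s g).
Proof.
move=> s0 bf bg fg; have be := bmf_etau s0.
apply: (tr_ale HQ); [exact: bmf_mul|exact: bmf_mul|].
by apply: filterS fg => y fgy; rewrite ler_wpM2l ?etau_ge0.
Qed.

Lemma Qs_aeq s f g : 0 <= s -> bmf f -> bmf g -> aeq f g -> aeq (Qs s f) (Qs s g).
Proof.
move=> s0 bf bg fg; have be := bmf_etau s0.
apply: (tr_aeq HQ); [exact: bmf_mul|exact: bmf_mul|].
by apply: filterS fg => y ->.
Qed.

Lemma Qs0 s : 0 <= s -> aeq (Qs s (fun=> 0)) (fun=> 0).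
Proof.
move=> s0; have := tr_cst HQ 0; rewrite /Qs.
rewrite (_ : (fun y => etau s y * 0) = fun=> 0)//.
by apply/funext => y; rewrite mulr0.
Qed.

Lemma Qs_add s f g : 0 <= s -> bmf f -> bmf g ->
  aeq (Qs s (fun y => f y + g y)) (fun y => Qs s f y + Qs s g y).
Proof.
move=> s0 bf bg; have be := bmf_etau s0; rewrite {1}/Qs.
rewrite (_ : (fun y => etau s y * _) = fun y => etau s y * f y + etau s y * g y).
  by apply: (tr_add HQ); exact: bmf_mul.
by apply/funext => y; rewrite mulrDr.
Qed.

Lemma gk_ge0 s k : 0 <= s -> ale (fun=> 0) (gk s k).
Proof.
move=> s0; elim: k => [|k IH]; first by apply: aeW => y; exact: ler01.
have := Qs_ale s0 (bmf_cst 0) (bmf_gk k s0) IH; have := Qs0 s0.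
by apply: filterS2 => y ->.
Qed.

Lemma gk_le1 s k : 0 <= s -> ale (gk s k) (fun=> 1).
Proof.
move=> s0; elim: k => [|k IH]; first by apply: aeW => y; exact: lexx.
have bg := bmf_gk k s0; have be := bmf_etau s0.
have H : ale (gk s k.+1) (Q (fun=> 1)).
  apply: (tr_ale HQ); [exact: bmf_mul|exact: bmf_cst|].
  apply: filterS2 IH (gk_ge0 k s0) => y g1 g0.
  by rewrite mulr_ile1 ?etau_ge0 ?etau_le1.
by have := tr_cst HQ 1; apply: filterS2 H => y + <-.
Qed.

Lemma vN_ge0 s N : 0 <= s -> ale (fun=> 0) (vN s N).
Proof.
move=> s0; elim: N => [|N IH]; first by apply: aeW => y; rewrite /vN big_ord0.
have := gk_ge0 N s0; apply: filterS2 IH => y v0 g0.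
by rewrite /vN big_ord_recr/= addr_ge0.
Qed.

Lemma vN_leN s N : 0 <= s -> ale (vN s N) (fun=> N%:R).
Proof.
move=> s0; elim: N => [|N IH]; first by apply: aeW => y; rewrite /vN big_ord0.
have := gk_le1 N s0; apply: filterS2 IH => y v0 g0.
by rewrite /vN big_ord_recr/= -addn1 natrD lerD.
Qed.

Lemma E_gk s k : 0 <= s -> E (gk s k) = E (eS s k).
Proof.
move=> s0; have := gk_dual k s0 (bmf_cst 1).
rewrite (E_ext mu (fun y => mulr1 (gk s k y))) => ->.
by apply: E_ext => y; rewrite mulr1.
Qed.

Lemma E_vN s N : 0 <= s -> E (vN s N) = \sum_(k < N) E (eS s k).
Proof.
move=> s0; rewrite /vN E_sum; last by move=> k _; exact: bmf_gk.
by apply: eq_bigr => k _; rewrite E_gk.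
Qed.

Lemma E_vN_ge1 s N : 0 <= s -> (0 < N)%N -> 1 <= E (vN s N).
Proof.
move=> s0; case: N => // N _; rewrite E_vN// big_ord_recl.
rewrite (E_ext mu (eS0 s)) E_cst lerDl sumr_ge0// => k _.
by apply: E_ge0 => y; exact: eS_ge0.
Qed.

Lemma iterQs_vN s n N : 0 <= s ->
  aeq (iter n (Qs s) (vN s N)) (fun y => \sum_(k < N) gk s (n + k) y).
Proof.
move=> s0; elim: n => [|n IH]; first exact: aeW.
have bS m M : bmf (fun y => \sum_(k < M) gk s (m + k) y).
  by apply: bmf_sum => k _; exact: bmf_gk.
have H := Qs_aeq s0 (bmf_iterQs n s0 (bmf_vN N s0)) (bS n N) IH.
apply: aeq_trans H _; elim: N {IH} => [|N IHN].
  have -> : (fun y => \sum_(k < 0) gk s (n + k) y) = fun=> 0.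
    by apply/funext => y; rewrite big_ord0.
  by apply: filterS (Qs0 s0) => y ->; rewrite big_ord0.
have -> : (fun y => \sum_(k < N.+1) gk s (n + k) y) =
    fun y => \sum_(k < N) gk s (n + k) y + gk s (n + N) y.
  by apply/funext => y; rewrite big_ord_recr.
have := Qs_add s0 (bS n N) (bmf_gk (n + N) s0).
by apply: filterS2 IHN => y e1 ->; rewrite e1 [RHS]big_ord_recr.
Qed.

(** Both sides are the sum of the first [n + N] terms. For [n = 1] this is the finite form of the
    resolvent equation: [vN] minus its image under [Qs] is [1 - gk s N] instead of [1]. *)
Lemma vN_split s n N y :
  vN s n y + \sum_(k < N) gk s (n + k) y = vN s N y + \sum_(k < n) gk s (N + k) y.
Proof.
have H m M : vN s m y + \sum_(k < M) gk s (m + k) y = vN s (m + M) y.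
  by rewrite /vN big_split_ord.
by rewrite !H addnC.
Qed.

(** [Q] preserves the mean, so [etau s * vN s N] has the mean of [Qs s (vN s N)], which is the sum
    shifted by one; the difference telescopes. *)
Lemma E_1etau_vN s N : 0 <= s ->
  E (fun y => (1 - etau s y) * vN s N y) = 1 - E (eS s N).
Proof.
move=> s0; have be := bmf_etau s0; have bv := bmf_vN N s0.
have bev := bmf_mul be bv.
transitivity (E (vN s N) - E (fun y => etau s y * vN s N y)).
  by rewrite -E_sub//; apply: E_ext => y; rewrite mulrBl mul1r.
rewrite -(tr_E HQ bev) -[Q _]/(iter 1 (Qs s) (vN s N)).
rewrite (E_aeq _ _ (iterQs_vN 1 N s0)); last first.
- by apply: bmf_sum => k _; exact: bmf_gk.
- exact: bmf_iterQs.
rewrite -E_sub//; last by apply: bmf_sum => k _; exact: bmf_gk.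
transitivity (E (fun y => 1 - gk s N y)).
  apply: E_ext => y; have := vN_split s 1 N y.
  rewrite /vN big_ord1 big_ord1 addn0 /= => H.
  by apply/eqP; rewrite subr_eq addrAC -subr_eq opprK; apply/eqP; rewrite H.
by rewrite E_sub ?E_cst ?E_gk//; [exact: bmf_cst|exact: bmf_gk].
Qed.

End TwistedTransfer.

(** * Estimates of the truncated resolvent sums as [s] tends to [0] *)

Section ResolventEstimates.
Context {R : realType} {d : measure_display} {Y : measurableType d}.
Variable mu : probability Y R.
Variables (F : Y -> Y) (Q : (Y -> R) -> Y -> R) (tau : Y -> R).
Implicit Types f g h w : Y -> R.
Local Notation E := (E mu).
Local Notation aeq := (aeq mu).
Local Notation ale := (ale mu).
Variables (p gamma C alpha delta : R) (BN : (Y -> R) -> R -> Prop).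
Local Notation Np := (Np mu p).
Local Notation Qs := (Qs Q tau).
Local Notation gk := (gk Q tau).
Local Notation vN := (vN Q tau).
Local Notation etau := (etau tau).
Local Notation eS := (eS F tau).
Local Notation Phi := (Phi mu tau).

Hypothesis p1 : 1 < p.
Hypothesis gamma0 : 0 < gamma.
Hypothesis HQ : bounded_transfer mu F Q.
Hypothesis mixF : bmf_mixing mu F.
Hypothesis mtau : measurable_fun [set: Y] tau.
Hypothesis tau0 : forall y, 0 <= tau y.
Hypothesis tau1 : {ae mu, forall y, 1 <= tau y}.
Hypothesis HB : banach_bound mu p BN.
Hypothesis C0 : 0 < C.
Hypothesis delta0 : 0 < delta.
Hypothesis alpha01 : 0 < alpha < 1.
Hypothesis LY : forall s f x n, 0 <= s < delta -> bmf f -> BN f x ->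
  (1 <= n)%N -> BN (iter n (Qs s) f) (C * (Np f + alpha ^+ n * x)).
Hypothesis moment : forall s f x, 0 < s -> bmf f -> ale (fun=> 0) f ->
  BN f x -> Np (Q (fun y => (1 - etau s y) * f y)) <= C * s `^ gamma * x.

Let p1' : 1 <= p. Proof. exact: ltW. Qed.
Let alpha0 : 0 <= alpha. Proof. by case/andP: alpha01 => /ltW. Qed.
Let alpha1 : alpha <= 1. Proof. by case/andP: alpha01 => _ /ltW. Qed.

Lemma Qs_at0 f : Qs 0 f = Q f.
Proof.
by rewrite /Qs /etau; congr Q; apply/funext => y; rewrite mul0r oppr0 expR0 mul1r.
Qed.

Lemma LY0 f x n : bmf f -> BN f x -> (1 <= n)%N ->
  BN (iter n Q f) (C * (Np f + alpha ^+ n * x)).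
Proof.
move=> bf Bf n1; have := LY (s := 0) _ bf Bf n1; rewrite lexx delta0 => /(_ isT).
by rewrite (@eq_iter _ (Qs 0) Q Qs_at0).
Qed.

Lemma BN_sum (f_ : nat -> Y -> R) M n : 0 <= M -> (forall k, BN (f_ k) M) ->
  BN (fun y => \sum_(k < n) f_ k y) (n%:R * M).
Proof.
move=> M0 Bf; elim: n => [|n IH].
  have := BN_scale HB 0 (Bf 0%N); rewrite normr0 !mul0r.
  by under eq_fun do rewrite mul0r; under [X in _ -> BN X _]eq_fun do rewrite big_ord0.
have := BN_add HB IH (Bf n); rewrite -[X in _ + X]mul1r -mulrDl natr1.
by under [X in _ -> BN X _]eq_fun do rewrite big_ord_recr.
Qed.

Lemma BN_gk : exists2 G, 0 < G & forall s k, 0 <= s < delta -> BN (gk s k) G.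
Proof.
have [K BK] := BN_one HB; have K0 := BN_ge0 HB BK.
exists (K + C * (1 + K)); first by rewrite ltr_wpDl// mulr_gt0// ltr_wpDr.
move=> s [|k] sd.
  by apply: (BN_le HB BK); rewrite lerDl mulr_ge0 ?addr_ge0// ltW.
apply: (BN_le HB (LY sd (bmf_cst 1) BK (ltn0Sn k))).
rewrite ler_wpDl// ler_pM2l// Np_cst// normr1 lerD2l ler_piMl//.
by rewrite exprn_ile1.
Qed.

Lemma Np_vN_le s n : 0 <= s -> Np (vN s n) <= n%:R.
Proof.
move=> s0; have := Np_cst mu p1' n%:R; rewrite ger0_norm// => <-.
apply: Np_ale => //; [exact: (bmf_vN HQ mtau tau0)|exact: bmf_cst|].
apply: filterS2 (vN_ge0 HQ mtau tau0 n s0) (vN_leN HQ mtau tau0 n s0) => y h0 h1.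
by rewrite !ger0_norm.
Qed.

(** By [vN_split], [vN s N] is its own image under [n.+1] steps of [Qs], plus [vN s n.+1], minus the
    image of the latter under [N] steps. Lasota-Yorke puts the factor [C * alpha ^ n.+1 <= 1/2] on
    the norm of [vN s N], which is then absorbed; the remaining constant does not depend on [N]. *)
Lemma BN_vN : exists2 C1, 0 < C1 & forall s N, 0 <= s < delta -> (0 < N)%N ->
  BN (vN s N) (C1 + 2 * C * Np (vN s N)).
Proof.
have [G G0 BG] := BN_gk.
have : alpha ^+ n @[n --> \oo] --> (0 : R).
  by apply: cvg_expr; rewrite ger0_norm//; case/andP: alpha01.
move=> /cvgrPdist_le /(_ (2 * C)^-1); rewrite invr_gt0 !mulr_gt0// => /(_ isT).
case=> n _ /(_ n.+1 (leqnSn n)).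
rewrite sub0r normrN ger0_norm ?exprn_ge0// => Hn.
pose a := n.+1%:R * G + C * (n.+1%:R + n.+1%:R * G).
have a0 : 0 < a.
  by rewrite addr_gt0 ?mulr_gt0// addr_gt0// mulr_gt0.
exists (2 * a); first by rewrite mulr_gt0.
move=> s N /[dup] sd /andP[s0 _] N0.
have bv := bmf_vN HQ mtau tau0 N s0.
have bvn := bmf_vN HQ mtau tau0 n.+1 s0.
have -> : 2 * a + 2 * C * Np (vN s N) = 2 * (C * Np (vN s N) + a).
  by ring.
have bS m M : bmf (fun y => \sum_(k < M) gk s (m + k) y).
  by apply: bmf_sum => k _; exact: (bmf_gk HQ mtau tau0).
apply: (@BN_absorb _ _ _ _ _ _ HB _ _ (C * alpha ^+ n.+1)).
- by rewrite addr_ge0 ?(ltW a0)// mulr_ge0 ?(ltW C0)// Np_ge0.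
- rewrite -ler_pdivlMl//; apply: le_trans Hn _.
  by rewrite invfM mulrC.
(* A bound that grows with [N] is good enough here: it only shows that the norm is finite, and it
   does not appear in the result of the absorption. *)
- by apply: (@BN_sum (gk s) G N) => [|k]; [exact: ltW|exact: BG].
move=> x Bx.
have H1 := LY sd bv Bx (ltn0Sn n).
have H2 : BN (vN s n.+1) (n.+1%:R * G).
  by apply: (@BN_sum (gk s) G n.+1) => [|k]; [exact: ltW|exact: BG].
have H3 := LY sd bvn H2 N0.
have H := BN_add HB H1 (BN_sub HB H2 H3).
apply: (BN_le HB (x := C * (Np (vN s N) + alpha ^+ n.+1 * x) +
   (n.+1%:R * G + C * (Np (vN s n.+1) + alpha ^+ N * (n.+1%:R * G))))); last first.
  rewrite mulrDr mulrA /a -!addrA lerD2l [leLHS]addrC -!addrA lerD2l lerD2r.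
  rewrite ler_pM2l//; apply: lerD.
    exact: Np_vN_le.
  by rewrite ler_piMl ?mulr_ge0 ?(ltW G0)// exprn_ile1.
apply: (BN_aeq HB _ H).
apply: filterS2 (iterQs_vN HQ mtau tau0 n.+1 N s0) (iterQs_vN HQ mtau tau0 N n.+1 s0).
move=> y -> ->; have := vN_split Q tau s n.+1 N y => H4.
by rewrite addrA [X in X - _]addrC H4 addrK.
Qed.

(** [f] is [Q^n f] plus the sum of [Q^i (f - Q f)] over [i < n], and [Q] contracts the norm. *)
Lemma Np_telescope n f : bmf f ->
  Np f <= Np (iter n Q f) + n%:R * Np (fun y => f y - Q f y).
Proof.
move=> bf; elim: n => [|n IH]; first by rewrite mul0r addr0.
apply: (le_trans IH); rewrite -natr1 mulrDl mul1r [leRHS]addrCA.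
rewrite [leLHS]addrC lerD2l.
have bn := bmf_iterQ HQ n bf; have bn1 := bmf_iterQ HQ n.+1 bf.
have bQ := tr_bmf HQ bf.
have := Np_add mu p1' bn1 (bmf_sub bn bn1).
rewrite (_ : (fun y => _ + (_ - _)) = iter n Q f); last first.
  by apply/funext => y; rewrite subrKC.
move=> /le_trans; apply; rewrite lerD2l.
have bfQ : bmf (fun y => f y - Q f y) by exact: bmf_sub.
apply: le_trans (Np_iter_tr HQ n p1 bfQ).
apply: Np_ale => //; [exact: bmf_sub|exact: (bmf_iterQ HQ)|].
by apply: filterS (tr_iter_sub HQ n bf bQ) => y ->; rewrite -iterSr.
Qed.

Lemma E_vN_le_Np s N : 0 <= s -> E (vN s N) <= Np (vN s N).
Proof.
move=> s0; have bv := bmf_vN HQ mtau tau0 N s0.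
apply: le_trans (E_abs_le_Np mu p1' bv); apply: (le_trans (ler_norm _)).
exact: E_norm.
Qed.

(** The identity is [f - Q f = (1 - gk s N) - Q ((1 - etau s) * vN s N)]. The first part lies in
    [[0, 1]]; the second is controlled by the moment bound and carries the factor [s ^ gamma]. *)
Lemma vN_defect s N x f : 0 < s -> BN (vN s N) x ->
  f = (fun y => vN s N y - E (vN s N)) ->
  Np (fun y => f y - Q f y) <= 1 + C * s `^ gamma * x.
Proof.
move=> s0 Bx; set c := E (vN s N) => fE; have s0' := ltW s0.
have bv := bmf_vN HQ mtau tau0 N s0'; have be := bmf_etau mtau tau0 s0'.
have bg := bmf_gk HQ mtau tau0 N s0'.
have bf : bmf f by rewrite fE; apply: bmf_sub => //; exact: bmf_cst.
have bQf := tr_bmf HQ bf.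
have b1e : bmf (fun y => (1 - etau s y) * vN s N y).
  by apply: bmf_mul => //; apply: bmf_sub => //; exact: bmf_cst.
have b1g : bmf (fun y => 1 - gk s N y) by apply: bmf_sub => //; exact: bmf_cst.
have bev : bmf (fun y => etau s y * vN s N y) by exact: bmf_mul.
have -> : Np (fun y => f y - Q f y) =
    Np (fun y => (1 - gk s N y) - Q (fun z => (1 - etau s z) * vN s N z) y).
  apply: Np_aeq => //.
  - exact: bmf_sub.
  - by apply: bmf_sub => //; exact: (tr_bmf HQ).
  have A1 := tr_sub HQ bv (bmf_cst c); rewrite -fE in A1.
  have A2 := tr_cst HQ c.
  have A3 := iterQs_vN HQ mtau tau0 1 N s0'.
  have A4 : aeq (Q (fun z => (1 - etau s z) * vN s N z))
      (fun y => Q (vN s N) y - Qs s (vN s N) y).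
    rewrite (_ : (fun z => (1 - etau s z) * vN s N z) =
      fun z => vN s N z - etau s z * vN s N z); first exact: (tr_sub HQ).
    by apply/funext => z; rewrite mulrBl mul1r.
  apply: filterS2 (filterI A1 A2) (filterI A3 A4) => y [a1 a2] [/= a3 a4].
  rewrite a1 a2 a4 a3 fE.
  have := vN_split Q tau s 1 N y; rewrite /vN !big_ord1 addn0 => H.
  rewrite (_ : gk s N y = gk s 0 y + \sum_(k < N) gk s (1 + k) y - \sum_(k < N) gk s k y).
    by rewrite /=; ring.
  by rewrite H addrC addKr.
apply: (le_trans (Np_sub mu p1' b1g (tr_bmf HQ b1e))); apply: lerD; last first.
  by apply: moment => //; exact: (vN_ge0 HQ mtau tau0).
rewrite -[leRHS]normr1 -(Np_cst mu p1'); apply: Np_ale => //; first exact: bmf_cst.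
apply: filterS2 (gk_ge0 HQ mtau tau0 N s0') (gk_le1 HQ mtau tau0 N s0') => y h0 h1.
by rewrite normr1 ger0_norm ?subr_ge0// lerBlDr lerDl.
Qed.

(* [n0] is a time after which the norm of centered elements is halved. *)
Lemma vN_centered : exists n0 K C1, [/\ (0 < n0)%N, 0 < K, 0 < C1 &
  forall s N k, 0 < s < delta -> (0 < N)%N ->
    BN (vN s N) (C1 + 2 * C * Np (vN s N)) /\
    Np (fun y => vN s N y - E (vN s N)) <=
      K * (1 + Np (vN s N)) / k.+1%:R +
      (k * n0)%:R * (1 + C * s `^ gamma * (C1 + 2 * C * Np (vN s N)))].
Proof.
have [n0 [K [n00 K0 decay]]] := Np_decay_rate p1 HQ mixF HB C0 alpha01 LY0.
have [C1 C10 Bv] := BN_vN; have [K1 BK1] := BN_one HB.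
have K10 := BN_ge0 HB BK1.
have C20 : 0 < 2 * C by rewrite mulr_gt0.
exists n0, (K * (C1 + 2 * C + K1)), C1; split => //.
  by rewrite mulr_gt0// ltr_wpDr// addr_gt0.
move=> s N k /andP[s0 sd] N0; have s0' := ltW s0.
have sd' : 0 <= s < delta by rewrite s0'.
have B1 := Bv _ _ sd' N0; split => //.
set c := E (vN s N); set f := fun y => vN s N y - c.
have bv := bmf_vN HQ mtau tau0 N s0'.
have bf : bmf f by apply: bmf_sub => //; exact: bmf_cst.
have Ef : E f = 0 by rewrite E_sub ?E_cst ?subrr//; exact: bmf_cst.
have cN : c <= Np (vN s N) by exact: E_vN_le_Np.
have c1 : 1 <= c by exact: (E_vN_ge1 HQ mtau tau0).
have Bf : BN f ((C1 + 2 * C + K1) * (1 + Np (vN s N))).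
  have := BN_add HB B1 (BN_scale HB (- c) BK1).
  rewrite (_ : (fun y => _ + _ * 1) = f); last first.
    by apply/funext => y; rewrite mulr1.
  move=> /(BN_le HB); apply; rewrite normrN ger0_norm ?(le_trans ler01 c1)//.
  have := Np_ge0 mu p (vN s N) => Nv0.
  have h1 : c * K1 <= Np (vN s N) * K1 by rewrite ler_wpM2r.
  have h2 : 0 <= C1 * Np (vN s N) by rewrite mulr_ge0 ?(ltW C10).
  by nra.
(* At time [k * n0] the gap has divided the initial term by [k.+1], while the defect has been paid
   [k * n0] times. *)
apply: (le_trans (Np_telescope (k * n0) bf)); apply: lerD.
  rewrite -(mulrA K); apply: decay => //.
  apply: mulr_gt0; first by rewrite ltr_wpDr// addr_gt0.
  by rewrite ltr_wpDr// Np_ge0.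
by rewrite ler_wpM2l// (vN_defect s0 B1).
Qed.

(** With [k] fixed so that the gap term is at most a quarter of [1 + V], and [s] then small, the
    centered part is at most [V / 2] plus a constant, and [V / 2] is absorbed. Constants are in turn
    multiples of the mean, which is at least [1]. *)
Lemma Np_vN_le_E : exists s0 M, [/\ 0 < s0 <= delta, 0 < M &
  forall s N, 0 < s < s0 -> (0 < N)%N -> Np (vN s N) <= M * E (vN s N)].
Proof.
have [n0 [K [C1 [n00 K0 C10 H]]]] := vN_centered.
pose k := Num.truncn (4 * K).
have Kk : K / k.+1%:R <= 4^-1.
  rewrite ler_pdivrMr// mulrC ler_pdivlMr// mulrC ltW//.
  exact: truncnS_gt.
(* [D] dominates both coefficients of [s ^ gamma] in the cost of the defect, so a single smallness
   condition on [s] handles the constant and the term in [V]. *)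
pose D := (k * n0)%:R * C * (2 * C) + (k * n0)%:R * C * C1 + 1.
have D1 : 1 <= D by rewrite lerDr addr_ge0// !mulr_ge0// ltW.
have D0 : 0 < D by exact: lt_le_trans D1.
have [s1 s10 Hs1] := powR_small gamma0 (e := (4 * D)^-1) ltac:(by rewrite invr_gt0 mulr_gt0).
exists (Num.min s1 delta), (2 * (1 + 1 + (k * n0)%:R + 1)); split.
- by rewrite lt_min s10 delta0/= ge_min lexx orbT.
- by rewrite mulr_gt0// ltr_wpDl.
move=> s N /andP[s0]; rewrite lt_min => /andP[ss1 sd] N0; have s0' := ltW s0.
have sd' : 0 < s < delta by rewrite s0.
have [_] := H s N k sd' N0.
set V := Np (vN s N); set c := E (vN s N).
have bv := bmf_vN HQ mtau tau0 N s0'.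
have c1 : 1 <= c by exact: (E_vN_ge1 HQ mtau tau0).
have V0 : 0 <= V by exact: Np_ge0.
have Vc : V <= c + Np (fun y => vN s N y - c).
  have := Np_add mu p1' (bmf_cst c) (bmf_sub bv (bmf_cst c)).
  rewrite Np_cst// ger0_norm ?(le_trans ler01 c1)//.
  by under [X in Np X <= _ -> _]eq_fun do rewrite subrKC.
move=> HV; have := le_trans Vc (lerD (lexx c) HV).
have e1 : K * (1 + V) / k.+1%:R <= 4^-1 * (1 + V).
  by rewrite mulrAC ler_wpM2r// addr_ge0.
set sg := s `^ gamma.
have sg0 : 0 <= sg by exact: powR_ge0.
have sgD : sg * D <= 4^-1.
  have := Hs1 s; rewrite s0 ss1 => /(_ isT); rewrite -/sg invfM => h.
  by rewrite -ler_pdivlMr.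
have e2 : (k * n0)%:R * (1 + C * sg * (C1 + 2 * C * V)) <= (k * n0)%:R + 4^-1 + 4^-1 * V.
  have -> : (k * n0)%:R * (1 + C * sg * (C1 + 2 * C * V)) =
     (k * n0)%:R + sg * ((k * n0)%:R * C * C1) + sg * ((k * n0)%:R * C * (2 * C)) * V by ring.
  apply: lerD.
    rewrite lerD2l; apply: le_trans sgD; rewrite ler_wpM2l// /D.
    by rewrite addrAC lerDr addr_ge0// !mulr_ge0// ltW.
  rewrite ler_wpM2r//; apply: le_trans sgD; rewrite ler_wpM2l// /D.
  by rewrite -addrA lerDl addr_ge0// !mulr_ge0// ltW.
have kn0 : 0 <= (k * n0)%:R :> R by [].
set kk := (k * n0)%:R in e2 kn0 *.
move=> h; have h3 : V <= c + (4^-1 * (1 + V) + (kk + 4^-1 + 4^-1 * V)).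
  by apply: (le_trans h); rewrite lerD2l lerD.
have h4 : kk <= kk * c by rewrite ler_peMr.
by lra.
Qed.

(** Because [tau_N >= N] almost everywhere, this makes [E (eS s N) <= 1/2]: the truncation keeps at
    least half of the identity for [E ((1 - etau s) * vN s N)]. *)
Definition deep (s : R) (N : nat) : Prop := (0 < N)%N /\ expR (- (s * N%:R)) <= 2^-1.

(** The indicator of [tau < 1] has mean zero, and measure preservation keeps the mean zero along the
    orbit, so every summand is at least [1] almost everywhere. *)
Lemma birkhoff_geN k : {ae mu, forall y, k%:R <= birkhoff_sum F tau k y}.
Proof.
elim: k => [|k IH]; first by apply: aeW => y; rewrite /birkhoff_sum big_ord0.
have bi : bmf (fun y => \1_[set y | tau y < 1] y : R).
  by apply: bmf_indic; apply: measurable_ltset => //; exact: measurable_cst.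
have i0 : ale (fun=> 0) (fun y => \1_[set y | tau y < 1] y : R).
  by apply: aeW => y; rewrite indicE ler0n.
have Ei : E (fun y => \1_[set y | tau y < 1] (iter k F y) : R) = 0.
  rewrite (tr_inv_iter HQ k bi) -[RHS](E_cst mu 0); apply: E_aeq => //.
    exact: bmf_cst.
  by apply: filterS tau1 => y ty; rewrite indicE memNset//= ltNge ty.
have H : aeq (fun y => \1_[set y | tau y < 1] (iter k F y) : R) (fun=> 0).
  apply: E_eq0 Ei; first exact: (bmf_iterF HQ k bi).
  by apply: aeW => y; rewrite indicE ler0n.
apply: filterS2 IH H => y h1 h2.
rewrite /birkhoff_sum big_ord_recr/= -natr1 lerD//.
rewrite leNgt; apply/negP => lt; move: h2; rewrite indicE mem_set//= => /eqP.
by rewrite oner_eq0.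
Qed.

Lemma E_eS_le s N : 0 <= s -> E (eS s N) <= expR (- (s * N%:R)).
Proof.
move=> s0; rewrite -[leRHS](E_cst mu); apply: E_le_ae.
- exact: (bmf_eS HQ mtau tau0).
- exact: bmf_cst.
apply: filterS (birkhoff_geN N) => y h.
by rewrite ler_expR lerN2 ler_wpM2l.
Qed.

(** Here [k] depends on [s]: with [k] of order [s ^ (- gamma / 2)] the gap term [1 / k] and the cost
    [k * s ^ gamma] are both of order [s ^ (gamma / 2)]. *)
Lemma vN_rate : exists s0 M, [/\ 0 < s0 <= delta, 0 < M &
  forall s N, 0 < s < s0 -> deep s N -> Np (vN s N) <= M * E (vN s N) /\
    Np (fun y => vN s N y - E (vN s N)) <= M * s `^ (gamma / 2) * E (vN s N)].
Proof.
have [n0 [K [C1 [n00 K0 C10 H]]]] := vN_centered.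
have [s0 [M [/andP[s00 s0d] M0 HM]]] := Np_vN_le_E.
pose X := C1 + 2 * C * M.
have X0 : 0 < X by rewrite addr_gt0// !mulr_gt0.
pose M2 := K * (1 + M) + n0%:R * (2 * C * X + C * X).
have n0R : 0 < n0%:R :> R by rewrite ltr0n.
have M20 : 0 < M2 by rewrite addr_gt0// mulr_gt0// addr_gt0// !mulr_gt0.
exists s0, (M + M2); split; [by rewrite s00|by rewrite addr_gt0|].
move=> s N /andP[sp ss0] [N0 eN]; have s0' := ltW sp.
have ss : 0 < s < s0 by rewrite sp.
have sd : 0 < s < delta by rewrite sp (lt_le_trans ss0).
have VM := HM s N ss N0.
set V := Np (vN s N) in VM *; set c := E (vN s N) in VM *.
have c1 : 1 <= c by exact: (E_vN_ge1 HQ mtau tau0).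
have c0 : 0 <= c by exact: le_trans c1.
have M2c : 0 <= M2 * c by rewrite mulr_ge0// ltW.
split; first by rewrite (le_trans VM)// ler_wpM2r// lerDl ltW.
pose sg := s `^ gamma; pose r := s `^ (gamma / 2).
have r0 : 0 < r by exact: powR_gt0.
have sgr : sg = r * r.
  by rewrite /sg /r -powRD ?gt_eqF ?implybT// -splitr.
pose k := Num.truncn r^-1.
have r1 : 0 <= r^-1 by rewrite invr_ge0 ltW.
have kr : k%:R <= r^-1 by have := truncn_itv r1 => /andP[].
have kr2 : r^-1 <= k.+1%:R by apply: ltW; exact: truncnS_gt.
have [BV Hc] := H s N k sd N0.
have bv := bmf_vN HQ mtau tau0 N s0'; have be := bmf_etau mtau tau0 s0'.
have Xc : C1 + 2 * C * V <= X * c.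
  have -> : X * c = C1 * c + 2 * C * (M * c) by rewrite /X; ring.
  apply: lerD; first by rewrite ler_peMr// ltW.
  by rewrite ler_pM2l ?mulr_gt0.
(* The constant [1] in the defect carries no factor [s ^ gamma]. Depth supplies it: [1/2 <= E ((1 -
   etau s) * vN s N) <= C * s ^ gamma * X * c], so [1] is itself at most a multiple of
   [s ^ gamma * c]. *)
have sgc : 1 <= 2 * C * sg * X * c.
  have b1e : bmf (fun y => (1 - etau s y) * vN s N y).
    by apply: bmf_mul => //; apply: bmf_sub => //; exact: bmf_cst.
  have h1 := E_1etau_vN HQ mtau tau0 N s0'.
  have h2 := E_eS_le N s0'.
  have h3 : E (fun y => (1 - etau s y) * vN s N y) <= C * sg * (X * c).
    apply: (@le_trans _ _ (C * sg * (C1 + 2 * C * V))); last first.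
      by rewrite ler_wpM2l// mulr_ge0 ?powR_ge0// ltW.
    rewrite -(tr_E HQ b1e); apply: le_trans (moment sp bv _ BV); last exact: (vN_ge0 HQ mtau tau0).
    apply: (le_trans (ler_norm _)); have bQ := tr_bmf HQ b1e.
    apply: (le_trans (E_norm mu bQ)); exact: E_abs_le_Np.
  have h4 : 2^-1 <= C * sg * (X * c).
    apply: le_trans h3; rewrite h1 lerBrDr -lerBrDl (le_trans h2)// (le_trans eN)//.
    by lra.
  have := h4; rewrite -(ler_pM2l (ltr0n R 2)) mulfV// => /le_trans; apply.
  by rewrite le_eqVlt; apply/orP; left; apply/eqP; ring.
apply: (le_trans Hc).
have t1 : K * (1 + V) / k.+1%:R <= K * (1 + M) * r * c.
  have ek : k.+1%:R^-1 <= r.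
    by rewrite -[leRHS]invrK lef_pV2 ?posrE ?invr_gt0.
  apply: (@le_trans _ _ (K * ((1 + M) * c) * r)); last first.
    by rewrite le_eqVlt; apply/orP; left; apply/eqP; ring.
  apply: ler_pM => //; first by rewrite mulr_ge0 ?addr_ge0 ?Np_ge0// ltW.
  by rewrite ler_pM2l// mulrDl mul1r lerD.
have t2 : (k * n0)%:R * (1 + C * sg * (C1 + 2 * C * V)) <=
    n0%:R * (2 * C * X + C * X) * r * c.
  apply: (@le_trans _ _ (r^-1 * n0%:R * (2 * C * sg * X * c + C * sg * (X * c)))).
    apply: ler_pM.
    - by [].
    - rewrite addr_ge0// !mulr_ge0 ?powR_ge0 ?(ltW C0)// addr_ge0 ?(ltW C10)//.
      by rewrite !mulr_ge0 ?Np_ge0 ?(ltW C0).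
    - by rewrite natrM ler_wpM2r.
    - by apply: lerD => //; rewrite ler_wpM2l// mulr_ge0 ?powR_ge0 ?(ltW C0).
  rewrite le_eqVlt; apply/orP; left; apply/eqP; rewrite sgr.
  by field; rewrite gt_eqF.
have := lerD t1 t2 => /le_trans; apply.
have -> : K * (1 + M) * r * c + n0%:R * (2 * C * X + C * X) * r * c = M2 * r * c.
  by rewrite /M2; ring.
by rewrite ler_wpM2r// ler_wpM2r ?(ltW r0)// lerDr ltW.
Qed.

Lemma Phi_ge0 s : 0 <= s -> 0 <= Phi s.
Proof. by move=> s0; apply: E_ge0 => y; rewrite subr_ge0 etau_le1. Qed.

(* Since [vN s N] is close to its mean in a high [L^p] norm, the identity
   [E ((1 - etau s) * vN s N) = 1 - E (eS s N)] gives
   [E (vN s N) * Phi s ~ 1]. *)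
Lemma E_vN_Phi (eta : R) : 0 < eta ->
  (forall e, 0 < e -> exists2 s0, 0 < s0 & forall s, 0 < s < s0 ->
     s `^ (gamma / 2 * p) <= e * Phi s) ->
  exists2 s0, 0 < s0 <= delta & forall s N, 0 < s < s0 -> deep s N ->
    Np (fun y => vN s N y - E (vN s N)) <= eta * E (vN s N) /\
    `|E (vN s N) * Phi s - 1| <=
      expR (- (s * N%:R)) + eta * (E (vN s N) * Phi s).
Proof.
move=> eta0 HPhi; have [s0 [M [/andP[s00 s0d] M0 H]]] := vN_rate.
have [eta2 eta2E] : exists x, x = eta / 2 by exists (eta / 2).
have eta20 : 0 < eta2 by rewrite eta2E divr_gt0.
(* The tail bound is applied at level [eta2 * c]. Its second term is at most [eta2 ^ (1 - p) * M ^ p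
   * s ^ (gamma / 2 * p) * c], which this [e] turns into [eta2 * Phi s * c]. *)
pose e := eta2 / (eta2 `^ (1 - p) * M `^ p).
have e0 : 0 < e by rewrite divr_gt0// mulr_gt0// powR_gt0.
have [s1 s10 Hs1] := HPhi e e0.
have g20 : 0 < gamma / 2 by rewrite divr_gt0.
have [s2 s20 Hs2] := powR_small g20 (e := eta / M) ltac:(by rewrite divr_gt0).
exists (Num.min s0 (Num.min s1 s2)).
  by rewrite !lt_min s00 s10 s20/= ge_min s0d.
move=> s N /andP[sp]; rewrite !lt_min => /and3P[ss0 ss1 ss2] dN.
have s0' := ltW sp; have N0 : (0 < N)%N by case: dN.
have [VM Vr] := H s N ltac:(by rewrite sp) dN.
have Hp := Hs1 s ltac:(by rewrite sp).
have Hr := Hs2 s ltac:(by rewrite sp).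
set c := E (vN s N) in VM Vr *.
have c1 : 1 <= c by exact: (E_vN_ge1 HQ mtau tau0).
have c0 : 0 < c by exact: lt_le_trans c1.
set f := fun y => vN s N y - c.
split.
  apply: (le_trans Vr); rewrite ler_pM2r//.
  by rewrite mulrC -ler_pdivlMr.
have bv := bmf_vN HQ mtau tau0 N s0'; have be := bmf_etau mtau tau0 s0'.
have b1 : bmf (fun y => 1 - etau s y) by apply: bmf_sub => //; exact: bmf_cst.
have bf : bmf f by apply: bmf_sub => //; exact: bmf_cst.
have b1f := bmf_mul b1 bf.
have id : c * Phi s - 1 = - E (eS s N) - E (fun y => (1 - etau s y) * f y).
  have := E_1etau_vN HQ mtau tau0 N s0'.
  rewrite (_ : E (fun y => (1 - etau s y) * vN s N y) =
     c * Phi s + E (fun y => (1 - etau s y) * f y)).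
    by move=> h; lra.
  rewrite /Phi -E_scale// -E_add//; last by apply: bmf_mul => //; exact: bmf_cst.
  by apply: E_ext => y; rewrite /f; ring.
rewrite id -opprD normrN.
have hE : 0 <= E (eS s N) by apply: E_ge0 => y; exact: eS_ge0.
apply: (le_trans (ler_normD _ _)); apply: lerD.
  by rewrite ger0_norm// E_eS_le.
apply: (le_trans (E_norm mu b1f)).
have -> : E (fun y => `|(1 - etau s y) * f y|) = E (fun y => (1 - etau s y) * `|f y|).
  apply: E_ext => y; rewrite normrM [in LHS]ger0_norm// subr_ge0.
  exact: etau_le1.
have P01 y : 0 <= 1 - etau s y <= 1.
  by rewrite subr_ge0 etau_le1//= lerBlDr lerDl etau_ge0.
apply: (le_trans (E_tail_le mu p1' bf b1 P01 (eta := eta2 * c) (mulr_gt0 eta20 c0))).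
rewrite -/(Phi s) (_ : eta * (c * Phi s) = eta2 * c * Phi s + eta2 * Phi s * c); last first.
  by rewrite eta2E; field.
rewrite lerD2l.
have p0 : 0 <= p by exact: le_trans p1'.
set r := s `^ (gamma / 2) in Vr.
have r0 : 0 <= r by exact: powR_ge0.
apply: (@le_trans _ _ ((eta2 * c) `^ (1 - p) * (M * r * c) `^ p)).
  rewrite ler_wpM2l ?powR_ge0//; apply: ge0_ler_powR => //; rewrite nnegrE ?Np_ge0//.
  by rewrite !mulr_ge0// ltW.
have -> : (eta2 * c) `^ (1 - p) * (M * r * c) `^ p =
    (eta2 `^ (1 - p) * M `^ p) * r `^ p * c.
  rewrite !powRM ?mulr_ge0 ?(ltW eta20) ?(ltW c0) ?(ltW M0)//.
  rewrite (_ : _ * _ = (eta2 `^ (1 - p) * M `^ p) * r `^ p * (c `^ (1 - p) * c `^ p)).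
    by congr (_ * _); rewrite -powRD ?(gt_eqF c0) ?implybT// subrK powRr1// ltW.
  by ring.
rewrite ler_pM2r// -ler_pdivlMl; last by rewrite mulr_gt0// powR_gt0.
rewrite /r -powRrM; apply: (le_trans Hp); rewrite /e.
by rewrite mulrAC mulrC.
Qed.

End ResolventEstimates.
(** Dominated convergence along [s = 1 / n.+1]; monotonicity in [s] then covers every smaller
    [s]. *)
Lemma E_1expR_small {R : realType} {d : measure_display} {Y : measurableType d}
    (mu : probability Y R) (X : Y -> R) (e : R) :
  measurable_fun [set: Y] X -> (forall y, 0 <= X y) -> 0 < e ->
  exists2 s0 : R, 0 < s0 & forall s : R, 0 < s < s0 ->
    E mu (fun y => 1 - expR (- (s * X y))) <= e.
Proof.
move=> mX X0 e0.
have bX (s : R) : 0 <= s -> bmf (fun y => 1 - expR (- (s * X y))).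
  move=> s0; apply: bmf_sub; first exact: bmf_cst.
  apply: bmf_expRN; last by move=> y; rewrite mulr_ge0.
  by apply: measurable_funM; [exact: measurable_cst|exact: mX].
pose u n : R := n.+1%:R^-1.
have u0 n : 0 < u n by rewrite invr_gt0.
have : E mu (fun y => 1 - expR (- (u n * X y))) @[n --> \oo] --> E mu (fun=> 0).
  apply: (@E_bounded_cvg _ _ _ mu (fun n y => 1 - expR (- (u n * X y))) (fun=> 0) 1).
  - by move=> n; exact: (proj1 (bX _ (ltW (u0 n)))).
  - exact: measurable_cst.
  - move=> n y; rewrite ger0_norm; first by rewrite lerBlDr lerDl expR_ge0.
    by rewrite subr_ge0 -expR0 ler_expR oppr_le0 mulr_ge0 ?(ltW (u0 n)).
  move=> y; have : u n * X y @[n --> \oo] --> 0 * X y.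
    by apply: cvgMl; exact: cvg_harmonic.
  rewrite mul0r => h.
  have : 1 - expR (- (u n * X y)) @[n --> \oo] --> 1 - expR (- (0 : R)).
    apply: cvgB; first exact: cvg_cst.
    by apply: (cvg_comp _ _ (cvgN h)); exact: continuous_expR.
  by rewrite oppr0 expR0 subrr.
rewrite E_cst.
move=> /cvgrPdist_le /(_ e e0) [n _ /(_ n (leqnn n))].
rewrite sub0r normrN => H; exists (u n) => // s /andP[s0 sn].
apply: le_trans (le_trans (ler_norm _) H).
apply: E_le; [exact/bX/ltW|exact/bX/ltW|move=> y].
by rewrite lerD2l lerN2 ler_expR lerN2 ler_wpM2r// ltW.
Qed.

(** Expand the square over pairs and order each pair, smaller index first; the diagonal is counted
    once too often, hence the inequality. *)
Lemma sqr_sum_le {R : realType} (N : nat) (a : nat -> R) : (forall k, 0 <= a k) ->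
  (\sum_(k < N) a k) ^+ 2 <= 2 * \sum_(j < N) a j * \sum_(k < N - j) a (j + k)%N.
Proof.
elim: N a => [|N IH] a a0; first by rewrite !big_ord0 expr0n mulr0.
have := IH (fun k => a k.+1) (fun k => a0 k.+1).
rewrite [X in _ -> X ^+ 2 <= _]big_ord_recl [X in _ -> _ <= _ * X]big_ord_recl.
rewrite /= subn0 big_ord_recl/=.
set S := \sum_(k < N) _; set T := \sum_(j < N) _.
have S0 : 0 <= S by apply: sumr_ge0.
have := a0 0%N; rewrite add0n => a00 h.
have : 0 <= a 0%N * a 0%N by rewrite mulr_ge0.
have : 0 <= a 0%N * S by rewrite mulr_ge0.
rewrite expr2 in h *; nra.
Qed.

Lemma ler_sum_widen {R : realType} (m n : nat) (b : nat -> R) : (m <= n)%N ->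
  (forall k, 0 <= b k) -> \sum_(k < m) b k <= \sum_(k < n) b k.
Proof.
move=> mn b0; rewrite -(subnKC mn) big_split_ord/= lerDl.
exact: sumr_ge0.
Qed.

(** * Laplace transform of the correlations *)

Section Correlations.
Context {R : realType} {d : measure_display} {Y : measurableType d}.
Variable mu : probability Y R.
Variables (F : Y -> Y) (Q : (Y -> R) -> Y -> R) (tau : Y -> R).
Implicit Types f g h w : Y -> R.
Local Notation E := (E mu).
Variable p : R.
Local Notation Np := (Np mu p).
Local Notation vN := (vN Q tau).
Local Notation eS := (eS F tau).
Local Notation Phi := (Phi mu tau).

Hypothesis p2 : 2 <= p.
Hypothesis HQ : bounded_transfer mu F Q.
Hypothesis mtau : measurable_fun [set: Y] tau.
Hypothesis tau0 : forall y, 0 <= tau y.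

Let p1 : 1 <= p. Proof. by apply: le_trans p2; rewrite ler1n. Qed.

(** The counterpart of [vN] before duality: [E (GN s w N) = E (vN s N * w)]. Being defined along
    orbits, it can be shifted in time by the cocycle identity. *)
Definition GN (s : R) (w : Y -> R) N y : R :=
  \sum_(k < N) eS s k y * w (iter k F y).

Lemma bmf_eSw s k w : 0 <= s -> bmf w -> bmf (fun y => eS s k y * w (iter k F y)).
Proof.
move=> s0 bw; apply: bmf_mul; first exact: (bmf_eS HQ mtau tau0).
exact: (bmf_iterF HQ).
Qed.

Lemma bmf_GN s w N : 0 <= s -> bmf w -> bmf (GN s w N).
Proof. by move=> s0 bw; apply: bmf_sum => k _; exact: bmf_eSw. Qed.

Lemma GN1_ge0 s N y : 0 <= GN s (fun=> 1) N y.
Proof. by apply: sumr_ge0 => k _; rewrite mulr1 expR_ge0. Qed.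

Lemma E_GN s w N : 0 <= s -> bmf w -> E (GN s w N) = E (fun y => vN s N y * w y).
Proof.
move=> s0 bw; rewrite (vN_dual HQ mtau tau0)// /GN E_sum// => k _.
exact: bmf_eSw.
Qed.

(* Squaring the sum and using the cocycle property of [birkhoff_sum] bounds
   [E (GN ^+ 2)] by [2 * E (vN * GN)]. *)
Lemma GN_L2 s N : 0 <= s ->
  Num.sqrt (E (fun y => GN s (fun=> 1) N y ^+ 2)) <= 2 * Np (vN s N).
Proof.
move=> s0; pose G := GN s (fun=> 1) N.
have b1 := @bmf_cst R _ Y 1.
have bG : bmf G by exact: bmf_GN.
have bG2 := bmf_exp 2 bG.
have bv := bmf_vN HQ mtau tau0 N s0; have bv2 := bmf_exp 2 bv.
have bGF k : bmf (fun y => eS s k y * G (iter k F y)) by exact: bmf_eSw.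
have H1 : E (fun y => G y ^+ 2) <= 2 * E (fun y => vN s N y * G y).
  rewrite (vN_dual HQ mtau tau0)// -E_sum// -E_scale; last first.
    by apply: bmf_sum => k _.
  apply: E_le => //.
    by apply: bmf_mul; [exact: bmf_cst|apply: bmf_sum => k _].
  move=> y; rewrite /G /GN.
  have e0 k : 0 <= eS s k y * 1 by rewrite mulr1 expR_ge0.
  apply: (le_trans (sqr_sum_le N e0)).
  rewrite ler_pM2l//; apply: ler_sum => j _; rewrite mulr1 ler_wpM2l ?expR_ge0//.
  apply: (@le_trans _ _ (\sum_(k < N - j) eS s k (iter j F y) * 1)).
    apply: ler_sum => k _; rewrite !mulr1 eSD ler_piMl ?expR_ge0//.
    exact: eS_le1.
  apply: (ler_sum_widen (b := fun k => eS s k (iter j F y) * 1) (leq_subr j N)) => k.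
  by rewrite mulr1 expR_ge0.
have H2 := cauchy_schwarz mu bv bG.
set x := Num.sqrt (E (fun y => G y ^+ 2)).
have x2 : x * x = E (fun y => G y ^+ 2).
  by rewrite -expr2 sqr_sqrtr// E_sq_ge0.
have H3 : Num.sqrt (E (fun y => vN s N y ^+ 2)) <= Np (vN s N).
  rewrite -[leRHS]ger0_norm ?Np_ge0// -sqrtr_sqr ler_sqrt ?sqr_ge0//.
  exact: E_sq_le_Np.
have [x0|] := eqVneq x 0; first by rewrite x0 mulr_ge0// Np_ge0.
move=> xn0; have xp : 0 < x by rewrite lt_def xn0 sqrtr_ge0.
rewrite -(ler_pM2r xp) x2; apply: (le_trans H1); rewrite -mulrA ler_pM2l//.
apply: (le_trans (le_trans (ler_norm _) H2)).
by rewrite ler_wpM2r// sqrtr_ge0.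
Qed.

(** Shifting time by [n] drops the first [n] terms of the sum and appends [n] new ones, all in
    [[0, 1]]; the two changes have opposite signs. *)
Lemma GN_shift s w N n y : 0 <= s -> (forall z, 0 <= w z <= 1) ->
  `|GN s w N y - eS s n y * GN s w N (iter n F y)| <= n%:R.
Proof.
move=> s0 w01; pose x k := eS s k y * w (iter k F y).
have x01 k : 0 <= x k <= 1.
  have /andP[w0 w1] := w01 (iter k F y).
  by rewrite mulr_ge0 ?expR_ge0//= mulr_ile1// ?expR_ge0// eS_le1.
have -> : eS s n y * GN s w N (iter n F y) = \sum_(k < N) x (n + k)%N.
  rewrite /GN mulr_sumr; apply: eq_bigr => k _.
  by rewrite /x eSD mulrA addnC iterD.
have H m M : \sum_(k < m) x k + \sum_(k < M) x (m + k)%N = \sum_(k < m + M) x k.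
  by rewrite big_split_ord.
have b (z : nat -> R) : (forall k, 0 <= z k <= 1) -> 0 <= \sum_(k < n) z k <= n%:R.
  move=> z01; apply/andP; split; first by apply: sumr_ge0 => k _; case/andP: (z01 k).
  rewrite -[leRHS]mulr1 mulr_natl -[X in _ *+ X]card_ord -sumr_const.
  by apply: ler_sum => k _; case/andP: (z01 k).
have := b x x01; have := b (fun k => x (N + k)%N) (fun k => x01 _).
have := H n N; rewrite addnC -(H N n) -/(GN s w N y) => h /andP[a1 a2] /andP[a3 a4].
rewrite ler_norml; apply/andP; split; lra.
Qed.

(** Three replacements: shift the sum by [n] ([T1]), drop the weight [eS s n] ([T2]), then move the
    [n] steps onto [a] by duality and replace [Q^n a] by its mean ([T3]). The last two use
    Cauchy-Schwarz and the [L^2] bound on [GN], so that their errors are proportional to the norm of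
    [vN]. *)
Lemma correlation_bound s w a N n : 0 <= s -> bmf w -> (forall z, 0 <= w z <= 1) ->
  bmf a -> (forall z, 0 <= a z <= 1) ->
  `|E (fun y => a y * GN s w N y) - E a * E (GN s w N)| <=
  n%:R + (Num.sqrt (E (fun y => 1 - eS s n y)) +
          Num.sqrt (E (fun y => `|iter n Q a y - E a|))) * (2 * Np (vN s N)).
Proof.
move=> s0 bw w01 ba a01; set g := GN s w N.
have bg : bmf g by exact: bmf_GN.
have bgF := bmf_iterF HQ n bg.
have be := bmf_eS HQ mtau tau0 n s0.
have b1e : bmf (fun y => 1 - eS s n y) by apply: bmf_sub => //; exact: bmf_cst.
have g0 y : 0 <= g y.
  by apply: sumr_ge0 => k _; rewrite mulr_ge0 ?expR_ge0//; case/andP: (w01 (iter k F y)).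
have gG y : g y <= GN s (fun=> 1) N y.
  by apply: ler_sum => k _; rewrite ler_wpM2l ?expR_ge0//; case/andP: (w01 (iter k F y)).
have gL2 : Num.sqrt (E (fun y => g y ^+ 2)) <= 2 * Np (vN s N).
  apply: le_trans (GN_L2 N s0); rewrite ler_sqrt ?E_sq_ge0//.
  apply: E_le; [exact: bmf_exp|exact/bmf_exp/bmf_GN/bmf_cst|].
  by move=> y; rewrite lerXn2r// nnegrE ?GN1_ge0.
have gFL2 : Num.sqrt (E (fun y => g (iter n F y) ^+ 2)) <= 2 * Np (vN s N).
  by rewrite (tr_inv_iter HQ n (bmf_exp 2 bg)).
have bQa := bmf_iterQ HQ n ba.
have bz : bmf (fun y => iter n Q a y - E a) by apply: bmf_sub => //; exact: bmf_cst.
have ba1 : bmf (fun y => a y * (1 - eS s n y)) by exact: bmf_mul.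
have bag := bmf_mul ba bg; have begF := bmf_mul be bgF.
have baeg := bmf_mul ba begF; have bagF := bmf_mul ba bgF.
have Ea01 : 0 <= E a <= 1.
  apply/andP; split; first by apply: E_ge0 => y; case/andP: (a01 y).
  rewrite -[leRHS](E_cst mu); apply: E_le => //; first exact: bmf_cst.
  by move=> y; case/andP: (a01 y).
have T1 : `|E (fun y => a y * g y) - E (fun y => a y * (eS s n y * g (iter n F y)))| <= n%:R.
  rewrite -E_sub//.
  apply: (le_trans (E_norm mu (bmf_sub bag baeg))).
  rewrite -[leRHS](E_cst mu); apply: E_le; [exact/bmf_abs/bmf_sub|exact: bmf_cst|].
  move=> y; rewrite -mulrBr normrM; have /andP[a0 a1] := a01 y.
  rewrite (ger0_norm a0); apply: le_trans (GN_shift N n y s0 w01).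
  by rewrite ler_piMl.
have T2 : `|E (fun y => a y * (eS s n y * g (iter n F y))) - E (fun y => a y * g (iter n F y))|
    <= Num.sqrt (E (fun y => 1 - eS s n y)) * (2 * Np (vN s N)).
  rewrite distrC -E_sub//.
  have -> : E (fun y => a y * g (iter n F y) - a y * (eS s n y * g (iter n F y))) =
     E (fun y => (a y * (1 - eS s n y)) * g (iter n F y)).
    by apply: E_ext => y; ring.
  apply: (le_trans (cauchy_schwarz mu ba1 bgF)).
  apply: ler_pM; rewrite ?sqrtr_ge0// ler_sqrt.
    apply: E_le => //; first exact: bmf_exp.
    move=> y; have /andP[a0 a1] := a01 y.
    have e0 := eS_ge0 F tau s n y; have e1 := eS_le1 F tau0 n y s0.
    rewrite expr2; apply: (@le_trans _ _ (1 * (1 - eS s n y))); last by rewrite mul1r.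
    apply: ler_pM; rewrite ?mulr_ge0 ?subr_ge0//.
      by rewrite mulr_ile1 ?subr_ge0// lerBlDr lerDl.
    by rewrite ler_piMl ?subr_ge0.
  by apply: E_ge0 => y; rewrite subr_ge0 eS_le1.
have T3 : `|E (fun y => a y * g (iter n F y)) - E a * E g| <=
    Num.sqrt (E (fun y => `|iter n Q a y - E a|)) * (2 * Np (vN s N)).
  rewrite -(tr_dual_iter HQ n ba bg) -E_scale// -E_sub; last 2 first.
  - exact: bmf_mul.
  - by apply: bmf_mul => //; exact: bmf_cst.
  have -> : E (fun y => iter n Q a y * g y - E a * g y) =
     E (fun y => (iter n Q a y - E a) * g y).
    by apply: E_ext => y; ring.
  apply: (le_trans (cauchy_schwarz mu bz bg)).
  apply: ler_pM; rewrite ?sqrtr_ge0// ler_sqrt; last by apply: E_ge0.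
  (* [Q^n a] and [E a] both lie in [[0, 1]], so the squared difference is at most the difference
     itself: decay in [L^1] controls the [L^2] norm. *)
  apply: E_le_ae; [exact: bmf_exp|exact: bmf_abs|].
  have b1 := @bmf_cst R _ Y 1; have b0 := @bmf_cst R _ Y 0.
  have Hu : ale mu (iter n Q a) (iter n Q (fun=> 1)).
    by apply: (tr_iter_ale HQ) => //; apply: aeW => y; case/andP: (a01 y).
  have Hl : ale mu (iter n Q (fun=> 0)) (iter n Q a).
    by apply: (tr_iter_ale HQ) => //; apply: aeW => y; case/andP: (a01 y).
  apply: filterS2 (filterI Hu Hl) (filterI (tr_iter_cst HQ n 1) (tr_iter_cst HQ n 0)).
  move=> y [h1 h2] [e1 e2]; rewrite e1 in h1; rewrite e2 in h2.
  rewrite -real_normK ?num_real// expr2 ler_piMl//.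
  case/andP: Ea01 => u1 u2; rewrite ler_norml; apply/andP; split; lra.
rewrite mulrDl addrA.
set X1 := E (fun y => a y * g y) in T1 *.
set X2 := E (fun y => a y * (eS s n y * g (iter n F y))) in T1 T2.
set X3 := E (fun y => a y * g (iter n F y)) in T2 T3.
have -> : X1 - E a * E g = (X1 - X2) + (X2 - X3) + (X3 - E a * E g) by ring.
apply: (le_trans (ler_normD _ _)); apply: lerD => //.
by apply: (le_trans (ler_normD _ _)); apply: lerD.
Qed.

Hypothesis rate : exists s1 M, [/\ 0 < s1, 0 < M & forall s N, 0 < s < s1 ->
  deep s N -> Np (vN s N) <= M * E (vN s N)].
Hypothesis key : forall eta : R, 0 < eta -> exists2 s0, 0 < s0 &
  forall s N, 0 < s < s0 -> deep s N ->
    Np (fun y => vN s N y - E (vN s N)) <= eta * E (vN s N) /\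
    `|E (vN s N) * Phi s - 1| <=
      expR (- (s * N%:R)) + eta * (E (vN s N) * Phi s).
Variables (a w : Y -> R).
Hypotheses (ba : bmf a) (a01 : forall z, 0 <= a z <= 1).
Hypotheses (bw : bmf w) (w01 : forall z, 0 <= w z <= 1).
Hypothesis decay : forall e, 0 < e -> exists n,
  E (fun y => `|iter n Q a y - E a|) <= e.

(** The errors are small multiples of [c = E (vN s N)], and [c * Phi s] stays between [1/4] and [2],
    so multiplication by [Phi s] makes them small in absolute value. *)
Lemma laplace_correlation (eta : R) : 0 < eta ->
  exists2 s0, 0 < s0 & forall s N, 0 < s < s0 -> deep s N ->
    `|E (fun y => a y * GN s w N y) * Phi s - E a * E w| <=
      expR (- (s * N%:R)) + eta.
Proof.
wlog eta1 : eta / eta <= 1.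
  move=> H eta0; have [e1|e1] := leP eta 1; first exact: H.
  have [s0 s00 Hs] := H 1 (lexx _) ltr01; exists s0 => // s N ss dN.
  by apply: (le_trans (Hs s N ss dN)); rewrite lerD2l ltW.
move=> eta0; have [s1 [M [s10 M0 HM]]] := rate.
pose t := eta / 24.
have t0 : 0 < t by rewrite divr_gt0.
have [s2 s20 H2] := key t0.
(* Each of the two square roots in [correlation_bound] becomes at most [t / (2 * M)]; they multiply
   [2 * Np (vN s N) <= 2 * M * c], which leaves [2 * t * c]. *)
pose q := (t / (2 * M)) ^+ 2.
have q0 : 0 < q by rewrite exprn_gt0// divr_gt0// mulr_gt0.
have [n Hn] := decay q0.
have mb := measurable_birkhoff HQ mtau n.
have [s3 s30 H3] := E_1expR_small mu mb (birkhoff_ge0 F tau0 n) q0.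
(* [Phi s <= q'] together with [c * Phi s >= 1/4] forces [c >= (n + 1) / t]: the [n] terms lost in
   the time shift are at most [t * c]. *)
pose q' := t / (4 * (n%:R + 1)).
have n1 : 0 < n%:R + 1 :> R by rewrite ltr_wpDl.
have q'0 : 0 < q' by rewrite divr_gt0// mulr_gt0.
have [s4 s40 H4] := E_1expR_small mu mtau tau0 q'0.
exists (Num.min (Num.min s1 s2) (Num.min s3 s4)).
  by rewrite !lt_min s10 s20 s30 s40.
move=> s N /andP[sp]; rewrite !lt_min => /andP[/andP[ss1 ss2] /andP[ss3 ss4]] dN.
have s0' := ltW sp.
have VM := HM s N ltac:(by rewrite sp) dN.
have [Vr cP] := H2 s N ltac:(by rewrite sp) dN.
have E3 := H3 s ltac:(by rewrite sp).
have E4 : Phi s <= q' by apply: H4; rewrite sp.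
set c := E (vN s N) in VM Vr cP *.
have c1 : 1 <= c by apply: (E_vN_ge1 HQ mtau tau0) => //; case: dN.
have c0 : 0 <= c by exact: le_trans c1.
have P0 : 0 <= Phi s by exact: Phi_ge0.
have cP0 : 0 <= c * Phi s by rewrite mulr_ge0.
have e2 : expR (- (s * N%:R)) <= 2^-1 by case: dN.
have t24 : t <= 24^-1 by rewrite /t ler_pdivrMr// mulVf.
set ex := expR (- (s * N%:R)) in cP e2 *.
have tc : t * (c * Phi s) <= 24^-1 * (c * Phi s) by rewrite ler_wpM2r.
have /andP[cl cu] : 4^-1 <= c * Phi s <= 2.
  by move: cP; rewrite ler_norml => /andP[h1 h2]; apply/andP; split; lra.
have nc : n%:R <= t * c.
  have : 4^-1 <= c * q' by apply: (le_trans cl); rewrite ler_wpM2l.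
  rewrite /q' mulrA ler_pdivlMr ?mulr_gt0// mulrC => h.
  by move: h; lra.
have bv := bmf_vN HQ mtau tau0 N s0'.
have w1 y : `|w y| <= 1 by case/andP: (w01 y) => h1 h2; rewrite ger0_norm.
have /andP[Ea0 Ea1] : 0 <= E a <= 1.
  apply/andP; split; first by apply: E_ge0 => y; case/andP: (a01 y).
  rewrite -[leRHS](E_cst mu); apply: E_le => //; first exact: bmf_cst.
  by move=> y; case/andP: (a01 y).
have /andP[Ew0 Ew1] : 0 <= E w <= 1.
  apply/andP; split; first by apply: E_ge0 => y; case/andP: (w01 y).
  rewrite -[leRHS](E_cst mu); apply: E_le => //; first exact: bmf_cst.
  by move=> y; case/andP: (w01 y).
have B1 : `|E (GN s w N) - c * E w| <= t * c.
  rewrite E_GN// -E_scale// -E_sub; last 2 first.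
  - exact: bmf_mul.
  - by apply: bmf_mul => //; exact: bmf_cst.
  rewrite (_ : E _ = E (fun y => (vN s N y - c) * w y)); last first.
    by apply: E_ext => y; ring.
  apply: le_trans Vr; apply: E_le_Np => //.
  by apply: bmf_sub => //; exact: bmf_cst.
have sqq x : x <= q -> Num.sqrt x <= t / (2 * M).
  move=> xq; rewrite -[leRHS]ger0_norm; last by rewrite divr_ge0 ?(ltW t0)// mulr_ge0// ltW.
  by rewrite -sqrtr_sqr ler_sqrt// sqr_ge0.
have B2 : `|E (fun y => a y * GN s w N y) - E a * E (GN s w N)| <= 3 * t * c.
  apply: (le_trans (correlation_bound N n s0' bw w01 ba a01)).
  have h1 := sqq _ E3; have h2 := sqq _ Hn.
  have -> : 3 * t * c = t * c + (t / (2 * M) + t / (2 * M)) * (2 * (M * c)).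
    by field; rewrite gt_eqF.
  apply: lerD => //; apply: ler_pM.
  - by rewrite addr_ge0 ?sqrtr_ge0.
  - by rewrite mulr_ge0 ?Np_ge0.
  - exact: lerD.
  - by rewrite ler_pM2l.
set X := E (fun y => a y * GN s w N y) in B2 *.
set Z := E (GN s w N) in B1 B2 *.
have B3 : `|X - E a * E w * c| <= 4 * t * c.
  have -> : X - E a * E w * c = (X - E a * Z) + E a * (Z - c * E w) by ring.
  apply: (le_trans (ler_normD _ _)).
  have -> : 4 * t * c = 3 * t * c + t * c by ring.
  apply: lerD => //; rewrite normrM (ger0_norm Ea0); apply: le_trans B1.
  by rewrite ler_piMl.
have -> : X * Phi s - E a * E w = (X - E a * E w * c) * Phi s + E a * E w * (c * Phi s - 1).
  by ring.
apply: (le_trans (ler_normD _ _)); rewrite !normrM (ger0_norm P0).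
rewrite (ger0_norm Ea0) (ger0_norm Ew0).
have h1 : `|X - E a * E w * c| * Phi s <= 8 * t.
  apply: (@le_trans _ _ (4 * t * c * Phi s)); first by rewrite ler_wpM2r.
  rewrite -(mulrA (4 * t)); apply: (@le_trans _ _ (4 * t * 2)).
    by rewrite ler_wpM2l// mulr_ge0// ltW.
  by lra.
have h2 : E a * E w * `|c * Phi s - 1| <= ex + 2 * t.
  apply: (@le_trans _ _ `|c * Phi s - 1|).
    by rewrite ler_piMl// mulr_ile1.
  apply: (le_trans cP); rewrite lerD2l mulrC; rewrite ler_wpM2r// ltW//.
by have := lerD h1 h2; rewrite /t; lra.
Qed.

End Correlations.
(** * Regularly varying tails *)

Section RegularTail.
Context {R : realType}.
Variables (T : R -> R) (beta : R).
Hypothesis beta0 : 0 <= beta.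
Hypothesis T01 : forall t, 0 <= T t <= 1.
Hypothesis Tmono : forall s t, s <= t -> T t <= T s.
Hypothesis TRV : forall l : R, 0 < l ->
  T (l * t) / T t @[t --> +oo] --> l `^ (- beta).

Lemma tail_gt0 t : 0 < T t.
Proof.
rewrite lt_def; case/andP: (T01 t) => -> _; rewrite andbT; apply/eqP => T0.
have T0' u : t <= u -> T u = 0.
  move=> tu; apply/eqP; rewrite eq_le; case/andP: (T01 u) => -> _.
  by rewrite andbT -T0 Tmono.
(* For [l = 1] the ratio must tend to [1]; a zero of the monotone [T] would make it eventually
   [0 / 0], which is [0] here. *)
have := TRV ltr01; rewrite powR1 => /cvgrPdist_lt /(_ 1 ltr01) [A [_ HA]].
have /HA : A < Num.max t (A + 1).
  by rewrite lt_max ltrDl ltr01 orbT.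
rewrite mul1r T0' ?le_max ?lexx// mul0r subr0 normr1.
by rewrite ltxx.
Qed.

(** Potter's bound. As [T (t / 2) / T t] tends to [2 ^ beta < 2 ^ b], each halving of a large
    argument costs at most [2 ^ b], and iteration produces the power of [t / u]. The threshold is
    imposed on [t] alone: for [u < t1] one compares [T u <= 1] with [T t1], hence the factor
    [1 / T t1] in the constant. *)
Lemma potter (b : R) : beta < b -> exists t1 C, [/\ 0 < t1, 0 < C &
  forall t u, t1 <= t -> 0 < u <= t -> T u <= C * (t / u) `^ b * T t].
Proof.
move=> bb; have h2 : 0 < 2^-1 :> R by rewrite invr_gt0.
have b0 : 0 < b by exact: le_lt_trans bb.
have inv2 (c : R) : 2^-1 `^ c = (2 `^ c)^-1.
  by rewrite -powR_inv1// -powRrM mulN1r powRN.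
have lim2 : 2^-1 `^ (- beta) = 2 `^ beta :> R by rewrite inv2 powRN invrK.
have lt2 : 2 `^ beta < 2 `^ b :> R 
  by rewrite /powR !gt_eqF// ltr_expR ltr_pM2r// ln_gt0// ltr1n.
have := TRV h2; rewrite lim2 => /cvgrPdist_lt /(_ (2 `^ b - 2 `^ beta)).
rewrite subr_gt0 lt2 => /(_ isT) [A [_ HA]].
pose t1 := Num.max 1 (A + 1).
have t10 : 0 < t1 by rewrite lt_max ltr01.
have half t : t1 <= t -> T (t / 2) <= 2 `^ b * T t.
  rewrite ge_max => /andP[_ At]; have /HA : A < t by rewrite (lt_le_trans _ At)// ltrDl.
  rewrite distrC ltr_distl subrKC [_ * t]mulrC => /andP[_].
  by move=> h; rewrite -ler_pdivrMr ?tail_gt0// ltW.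
have powge1 (z : R) : 1 <= z -> 1 <= z `^ b.
  have p1 : 1 `^ b = 1 :> R by rewrite powR1.
  move=> z1; rewrite -[leLHS]p1.
  by apply: ge0_ler_powR; rewrite ?nnegrE ?(ltW b0)// (le_trans ler01).
(* [n] bounds the number of halvings that lead from [t] to [u]; the extra factor [2 ^ b] pays for
   the last, incomplete one. *)
have key n t u : t1 <= u -> u <= t -> t <= 2 ^+ n * u ->
    T u <= 2 `^ b * (t / u) `^ b * T t.
  have p2b : 1 <= 2 `^ b :> R by rewrite powge1// ler1n.
  elim: n t u => [|n IH] t u tu ut tn.
    have -> : t = u by apply/eqP; rewrite eq_le ut andbT -[leRHS]mul1r -(expr0 2).
    have u0 : u != 0 by rewrite gt_eqF// (lt_le_trans t10).
    by rewrite divff// powR1 mulr1 ler_peMl// ltW// tail_gt0.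
  have u0 : 0 < u by exact: lt_le_trans tu.
  have t0 : 0 < t by exact: lt_le_trans ut.
  have hf := half t (le_trans tu ut).
  have [ut2|ut2] := leP u (t / 2).
    have tn2 : t / 2 <= 2 ^+ n * u by rewrite ler_pdivrMr// mulrAC -exprSr.
    apply: (le_trans (IH _ _ tu ut2 tn2)).
    have -> : t / 2 / u = 2^-1 * (t / u) by rewrite mulrAC mulrC.
    rewrite powRM ?divr_ge0 ?(ltW u0) ?(ltW t0)// inv2.
    have -> : 2 `^ b * ((2 `^ b)^-1 * (t / u) `^ b) * T (t / 2) =
        (t / u) `^ b * T (t / 2).
      by field; rewrite gt_eqF// powR_gt0.
    by rewrite (mulrC (2 `^ b)) -mulrA ler_pM2l ?powR_gt0 ?divr_gt0.
  apply: (@le_trans _ _ (T (t / 2))); first by rewrite Tmono// ltW.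
  apply: (le_trans hf); rewrite ler_pM2r ?tail_gt0// ler_peMr ?powR_ge0//.
  by apply: powge1; rewrite ler_pdivlMr// mul1r.
have key2 t u : t1 <= u -> u <= t -> T u <= 2 `^ b * (t / u) `^ b * T t.
  move=> tu ut; apply: (key (Num.truncn (t / u)).+1) => //.
  have u0 : 0 < u by exact: lt_le_trans tu.
  rewrite -ler_pdivrMr//; apply: (@le_trans _ _ (Num.truncn (t / u)).+1%:R).
    exact/ltW/truncnS_gt.
  by rewrite -natrX ler_nat ltnW// ltn_expl.
have Tt1 := tail_gt0 t1; have /andP[_ Tt11] := T01 t1.
have p2b : 0 < 2 `^ b :> R by exact: powR_gt0.
exists t1, (2 `^ b / T t1); split => //; first exact: divr_gt0.
move=> t u tt1 /andP[u0 ut].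
have t0 : 0 < t by exact: lt_le_trans ut.
have [tu|ut1] := leP t1 u.
  apply: (le_trans (key2 _ _ tu ut)); rewrite ler_pM2r ?tail_gt0//.
  rewrite ler_pM2r ?powR_gt0 ?divr_gt0//.
  by rewrite ler_peMr ?(ltW p2b)// -invr1 lef_pV2 ?posrE.
case/andP: (T01 u) => _ /le_trans; apply.
have -> : 2 `^ b / T t1 * (t / u) `^ b * T t = (2 `^ b * (t / u) `^ b * T t) / T t1.
  by ring.
rewrite ler_pdivlMr// mul1r; apply: (le_trans (key2 _ _ (lexx t1) tt1)).
rewrite ler_pM2r ?tail_gt0// ler_pM2l//.
apply: ge0_ler_powR; rewrite ?nnegrE ?divr_ge0 ?(ltW b0) ?(ltW t0) ?(ltW u0) ?(ltW t10)//.
by rewrite ler_pM2l// lef_pV2 ?posrE// ltW.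
Qed.

Lemma tail_lower (b : R) : beta < b -> exists t1 c, [/\ 0 < t1, 0 < c &
  forall t, t1 <= t -> c * t `^ (- b) <= T t].
Proof.
move=> bb; have [t1 [C [t10 C0 H]]] := potter bb.
exists t1, (T t1 / (C * t1^-1 `^ b)); split => //.
  by rewrite divr_gt0 ?tail_gt0// mulr_gt0// powR_gt0// invr_gt0.
move=> t tt1; have t0 : 0 < t by exact: lt_le_trans tt1.
have := H t t1 tt1 ltac:(by rewrite t10).
rewrite powRM ?invr_ge0 ?(ltW t0) ?(ltW t10)// => h.
rewrite powRN mulrAC ler_pdivrMr ?mulr_gt0 ?powR_gt0 ?invr_gt0//.
rewrite ler_pdivrMr ?powR_gt0//; apply: (le_trans h).
by rewrite le_eqVlt; apply/orP; left; apply/eqP; ring.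
Qed.

End RegularTail.
(** * Karamata's Tauberian theorem *)

Section Bernstein.
Context {R : realType}.
Implicit Types f g : nat -> R.

(** The [n]-th Bernstein polynomial with [f] sampled at the integers, that is, the mean of [f] at a
    binomial variable with parameters [n] and [y]. Conditioning on one trial gives the recursion,
    and its moments become ring computations free of binomial coefficients. *)
Fixpoint bernstein (n : nat) f : {poly R} :=
  if n is n'.+1 then (1 - 'X) * bernstein n' f + 'X * bernstein n' (f \o succn)
  else (f 0%N)%:P.

Lemma bernsteinS n f y : (bernstein n.+1 f).[y] =
  (1 - y) * (bernstein n f).[y] + y * (bernstein n (f \o succn)).[y].
Proof. by rewrite /= !hornerE. Qed.

Lemma bernstein_le n f g y : 0 <= y <= 1 -> (forall k, f k <= g k) ->
  (bernstein n f).[y] <= (bernstein n g).[y].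
Proof.
move=> /andP[y0 y1]; elim: n f g => [|n IH] f g fg; first by rewrite /= !hornerC.
rewrite !bernsteinS; apply: lerD; apply: ler_wpM2l; rewrite ?subr_ge0//.
  exact: IH.
by apply: IH => k /=.
Qed.

Lemma bernsteinD n f g y : (bernstein n (fun k => f k + g k)).[y] =
  (bernstein n f).[y] + (bernstein n g).[y].
Proof.
elim: n f g => [|n IH] f g; first by rewrite /= !hornerC.
by rewrite !bernsteinS (IH f g) (IH (f \o succn) (g \o succn)); ring.
Qed.

Lemma bernsteinZ n a f y : (bernstein n (fun k => a * f k)).[y] =
  a * (bernstein n f).[y].
Proof.
elim: n f => [|n IH] f; first by rewrite /= !hornerC.
by rewrite !bernsteinS (IH f) (IH (f \o succn)); ring.
Qed.

Lemma bernstein_cst n c y : (bernstein n (fun=> c)).[y] = c.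
Proof.
elim: n => [|n IH]; first by rewrite /= hornerC.
by rewrite bernsteinS (_ : (fun=> c) \o succn = fun=> c)// IH; ring.
Qed.

Lemma bernstein_id n y : (bernstein n (fun k => k%:R)).[y] = n%:R * y.
Proof.
elim: n => [|n IH]; first by rewrite /= hornerC mul0r.
rewrite bernsteinS (_ : _ \o succn = fun k => k%:R + 1); last first.
  by apply/funext => k /=; rewrite -natr1.
by rewrite bernsteinD bernstein_cst IH -natr1; ring.
Qed.

Lemma bernstein_sqr n y : (bernstein n (fun k => k%:R ^+ 2)).[y] =
  n%:R * y + n%:R * (n%:R - 1) * y ^+ 2.
Proof.
elim: n => [|n IH]; first by rewrite /= hornerC; ring.
rewrite bernsteinS (_ : _ \o succn = fun k => k%:R ^+ 2 + (2 * k%:R + 1)); last first.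
  by apply/funext => k /=; rewrite -natr1; ring.
rewrite !bernsteinD bernsteinZ bernstein_cst bernstein_id IH -natr1; ring.
Qed.

(** Bernstein's proof: [|y - z| <= dl + (y - z) ^ 2 / dl] turns the Lipschitz bound into one by the
    binomial variance [y * (1 - y) / n]. *)
Lemma lipschitz_poly_approx (h : R -> R) K (e : R) : 0 < e ->
  (forall x y, `|h x - h y| <= K * `|x - y|) ->
  exists P : {poly R}, forall y, 0 <= y <= 1 -> `|h y - P.[y]| <= e.
Proof.
move=> e0 hK; have K0 : 0 <= K.
  have := hK 1 0; rewrite subr0 normr1 mulr1; exact: le_trans.
(* [K + 1] in place of [K] keeps the divisions legitimate when [K = 0]. With this [dl] and the [n]
   below, [K * dl] and the variance term are at most [e / 2] each. *)
pose dl := e / (2 * (K + 1)).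
have K1 : 0 < K + 1 by rewrite ltr_wpDl.
have dl0 : 0 < dl by rewrite divr_gt0// mulr_gt0.
pose n := (Num.truncn ((K + 1) * 2 / (dl * e))).+1.
have n0 : 0 < n%:R :> R by rewrite ltr0n.
have nbig : (K + 1) * 2 / (dl * e) <= n%:R by apply: ltW; exact: truncnS_gt.
pose f k := h (k%:R / n%:R).
exists (bernstein n f) => y y01.
have bnd g : (forall k, `|h y - f k| <= g k) ->
   `|h y - (bernstein n f).[y]| <= (bernstein n g).[y].
  move=> fg; have -> : h y - (bernstein n f).[y] = (bernstein n (fun k => h y + -1 * f k)).[y].
    by rewrite bernsteinD bernsteinZ bernstein_cst mulN1r.
  rewrite ler_norml -[- (bernstein n g).[y]]mulN1r -bernsteinZ; apply/andP; split.
    apply: bernstein_le => // k.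
    by have := fg k; rewrite !mulN1r ler_norml => /andP[].
  apply: bernstein_le => // k.
  by have := fg k; rewrite !mulN1r ler_norml => /andP[].
apply: (le_trans (bnd (fun k => K * dl + (K / (dl * n%:R ^+ 2)) *
    ((n%:R * y) ^+ 2 + ((- (2 * (n%:R * y))) * k%:R + k%:R ^+ 2))) _)).
  move=> k; apply: (le_trans (hK _ _)).
  set z := k%:R / n%:R; have zn : k%:R = z * n%:R :> R by rewrite divfK// gt_eqF.
  have -> : K * dl + K / (dl * n%:R ^+ 2) *
      ((n%:R * y) ^+ 2 + (- (2 * (n%:R * y)) * k%:R + k%:R ^+ 2)) =
      K * (dl + (y - z) ^+ 2 / dl).
    by rewrite zn; field; rewrite !gt_eqF.
  apply: ler_wpM2l => //; rewrite -real_normK ?num_real//.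
  set u := `|y - z|; have u0 : 0 <= u by exact: normr_ge0.
  have [ud|ud] := leP u dl.
    by rewrite (le_trans ud)// lerDl divr_ge0 ?sqr_ge0// ltW.
  rewrite ler_wpDl ?(ltW dl0)// ler_pdivlMr// expr2 ler_wpM2l// ltW//.
rewrite (bernsteinD n (fun=> K * dl) (fun k => _ * (_ + (_ * k%:R + k%:R ^+ 2)))).
rewrite (bernsteinZ n _ (fun k => _ + (_ * k%:R + k%:R ^+ 2))).
rewrite (bernsteinD n (fun=> (n%:R * y) ^+ 2) (fun k => _ * k%:R + k%:R ^+ 2)).
rewrite (bernsteinD n (fun k => _ * k%:R) (fun k => k%:R ^+ 2)).
rewrite (bernsteinZ n _ (fun k => k%:R)) !bernstein_cst bernstein_id bernstein_sqr.
have -> : K * dl + K / (dl * n%:R ^+ 2) * ((n%:R * y) ^+ 2 +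
    (- (2 * (n%:R * y)) * (n%:R * y) + (n%:R * y + n%:R * (n%:R - 1) * y ^+ 2))) =
    K * dl + K / dl * (y * (1 - y)) / n%:R.
  by field; rewrite !gt_eqF.
have /andP[y0 y1] := y01.
have h1 : K * dl <= e / 2.
  have -> : K * dl = K / (K + 1) * (e / 2) by rewrite /dl; field; rewrite gt_eqF.
  by rewrite ler_piMl ?divr_ge0 ?(ltW e0)// ler_pdivrMr// mul1r lerDl.
have h2 : K / dl * (y * (1 - y)) / n%:R <= e / 2.
  rewrite ler_pdivrMr//.
  apply: (@le_trans _ _ ((K + 1) / dl)).
    apply: (@le_trans _ _ (K / dl)).
      rewrite ler_piMr ?divr_ge0 ?(ltW dl0)//; nra.
    by rewrite ler_wpM2r ?invr_ge0 ?(ltW dl0)// lerDl.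
  rewrite -ler_pdivrMl ?divr_gt0//; apply: le_trans nbig.
  by rewrite le_eqVlt; apply/orP; left; apply/eqP; field; rewrite !gt_eqF.
by rewrite [leRHS]splitr lerD.
Qed.

End Bernstein.

(** * From convergence of moments to pointwise convergence of monotone functions *)

Section Tauberian.
Context {R : realType}.
Local Notation leb := (@lebesgue_measure R).
Local Notation D := (`[0%R, +oo[%classic : set R).
Implicit Types V g : R -> R.

Let mD : measurable D. Proof. exact: measurable_itv. Qed.

Definition laplace_weight V (x : R) : R := expR (- x) * V x.

(* For [g = (fun y => y ^+ j)] this is the Laplace transform of [V] at [j + 1]. *)
Definition laplace_test V g : R :=
  \int[leb]_(x in D) (g (expR (- x)) * laplace_weight V x).

Definition laplace_adm V : Prop :=
  [/\ measurable_fun [set: R] V, forall x, 0 <= x -> 0 <= V x,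
      forall x y, 0 <= x <= y -> V x <= V y &
      leb.-integrable D (EFin \o laplace_weight V)].

(** The bound is asked on [[0, 1]], where [expR (- x)] lives for [x >= 0], so that polynomials
    qualify. *)
Definition bounded01 g : Prop :=
  measurable_fun [set: R] g /\ exists M, forall y, 0 <= y <= 1 -> `|g y| <= M.

Lemma expRN_01 (x : R) : 0 <= x -> 0 <= expR (- x) <= 1.
Proof. by move=> x0; rewrite expR_ge0 expR_le1 oppr_le0. Qed.

Lemma measurable_expRN : measurable_fun [set: R] (fun x : R => expR (- x)).
Proof.
apply: (measurableT_comp (@measurable_expR R)).
by apply: (measurableT_comp (@oppr_measurable R setT)).
Qed.

Lemma measurable_weight V : measurable_fun [set: R] V ->
  measurable_fun [set: R] (laplace_weight V).
Proof. by move=> mV; apply: measurable_funM => //; exact: measurable_expRN. Qed.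

Lemma laplace_integrable V g : laplace_adm V -> bounded01 g ->
  leb.-integrable D (fun x => (g (expR (- x)) * laplace_weight V x)%:E).
Proof.
move=> [mV V0 Vm iV] [mg [M' gM]]; have [M {}gM] : exists M : R, forall y, 0 <= y <= 1 -> `|g y| <= M.
  by exists M'.
have iMV : leb.-integrable D (fun x => (M * laplace_weight V x)%:E).
  have H : leb.-integrable D (fun x => M%:E * (EFin \o laplace_weight V) x)%E.
    exact: integrableZl.
  by apply: eq_integrable H.
apply: le_integrable iMV => //.
  apply/measurable_EFinP; apply: measurable_funTS; apply: measurable_funM.
    exact: (measurableT_comp mg measurable_expRN).
  exact: measurable_weight.
move=> x; rewrite /= in_itv/= andbT => x0; rewrite lee_fin !normrM.
rewrite ler_wpM2r ?mulr_ge0//; apply: (le_trans (gM _ (expRN_01 x0))).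
exact: ler_norm.
Qed.

Lemma laplace_test_le V g1 g2 : laplace_adm V -> bounded01 g1 -> bounded01 g2 ->
  (forall y, 0 <= y <= 1 -> g1 y <= g2 y) ->
  laplace_test V g1 <= laplace_test V g2.
Proof.
move=> aV b1 b2 g12; apply: le_Rintegral => //; do ?exact: laplace_integrable.
case: aV => _ V0 _ _ x; rewrite /= in_itv/= andbT => x0.
rewrite ler_wpM2r ?mulr_ge0 ?expR_ge0 ?V0//; exact/g12/expRN_01.
Qed.

Lemma laplace_testD V g1 g2 : laplace_adm V -> bounded01 g1 -> bounded01 g2 ->
  laplace_test V (fun y => g1 y + g2 y) = laplace_test V g1 + laplace_test V g2.
Proof.
move=> aV b1 b2; rewrite /laplace_test -RintegralD//; last 2 first.
- exact: laplace_integrable.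
- exact: laplace_integrable.
by apply: eq_Rintegral => x _; rewrite mulrDl.
Qed.

Lemma laplace_testZ V a g : laplace_adm V -> bounded01 g ->
  laplace_test V (fun y => a * g y) = a * laplace_test V g.
Proof.
move=> aV b1; rewrite /laplace_test -RintegralZl//; last exact: laplace_integrable.
by apply: eq_Rintegral => x _; rewrite mulrA.
Qed.

Lemma bounded01D g1 g2 : bounded01 g1 -> bounded01 g2 ->
  bounded01 (fun y => g1 y + g2 y).
Proof.
move=> [m1 [M1 h1]] [m2 [M2 h2]]; split; first exact: measurable_funD.
by exists (M1 + M2) => y y01; rewrite (le_trans (ler_normD _ _))// lerD ?h1 ?h2.
Qed.

Lemma bounded01Z a g : bounded01 g -> bounded01 (fun y => a * g y).
Proof.
move=> [m1 [M1 h1]]; split; first by apply: measurable_funM.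
by exists (`|a| * M1) => y y01; rewrite normrM ler_wpM2l ?h1.
Qed.

Lemma bounded01X n : bounded01 (fun y => y ^+ n).
Proof.
split; first exact: measurable_funX.
by exists 1 => y /andP[y0 y1]; rewrite ger0_norm ?exprn_ge0 ?exprn_ile1.
Qed.

Lemma bounded01_sum n (c : nat -> R) : bounded01 (fun y => \sum_(i < n) c i * y ^+ i).
Proof.
elim: n => [|n IH].
  rewrite (_ : (fun y => _) = fun=> 0); first by split => //; exists 0 => y _; rewrite normr0.
  by apply/funext => y; rewrite big_ord0.
rewrite (_ : (fun y => _) = fun y => \sum_(i < n) c i * y ^+ i + c n * y ^+ n).
  exact/bounded01D/bounded01Z/bounded01X.
by apply/funext => y; rewrite big_ord_recr.
Qed.

Lemma bounded01_poly (P : {poly R}) : bounded01 (fun y => P.[y]).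
Proof.
rewrite (_ : (fun y => _) = fun y => \sum_(i < size P) P`_i * y ^+ i).
  exact: bounded01_sum.
by apply/funext => y; rewrite horner_coef.
Qed.

Lemma bounded01_cst (c : R) : bounded01 (fun=> c).
Proof. by split => //; exists `|c|. Qed.

(** Evaluated at [exp (- x)], a bump on an interval of [x]. It is Lipschitz, hence a uniform limit
    of polynomials on [[0, 1]], unlike an indicator; the monotonicity of [V] makes up for the loss
    of sharpness. *)
Definition tent (a b y : R) : R := Num.max 0 (Num.min (y - a) (b - y)).

Lemma tent_lipschitz a b x y : `|tent a b x - tent a b y| <= 1 * `|x - y|.
Proof.
have H u v : tent a b u <= tent a b v + `|u - v|.
  have : `|u - v| <= `|u - v| by []; rewrite ler_norml => /andP[h1 h2].
  rewrite /tent ge_max addr_ge0 ?le_max ?lexx//= -lerBlDr le_max; apply/orP; right.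
  rewrite le_min !lerBlDr !ge_min; apply/andP; split; apply/orP.
    by left; lra.
  by right; lra.
rewrite mul1r; have := H x y; have := H y x; rewrite distrC => h1 h2.
by rewrite ler_norml; apply/andP; split; lra.
Qed.

Lemma tent_ge0 a b y : 0 <= tent a b y.
Proof. by rewrite le_max lexx. Qed.

Lemma bounded01_tent a b : bounded01 (tent a b).
Proof.
split.
  apply: measurable_maxr; first exact: measurable_cst.
  by apply: measurable_minr; apply: measurable_funB.
exists (`|b| + 1) => y /andP[y0 y1]; rewrite ger0_norm ?tent_ge0// /tent.
rewrite ge_max addr_ge0//= ge_min; apply/orP; right.
rewrite (@le_trans _ _ b) ?gerBl//.
by rewrite (le_trans (ler_norm b))// lerDl.
Qed.

Lemma tent_out (x1 x4 x : R) : ~~ (x1 < x < x4) ->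
  tent (expR (- x4)) (expR (- x1)) (expR (- x)) = 0.
Proof.
rewrite negb_and -!leNgt => h; apply/eqP; rewrite eq_le tent_ge0 andbT /tent.
rewrite ge_max lexx/= ge_min !subr_le0 !ler_expR !lerN2.
by case/orP: h => ->; rewrite ?orbT.
Qed.

Lemma laplace_adm1 : laplace_adm (fun=> 1).
Proof.
split => //.
rewrite /laplace_weight.
have H : leb.-integrable D (EFin \o exponential_pdf 1).
  apply: (@integrableS _ _ _ leb setT) => //.
  exact: integrable_exponential_pdf.
move: H; apply: eq_integrable => // x; rewrite inE/= in_itv/= andbT => x0.
by rewrite /= exponential_pdfE// /exponential_pdf mul1r mulN1r mulr1.
Qed.

(** The tent is at least [c] on the middle third [[x2, x3]]. Positivity allows dividing by this mass
    to obtain averages. *)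
Lemma tent_mass_gt0 (x1 x4 : R) : 0 <= x1 < x4 ->
  0 < laplace_test (fun=> 1) (tent (expR (- x4)) (expR (- x1))).
Proof.
move=> /andP[x10 x14]; pose h := (x4 - x1) / 3.
have h0 : 0 < h by rewrite divr_gt0// subr_gt0.
pose x2 := x1 + h; pose x3 := x1 + 2 * h.
have x23 : x2 < x3 by rewrite /x2 /x3; lra.
have x34 : x3 < x4 by rewrite /x3 /h; lra.
pose c := Num.min (expR (- x3) - expR (- x4)) (expR (- x1) - expR (- x2)).
have c0 : 0 < c by rewrite lt_min !subr_gt0 !ltr_expR !ltrN2 x34/= ltrDl.
pose T := tent (expR (- x4)) (expR (- x1)).
have sub : `[x2, x3] `<=` D.
  move=> x; rewrite /= !in_itv/= andbT => /andP[h1 _].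
  by apply: le_trans h1; rewrite addr_ge0// ltW.
have iT := laplace_integrable laplace_adm1 (bounded01_tent (expR (- x4)) (expR (- x1))).
have H : (\int[leb]_(x in `[x2, x3]) (c * expR (- x3))%:E <=
    \int[leb]_(x in D) (T (expR (- x)) * laplace_weight (fun=> 1) x)%:E)%E.
  apply: (@le_trans _ _ (\int[leb]_(x in `[x2, x3]) (T (expR (- x)) * laplace_weight (fun=> 1) x)%:E)%E).
    apply: ge0_le_integral => //.
    - by move=> x _; rewrite lee_fin mulr_ge0 ?expR_ge0// ltW.
    - apply/measurable_EFinP; apply: measurable_funTS; apply: measurable_funM.
        exact: (measurableT_comp (proj1 (bounded01_tent _ _)) measurable_expRN).
      by apply: measurable_weight; exact: measurable_cst.
    - move=> x; rewrite /= in_itv/= => /andP[h1 h2]; rewrite lee_fin.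
      rewrite /laplace_weight mulr1 ler_pM ?expR_ge0 ?(ltW c0)//; last first.
        by rewrite ler_expR lerN2.
      rewrite /T /tent le_max; apply/orP; right.
      rewrite le_min !ge_min !lerD2r !lerD2l lerN2 !ler_expR !lerN2 h1 h2 ?orbT//.
  apply: ge0_subset_integral => //.
  - exact: (measurable_int _ iT).
  - by move=> x _; rewrite lee_fin mulr_ge0 ?tent_ge0// mulr_ge0 ?expR_ge0.
have Jf : (\int[leb]_(x in D) (T (expR (- x)) * laplace_weight (fun=> 1) x)%:E)%E \is a fin_num.
  exact: integrable_fin_num.
rewrite -lte_fin /laplace_test /Rintegral fineK//; apply: lt_le_trans H.
rewrite integral_cst//= lebesgue_measure_itv/= lte_fin x23 -EFinD -EFinM lte_fin.
by rewrite !mulr_gt0 ?expR_gt0// subr_gt0.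
Qed.

Lemma tent_bounds V x1 x4 : laplace_adm V -> 0 <= x1 < x4 ->
  V x1 * laplace_test (fun=> 1) (tent (expR (- x4)) (expR (- x1))) <=
    laplace_test V (tent (expR (- x4)) (expR (- x1))) <=
  V x4 * laplace_test (fun=> 1) (tent (expR (- x4)) (expR (- x1))).
Proof.
move=> aV /andP[x10 x14].
have bh := bounded01_tent (expR (- x4)) (expR (- x1)).
have iV := laplace_integrable aV bh.
have i1 := laplace_integrable laplace_adm1 bh.
case: aV => _ _ Vm _.
have iZ c : leb.-integrable D (EFin \o (fun x => c *
    (tent (expR (- x4)) (expR (- x1)) (expR (- x)) * laplace_weight (fun=> 1) x))).
  have H : leb.-integrable D (fun x => c%:E * (tent (expR (- x4)) (expR (- x1)) (expR (- x)) * laplace_weight (fun=> 1) x)%:E)%E.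
    exact: integrableZl.
  by apply: eq_integrable H.
rewrite /laplace_test -!RintegralZl//.
have swap c (z w : R) : c * (z * (w * 1)) = z * (w * c) by ring.
apply/andP; split; apply: le_Rintegral => // x; rewrite /= in_itv/= andbT => x0;
  rewrite /laplace_weight swap;
  (have [/andP[h1 h4]|/tent_out ->] := boolP (x1 < x < x4); last by rewrite !mul0r);
  apply: ler_wpM2l; rewrite ?tent_ge0//; apply: ler_wpM2l; rewrite ?expR_ge0// Vm//.
  by rewrite x10 ltW.
by rewrite x0 ltW.
Qed.

Let ler_weight_le (v u j lv l0 e : R) :
  0 < j -> v * j <= lv -> l0 <= u * j -> lv <= l0 + e * j -> v <= u + e.
Proof. by move=> j0 h1 h2 h3; rewrite -(ler_pM2r j0) mulrDl; lra. Qed.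

Section Convergence.
Variables (V_ : nat -> R -> R) (V0 : R -> R).
Hypothesis aV_ : forall n, laplace_adm (V_ n).
Hypothesis aV0 : laplace_adm V0.
Hypothesis moments : forall j,
  laplace_test (V_ n) (fun y => y ^+ j) @[n --> \oo] -->
  laplace_test V0 (fun y => y ^+ j).

Lemma laplace_cvg_poly (P : {poly R}) :
  laplace_test (V_ n) (fun y => P.[y]) @[n --> \oo] -->
  laplace_test V0 (fun y => P.[y]).
Proof.
have H m (c : nat -> R) :
    laplace_test (V_ n) (fun y => \sum_(i < m) c i * y ^+ i) @[n --> \oo] -->
    laplace_test V0 (fun y => \sum_(i < m) c i * y ^+ i).
  elim: m => [|m IH].
    have z V : laplace_test V (fun y => \sum_(i < 0) c i * y ^+ i) = 0.
      rewrite /laplace_test (_ : (fun x => _) = fun=> 0); last first.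
        by apply/funext => x; rewrite big_ord0 mul0r.
      by rewrite /Rintegral integral0.
    by rewrite z; under eq_cvg do rewrite z; exact: cvg_cst.
  have E V : laplace_adm V -> laplace_test V (fun y => \sum_(i < m.+1) c i * y ^+ i) =
      laplace_test V (fun y => \sum_(i < m) c i * y ^+ i) +
      c m * laplace_test V (fun y => y ^+ m).
    move=> aV; rewrite -laplace_testZ//; last exact: bounded01X.
    rewrite -laplace_testD//; [|exact: bounded01_sum|exact/bounded01Z/bounded01X].
    by congr (laplace_test V _); apply/funext => y; rewrite big_ord_recr.
  rewrite E//; under eq_cvg do rewrite E//.
  by apply: cvgD => //; apply: cvgMr.
have E V : laplace_test V (fun y => P.[y]) =
    laplace_test V (fun y => \sum_(i < size P) P`_i * y ^+ i).
  by congr (laplace_test V _); apply/funext => y; rewrite horner_coef.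
by rewrite E; under eq_cvg do rewrite E; exact: H.
Qed.

Lemma laplace_cvg_tent a b :
  laplace_test (V_ n) (tent a b) @[n --> \oo] --> laplace_test V0 (tent a b).
Proof.
apply/cvgrPdist_le => e e0.
have one V : laplace_test V (fun y => y ^+ 0) = laplace_test V (fun=> 1).
  by congr (laplace_test V _); apply/funext => y; rewrite expr0.
set J := laplace_test V0 (fun=> 1).
have J0 : 0 <= J.
  apply: Rintegral_ge0 => x; rewrite /= in_itv/= andbT => x0.
  by rewrite mul1r mulr_ge0 ?expR_ge0//; case: aV0 => _ + _ _; exact.
(* The moment [j = 0] bounds the masses [J1] by [J + 1] for large [n], so the two approximation
   errors sum to at most [dl * (2 * J + 1) <= e / 2]. *)
pose dl := e / (2 * (2 * J + 2)).
have dl0 : 0 < dl by rewrite divr_gt0// mulr_gt0// ltr_wpDl// mulr_ge0.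
have [P HP] := lipschitz_poly_approx dl0 (tent_lipschitz a b).
have bt := bounded01_tent a b; have bP := bounded01_poly P.
have b1 := bounded01_cst 1.
have approx V : laplace_adm V ->
    `|laplace_test V (tent a b) - laplace_test V (fun y => P.[y])| <=
    dl * laplace_test V (fun=> 1).
  move=> aV; have bd1 := bounded01Z dl b1.
  have h1 : laplace_test V (tent a b) <= laplace_test V (fun y => P.[y] + dl * 1).
    apply: laplace_test_le => //; first exact: bounded01D.
    by move=> y /HP; rewrite mulr1 ler_distl => /andP[].
  have h2 : laplace_test V (fun y => P.[y]) <= laplace_test V (fun y => tent a b y + dl * 1).
    apply: laplace_test_le => //; first exact: bounded01D.
    by move=> y /HP; rewrite mulr1 ler_distl lerBlDr => /andP[].
  rewrite laplace_testD// laplace_testZ// in h1.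
  rewrite laplace_testD// laplace_testZ// in h2.
  by rewrite ler_norml; apply/andP; split; lra.
have C1 := @moments 0%N; rewrite one -/J in C1.
move/cvgrPdist_le : C1 => /(_ 1 ltr01) C1.
move: (@laplace_cvg_poly P) => /cvgrPdist_le /(_ (e / 2)).
rewrite divr_gt0// => /(_ isT) C2.
apply: filterS2 C1 C2 => n c1 c2; rewrite one in c1.
have a1 := approx _ (aV_ n); have a0 := approx _ aV0; rewrite -/J in a0.
set J1 := laplace_test (V_ n) (fun=> 1) in c1 a1.
have J1J : J1 <= J + 1 by move: c1; rewrite ler_distl => /andP[h1 h2]; lra.
set X := laplace_test V0 (tent a b) in a0 *.
set Z := laplace_test (V_ n) (tent a b) in a1 *.
set X' := laplace_test V0 _ in a0 c2; set Z' := laplace_test (V_ n) _ in a1 c2.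
have -> : X - Z = (X - X') + (X' - Z') + (Z' - Z) by ring.
apply: (le_trans (ler_normD _ _)).
have h3 : dl * J + dl * J1 <= e / 2.
  have -> : e / 2 = dl * (2 * J + 2).
    by rewrite /dl; field; rewrite gt_eqF// ltr_wpDl// mulr_ge0.
  rewrite -mulrDr ler_pM2l//; lra.
have h4 := ler_normD (X - X') (X' - Z').
rewrite (distrC Z').
lra.
Qed.

(* By monotonicity [V_ n 1] lies between the averages of [V_ n] against tent
   functions of [expR (- x)] supported on either side of [x = 1]. *)
Theorem laplace_tauberian : V0 x @[x --> (1 : R)] --> V0 1 ->
  V_ n 1 @[n --> \oo] --> V0 1.
Proof.
move=> cV0; apply/cvgrPdist_le => e e0.
move/cvgrPdist_le : cV0 => /(_ (e / 2)); rewrite divr_gt0// => /(_ isT).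
case=> eta0 /= eta00 Heta.
(* [eta0 / 2] stays strictly inside the neighborhood of continuity, and [1/2] keeps the left tent
   within [x >= 0]. *)
pose eta := Num.min (eta0 / 2) (2^-1).
have eta_gt0 : 0 < eta by rewrite lt_min divr_gt0//= invr_gt0.
have eta_le : eta < eta0 by rewrite gt_min ltr_pdivrMr// ltr_pMr// ltr1n.
have eta1 : eta < 1 by rewrite gt_min orbC invf_lt1// ltr1n.
have Vu : V0 (1 + eta) <= V0 1 + e / 2.
  have := Heta (1 + eta); rewrite /= opprD addNKr normrN gtr0_norm// => /(_ eta_le).
  by rewrite ler_distl => /andP[h1 h2]; lra.
have Vl : V0 1 - e / 2 <= V0 (1 - eta).
  have := Heta (1 - eta); rewrite /= opprB addrC subrK gtr0_norm// => /(_ eta_le).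
  by rewrite ler_distl => /andP[h1 h2]; lra.
have x14u : 0 <= (1 : R) < 1 + eta by rewrite ler01 ltrDl.
have x14l : 0 <= 1 - eta < 1 by rewrite subr_ge0 ltW//= gtrBl.
have cu := @laplace_cvg_tent (expR (- (1 + eta))) (expR (- 1)).
have cl := @laplace_cvg_tent (expR (- 1)) (expR (- (1 - eta))).
have Ju := tent_mass_gt0 x14u; have Jl := tent_mass_gt0 x14l.
set hu := tent _ _ in cu Ju; set hl := tent _ _ in cl Jl.
set ju := laplace_test _ hu in Ju; set jl := laplace_test _ hl in Jl.
have e20 : 0 < e / 2 by rewrite divr_gt0.
move/cvgrPdist_le : cu => /(_ _ (mulr_gt0 e20 Ju)) cu.
move/cvgrPdist_le : cl => /(_ _ (mulr_gt0 e20 Jl)) cl.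
apply: filterS2 cu cl => n cu cl.
have /andP[u1 _] := tent_bounds (aV_ n) x14u.
have /andP[_ u2] := tent_bounds aV0 x14u.
have /andP[_ l1] := tent_bounds (aV_ n) x14l.
have /andP[l2 _] := tent_bounds aV0 x14l.
rewrite -/hu -/ju in u1 u2; rewrite -/hl -/jl in l1 l2.
move: cu; rewrite distrC ler_distl => /andP[_ cu1].
move: cl; rewrite ler_distl => /andP[_ cl2'].
have a1 := ler_weight_le Ju u1 u2 cu1.
have a2 := ler_weight_le Jl l2 l1 cl2'.
rewrite distrC ler_distl; apply/andP; split; last first.
  rewrite (le_trans a1)// (le_trans (lerD Vu (lexx _)))//.
  by rewrite -addrA -splitr.
by have := le_trans Vl a2; rewrite !lerBlDr -addrA -splitr.
Qed.

End Convergence.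
End Tauberian.
(** * Laplace transforms of distribution functions *)

Section LayerCake.
Context {R : realType} {d : measure_display} {Y : measurableType d}.
Variable mu : probability Y R.
Local Notation leb := (@lebesgue_measure R).

(** Tonelli's theorem for [k x] times the indicator of [S]. *)
Lemma layer_cake (k : R -> R) (S : set (R * Y)) :
  measurable_fun [set: R] k -> (forall x, 0 <= k x) -> measurable S ->
  (\int[leb]_x ((k x)%:E * mu (xsection S x)) =
   \int[mu]_y \int[leb]_(x in ysection S y) (k x)%:E)%E.
Proof.
move=> mk k0 mS.
pose f (z : measurableTypeR R * Y) : \bar R := ((k z.1)%:E * (\1_S z)%:E)%E.
have mf : measurable_fun [set: measurableTypeR R * Y] f.
  apply: emeasurable_funM; apply/measurable_EFinP.
    by apply: (measurableT_comp mk); exact: measurable_fst.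
  exact: measurable_indic.
have f0 z : (0 <= f z)%E by rewrite mule_ge0 ?lee_fin.
have := @fubini_tonelli _ _ (measurableTypeR R) Y R leb mu f mf f0.
move=> H; transitivity (\int[leb]_x \int[mu]_y f (x, y))%E.
  apply: eq_integral => x _; rewrite /f/=.
  rewrite ge0_integralZl//; last 2 first.
  - apply/measurable_EFinP.
    have H1 : measurable_fun [set: Y] (\1_(xsection S x) : Y -> R).
      by apply: measurable_indic; exact: measurable_xsection.
    move: H1; apply: eq_measurable_fun => y _.
    by rewrite /= !indicE mem_xsection.
  - by rewrite lee_fin.
  congr (_ * _)%E.
  transitivity (\int[mu]_y (\1_(xsection S x) y)%:E)%E.
    by rewrite integral_indic ?setIT//; exact: measurable_xsection.
  by apply: eq_integral => y _; rewrite !indicE mem_xsection.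
rewrite H; apply: eq_integral => y _.
rewrite [RHS]integral_mkcond; apply: eq_integral => x _.
rewrite patchE /f/= indicE -mem_ysection.
by case: ifP => _; rewrite ?mule1 ?mule0.
Qed.

End LayerCake.

Section ExponentialKernel.
Context {R : realType}.
Local Notation leb := (@lebesgue_measure R).

Lemma continuous_expRNl (l : R) : continuous (fun x : R => expR (- (l * x))).
Proof.
move=> x; apply: (@cvg_comp _ _ _ (fun z : R => - (l * z)) expR).
  by apply: cvgN; apply: cvgM; [exact: cvg_cst|exact: cvg_id].
exact: continuous_expR.
Qed.

Lemma integral_expRN_tail (l a : R) : 0 < l ->
  (\int[leb]_(x in `[a, +oo[) (l * expR (- (l * x)))%:E = (expR (- (l * a)))%:E)%E.
Proof.
move=> l0; pose F x : R := - expR (- (l * x)).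
have dF (x : R) : is_derive x (1 : R) F (l * expR (- (l * x))).
  rewrite /F; apply: is_derive_eq.
  by rewrite /GRing.scale/=; ring.
rewrite (@ge0_continuous_FTC2y _ _ F a 0).
- by rewrite sub0e /F EFinN oppeK.
- by move=> x _; rewrite mulr_ge0 ?expR_ge0// ltW.
- apply: continuous_subspaceT => x.
  by apply: cvgM; [exact: cvg_cst|exact: continuous_expRNl].
- rewrite -[X in _ --> X]oppr0; apply: cvgN.
  apply: (@cvg_comp _ _ _ (fun x => l * x) (fun x => expR (- x)) _ +oo).
    exact: gt0_cvgMry.
  exact: cvgr_expR.
- by move=> x _; exact: (@ex_derive _ _ _ _ _ _ _ (dF x)).
- apply: cvg_at_right_filter; have := dF a => dFa.
  have : derivable F a 1 by exact: (@ex_derive _ _ _ _ _ _ _ dFa).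
  by move=> /derivable1_diffP/differentiable_continuous.
- by move=> x _; rewrite derive1E; exact: derive_val.
Qed.

End ExponentialKernel.

Lemma lebesgue_itv_co {R : realType} (a b : R) : a <= b ->
  lebesgue_measure `[a, b[%classic = (b - a)%:E.
Proof.
move=> ab; rewrite lebesgue_measure_itv/= lte_fin EFinB.
by case: ltgtP ab => // <- _; rewrite subee.
Qed.

Lemma lebesgue_itv_cc {R : realType} (a b : R) : a <= b ->
  lebesgue_measure `[a, b]%classic = (b - a)%:E.
Proof.
move=> ab; rewrite lebesgue_measure_itv/= lte_fin EFinB.
by case: ltgtP ab => // <- _; rewrite subee.
Qed.

Section LaplaceCdf.
Context {R : realType} {d : measure_display} {Y : measurableType d}.
Variable mu : probability Y R.
Local Notation leb := (@lebesgue_measure R).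
Variable X : Y -> R.
Hypothesis mX : measurable_fun [set: Y] X.
Hypothesis X0 : forall y, 0 <= X y.

Let measurable_exp_kernel (l : R) : measurable_fun [set: R] (fun x => l * expR (- (l * x))).
Proof.
apply: measurable_funM => //; apply: (measurableT_comp (@measurable_expR R)).
apply: (measurableT_comp (@oppr_measurable R setT)).
by apply: measurable_funM.
Qed.

(** A point [y] of [A] contributes the integral of [l * exp (- l x)] over [x >= X y], which is
    [exp (- l X y)]. This is a Laplace-Stieltjes transform in its integrated form, so that no
    Stieltjes measure appears. *)
Lemma laplace_cdf (A : set Y) (l : R) : measurable A -> 0 < l ->
  (\int[leb]_(x in `[0%R, +oo[) ((l * expR (- (l * x)))%:E * mu (A `&` [set y | (X y <= x)%R]))
   = (E mu (fun y => \1_A y * expR (- (l * X y)))%R)%:E)%E.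
Proof.
move=> mA l0.
pose S : set (measurableTypeR R * Y) := [set z | X z.2 <= z.1] `&` (setT `*` A).
have mS : measurable S.
  apply: measurableI; last exact: measurableX.
  apply: (@measurable_leset _ _ _ (fun z => X z.2) (fun z => z.1)).
    exact: (measurableT_comp mX measurable_snd).
  exact: measurable_fst.
have k0 x : 0 <= l * expR (- (l * x)) by rewrite mulr_ge0 ?expR_ge0// ltW.
have := layer_cake mu (measurable_exp_kernel l) k0 mS.
have xsS x : xsection S x = A `&` [set y | X y <= x].
  by apply/seteqP; split => y; rewrite /xsection /S/= inE/= => -[h1 h2]; split => //; case: h2.
under eq_integral do rewrite xsS.
move=> H; rewrite integral_mkcond; etransitivity.
  apply: etrans H; apply: eq_integral => x _; rewrite patchE; case: ifPn => // x0.
  rewrite (_ : A `&` _ = set0) ?measure0 ?mule0//.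
  apply/seteqP; split => // y [_ /= Xx]; move: x0; rewrite notin_setE/= in_itv/= andbT.
  by apply; apply: le_trans Xx.
rewrite -E_EFin; last first.
  apply: bmf_mul; first exact: bmf_indic.
  apply: bmf_expRN; last by move=> y; rewrite mulr_ge0// ltW.
  by apply: measurable_funM.
apply: eq_integral => y _; rewrite indicE.
have [yA|yA] := boolP (y \in A); last first.
  rewrite mul0r (_ : ysection S y = set0) ?integral_set0//.
  apply/seteqP; split => // x; rewrite /ysection /S/= inE/= => -[_ [_ yA']].
  by move: yA; rewrite notin_setE.
rewrite mul1r -integral_expRN_tail//; congr (integral _ _ _).
rewrite inE in yA; apply/seteqP; split => x; rewrite /ysection /S/= inE/= in_itv/= andbT.
  by case.
by move=> ?; split.
Qed.

Lemma laplace_tail (l : R) : 0 < l ->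
  (\int[leb]_(x in `[0%R, +oo[) ((l * expR (- (l * x)))%:E * mu [set y | (x < X y)%R])
   = (E mu (fun y => 1 - expR (- (l * X y)))%R)%:E)%E.
Proof.
move=> l0.
have H : (\int[leb]_(x in `[0%R, +oo[) ((l * expR (- (l * x)))%:E * mu [set y | (X y <= x)%R])
   = (E mu (fun y => \1_[set: Y] y * expR (- (l * X y)))%R)%:E)%E.
  by rewrite -(laplace_cdf measurableT l0); apply: eq_integral => x _; rewrite setTI.
have mle x : measurable [set y | X y <= x] by apply: measurable_leset => //.
have mlt x : measurable [set y | x < X y] by apply: measurable_ltset => //.
have k0 x : 0 <= l * expR (- (l * x)) by rewrite mulr_ge0 ?expR_ge0// ltW.
have bX : bmf (fun y => expR (- (l * X y))).
  apply: bmf_expRN; last by move=> y; rewrite mulr_ge0// ltW.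
  by apply: measurable_funM.
have mcdf : measurable_fun [set: R] (fun x => mu [set y | X y <= x]).
  have := @measurable_fun_xsection _ _ (measurableTypeR R) Y R mu.
  move=> /(_ [set z | X z.2 <= z.1]) /(_ _)/wrap[].
    apply: (@measurable_leset _ _ _ (fun z => X z.2) (fun z => z.1)).
      exact: (measurableT_comp mX measurable_snd).
    exact: measurable_fst.
  by apply: eq_measurable_fun => x _; congr (mu _); apply/seteqP; split => y;
    rewrite /xsection/= inE.
have mtail : measurable_fun [set: R] (fun x => mu [set y | x < X y]).
  have := @measurable_fun_xsection _ _ (measurableTypeR R) Y R mu.
  move=> /(_ [set z | z.1 < X z.2]) /(_ _)/wrap[].
    apply: (@measurable_ltset _ _ _ (fun z => z.1) (fun z => X z.2)).
      exact: measurable_fst.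
    exact: (measurableT_comp mX measurable_snd).
  by apply: eq_measurable_fun => x _; congr (mu _); apply/seteqP; split => y;
    rewrite /xsection/= inE.
have S1 : (\int[leb]_(x in `[0%R, +oo[) ((l * expR (- (l * x)))%:E * mu [set y | (X y <= x)%R]) +
  \int[leb]_(x in `[0%R, +oo[) ((l * expR (- (l * x)))%:E * mu [set y | (x < X y)%R]) = 1)%E.
  rewrite -ge0_integralD//.
  - transitivity (\int[leb]_(x in `[0%R, +oo[) (l * expR (- (l * x)))%:E)%E.
      apply: eq_integral => x _; rewrite -ge0_muleDr//.
      have -> : (mu [set y | (X y <= x)%R] + mu [set y | (x < X y)%R] = 1)%E.
        rewrite -measureU//; last first.
          by apply/seteqP; split => // y [/= h1 h2]; rewrite ltNge h1 in h2.
        rewrite (_ : _ `|` _ = setT); first exact: probability_setT.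
        by apply/seteqP; split => // y _; case: (leP (X y) x) => h; [left|right].
      by rewrite mule1.
    by rewrite integral_expRN_tail// mulr0 oppr0 expR0.
  - by move=> x _; rewrite mule_ge0// lee_fin.
  - apply: emeasurable_funM.
      by apply/measurable_EFinP; apply: measurable_funTS; exact: measurable_exp_kernel.
    exact: measurable_funTS.
  - by move=> x _; rewrite mule_ge0// lee_fin.
  - apply: emeasurable_funM; last exact: measurable_funTS.
    by apply/measurable_EFinP; apply: measurable_funTS; exact: measurable_exp_kernel.
move: S1; rewrite H => S1.
set Z := (\int[leb]_(x in _) _)%E in S1 *.
have -> : E mu (fun y => 1 - expR (- (l * X y))) = 1 - E mu (fun y => expR (- (l * X y))).
  by rewrite E_sub ?E_cst//; exact: bmf_cst.
rewrite EFinB -S1 (_ : E mu (fun y => \1_[set: Y] y * expR (- (l * X y))) =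
   E mu (fun y => expR (- (l * X y)))).
  by rewrite addeAC subee ?add0e.
by apply: E_ext => y; rewrite indicE in_setT mul1r.
Qed.

(** Identifies the integral that defines [m] for [beta = 1] as a truncated mean; the lower limit [1]
    of the integral removes exactly [1] since [X >= 1] almost everywhere. *)
Lemma integral_tail_cut (t : R) : 1 <= t ->
  {ae mu, forall y, 1 <= X y} ->
  (\int[leb]_(x in `[1%R, t]) mu [set y | (x < X y)%R] =
   (E mu (fun y => Num.min (X y) t) - 1)%R%:E)%E.
Proof.
move=> t1 X1.
pose S : set (measurableTypeR R * Y) := [set z | z.1 < X z.2] `&` (`[1, t] `*` setT).
have mS : measurable S.
  apply: measurableI; last by apply: measurableX => //; exact: measurable_itv.
  apply: (@measurable_ltset _ _ _ (fun z => z.1) (fun z => X z.2)).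
    exact: measurable_fst.
  exact: (measurableT_comp mX measurable_snd).
have bm : bmf (fun y => Num.min (X y) t).
  split; first exact: measurable_minr.
  exists t => y; have t0 : 0 <= t by exact: le_trans t1.
  by rewrite ger0_norm ?le_min ?X0//= ge_min lexx orbT.
have := layer_cake mu (k := fun=> 1) (measurable_cst _) (fun=> ler01) mS.
have xsS x : (x \in `[1, t]) -> xsection S x = [set y | x < X y].
  move=> xt; apply/seteqP; split => y; rewrite /xsection /S/= inE/=; first by case.
  by move=> ?; split.
move=> H; rewrite integral_mkcond; etransitivity.
  apply: etrans H; apply: eq_integral => x _; rewrite patchE mem_setE mul1e.
  case: ifPn => xt; first by rewrite xsS.
  rewrite (_ : xsection S x = set0) ?measure0//.
  apply/seteqP; split => // y; rewrite /xsection /S/= inE/= => -[_ [h _]].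
  by rewrite h in xt.
have -> : E mu (fun y => Num.min (X y) t) - 1 = E mu (fun y => Num.min (X y) t - 1).
  by rewrite E_sub ?E_cst//; exact: bmf_cst.
rewrite -E_EFin; last by apply: bmf_sub => //; exact: bmf_cst.
have yE y : 1 <= X y -> (\int[leb]_(x in ysection S y) 1%:E = (Num.min (X y) t - 1)%:E)%E.
  move=> X1y; rewrite integral_cst ?mul1e; last exact: measurable_ysection.
  have [Xt|Xt] := leP (X y) t.
    rewrite (_ : ysection S y = `[1, X y[%classic).
      exact: lebesgue_itv_co.
    apply/seteqP; split => x; rewrite /ysection /S/= inE/= !in_itv/=.
      by move=> [-> [/andP[-> _] _]].
    by move=> /andP[h1 h2]; split => //; split => //; rewrite h1/= (le_trans _ Xt)// ltW.
  rewrite (_ : ysection S y = `[1, t]%classic).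
    exact: lebesgue_itv_cc.
  apply/seteqP; split => x; rewrite /ysection /S/= inE/= !in_itv/=.
    by move=> [_ [h _]].
  by move=> /andP[h1 h2]; split; [exact: le_lt_trans Xt|split => //; rewrite h1].
apply: ae_eq_integral => //.
- have := @measurable_fun_ysection _ _ (measurableTypeR R) Y R leb S mS.
  apply: eq_measurable_fun => y _; rewrite integral_cst ?mul1e//.
  exact: measurable_ysection.
- apply/measurable_EFinP; apply: measurable_funB => //; exact: (proj1 bm).
- by apply: filterS X1 => y X1y _; exact: yE.
Qed.

End LaplaceCdf.
(** * Gamma integrals *)

Section GammaIntegrals.
Context {R : realType}.
Local Notation leb := (@lebesgue_measure R).

Lemma continuous_expRN : continuous (fun x : R => expR (- x)).
Proof.
move=> x; apply: (@cvg_comp _ _ _ (fun z : R => - z) expR).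
  by apply: cvgN; exact: cvg_id.
exact: continuous_expR.
Qed.

Lemma measurable_powR_expRN (a : R) (D : set R) :
  measurable_fun D (fun x : R => x `^ a * expR (- x)).
Proof.
apply: measurable_funTS; apply: measurable_funM; first exact: measurable_powR.
exact: measurable_expRN.
Qed.

Lemma powR_expRN_ge0 (a x : R) : 0 <= x `^ a * expR (- x).
Proof. by rewrite mulr_ge0 ?powR_ge0 ?expR_ge0. Qed.

Lemma add1_le_expR_half (x : R) : x + 1 <= 2 * expR (x / 2).
Proof. by have := @expR_ge1Dx R (x / 2); lra. Qed.

Lemma integrable_powR_expRN (a : R) : 0 <= a <= 1 ->
  leb.-integrable `[0%R, +oo[ (EFin \o (fun x => x `^ a * expR (- x))).
Proof.
move=> /andP[a0 a1].
(* The majorant is [2 * exp (- x / 2)], from [x ^ a <= x + 1 <= 2 * exp (x / 2)], written as [4]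
   times an exponential density whose integral is known. *)
have i1 : leb.-integrable `[0%R, +oo[ (fun x => (4 * (2^-1 * expR (- (2^-1 * x))))%:E).
  apply/integrableP; split.
    apply/measurable_EFinP; apply: measurable_funTS; apply: continuous_measurable_fun => x.
    apply: cvgM; first exact: cvg_cst.
    by apply: cvgM; [exact: cvg_cst|exact: continuous_expRNl].
  under eq_integral do rewrite gee0_abs ?lee_fin ?mulr_ge0 ?expR_ge0//.
  under eq_integral do rewrite EFinM.
  rewrite ge0_integralZl//; last first.
    apply/measurable_EFinP; apply: measurable_funTS; apply: continuous_measurable_fun => x.
    by apply: cvgM; [exact: cvg_cst|exact: continuous_expRNl].
  by rewrite integral_expRN_tail// -EFinM ltry.
apply: le_integrable i1 => //.
  by apply/measurable_EFinP; exact: measurable_powR_expRN.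
move=> x; rewrite /= in_itv/= andbT => x0.
rewrite lee_fin !ger0_norm ?powR_expRN_ge0 ?mulr_ge0 ?expR_ge0//.
have -> : expR (- x) = expR (- (2^-1 * x)) * expR (- (2^-1 * x)).
  by rewrite -expRD; congr expR; field.
rewrite !mulrA ler_wpM2r ?expR_ge0//.
rewrite expRN ler_pdivrMr ?expR_gt0//.
have -> : 4 * 2^-1 = 2 :> R by field.
rewrite (mulrC 2^-1); apply: le_trans (add1_le_expR_half x).
have [x1|x1] := leP 1 x.
  by rewrite (le_trans (ler1_powR x1 a1))// lerDl.
have [->|xn0] := eqVneq x 0.
  by rewrite add0r /powR eqxx; case: eqP.
have xp : 0 < x by rewrite lt_def xn0.
have : x `^ a <= x `^ 0 by rewrite ger_powR// xp ltW.
by rewrite powRr0 => /le_trans; apply; rewrite lerDr.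
Qed.

Lemma integrable_itv_open (f : R -> \bar R) :
  leb.-integrable `[0%R, +oo[ f -> leb.-integrable `]0%R, +oo[ f.
Proof.
move=> h; apply: (@integrableS _ _ _ leb `[0%R, +oo[%classic) => //.
by move=> x; rewrite /= !in_itv/= !andbT; exact: ltW.
Qed.

(** The integrand may be unbounded at [0], so []0, 1]] is exhausted by the intervals
    [[1 / n.+2, 1]], nondegenerate for every [n], on which the antiderivative bounds the integral by
    [1 / (a + 1)]. *)
Lemma integral_powR_01 (a : R) : -1 < a ->
  (\int[leb]_(x in `]0%R, 1%R]) (x `^ a)%:E < +oo)%E.
Proof.
move=> a1; have a10 : 0 < a + 1 by rewrite -ltrBlDr sub0r.
pose F n := `[(n.+2%:R : R)^-1, 1]%classic.
have FU : \bigcup_n F n = `]0, 1]%classic.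
  apply/seteqP; split => x; rewrite /F/= in_itv/=.
    move=> [n _] /=; rewrite in_itv/= => /andP[h ->]; rewrite andbT.
    by rewrite (lt_le_trans _ h).
  move=> /andP[x0 x1]; exists (Num.truncn x^-1) => //=; rewrite in_itv/= x1 andbT.
  rewrite -[leRHS]invrK lef_pV2 ?posrE ?invr_gt0//.
  apply: (@le_trans _ _ (Num.truncn x^-1).+1%:R); first exact/ltW/truncnS_gt.
  by rewrite ler_nat.
have mf n : measurable_fun (F n) (fun x : R => (x `^ a)%:E).
  by apply/measurable_EFinP; apply: measurable_funTS; exact: measurable_powR.
apply: (@le_lt_trans _ _ ((a + 1)^-1)%:E); last exact: ltry.
have cv : (\int[leb]_(x in F n) (x `^ a)%:E)%E @[n --> \oo] -->
    (\int[leb]_(x in `]0%R, 1%R]) (x `^ a)%:E)%E.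
  rewrite -FU; apply: ge0_nondecreasing_set_cvg_integral.
  - move=> n m nm; apply/subsetPset => x; rewrite /F/= !in_itv/= => /andP[h ->].
    rewrite andbT (le_trans _ h)// lef_pV2 ?posrE// ler_nat.
    by rewrite !ltnS.
  - by move=> n; exact: measurable_itv.
  - exact: mf.
  - by move=> n x _; rewrite lee_fin powR_ge0.
rewrite -(cvg_lim _ cv)//; apply: lime_le; first by apply/cvg_ex; eexists; exact: cv.
apply: nearW => n.
pose c := (n.+2%:R : R)^-1; pose G (x : R) := (a + 1)^-1 * x `^ (a + 1).
have c0 : 0 < c by rewrite invr_gt0.
have c1 : c < 1 by rewrite invf_lt1// ltr1n.
have dG (x : R) : 0 < x -> is_derive x (1 : R) G (x `^ a).
  move=> x0; rewrite /G.
  have := is_derive1_powR (a + 1) x0 => D1.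
  apply: is_derive_eq; rewrite /GRing.scale/= addrK; field.
  by rewrite gt_eqF.
have dcont (x : R) : 0 < x -> {for x, continuous G}.
  move=> x0; have D1 := dG x x0.
  have : derivable G x 1 by exact: (@ex_derive _ _ _ _ _ _ _ D1).
  by move=> /derivable1_diffP/differentiable_continuous.
rewrite /F (@continuous_FTC2 _ _ G)//.
- rewrite /G powR1 mulr1 -EFinB lee_fin gerBl mulr_ge0 ?powR_ge0// invr_ge0 ltW//.
- apply: derivable_within_continuous => x; rewrite in_itv/= => /andP[cx _].
  have x0 : 0 < x by exact: lt_le_trans cx.
  have D1 := is_derive1_powR a x0.
  exact: (@ex_derive _ _ _ _ _ _ _ D1).
- split.
  + move=> x; rewrite in_itv/= => /andP[cx _].
    exact: (@ex_derive _ _ _ _ _ _ _ (dG x (lt_trans c0 cx))).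
  + by apply: cvg_at_right_filter; exact: dcont.
  + by apply: cvg_at_left_filter; exact: dcont.
- move=> x; rewrite in_itv/= => /andP[cx _]; rewrite derive1E.
  have D1 := dG x (lt_trans c0 cx); exact: derive_val.
Qed.

Lemma integrable_powR_expRN_neg (a : R) : -1 < a <= 0 ->
  leb.-integrable `]0%R, +oo[ (EFin \o (fun x => x `^ a * expR (- x))).
Proof.
move=> /andP[a1 a0].
apply/integrableP; split; first by apply/measurable_EFinP; exact: measurable_powR_expRN.
under eq_integral do rewrite /= ger0_norm ?powR_expRN_ge0//.
have -> : `]0%R, +oo[%classic = `]0%R, 1%R] `|` `]1%R, +oo[ :> set R.
  apply/seteqP; split => x /=; rewrite !in_itv/= !andbT.
    by move=> ->/=; case: (leP x 1); [left|right].
  by case=> [/andP[]//|]; exact: lt_trans.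
rewrite ge0_integral_setU//=; last 3 first.
- by apply/measurable_EFinP; exact: measurable_powR_expRN.
- by move=> x _; rewrite lee_fin powR_expRN_ge0.
- rewrite disj_set2E; apply/eqP/seteqP; split => // x [] /=; rewrite !in_itv/= andbT.
  by move=> /andP[_ h1] h2; rewrite ltNge h1 in h2.
apply: lte_add_pinfty.
  apply: le_lt_trans (integral_powR_01 a1); apply: ge0_le_integral => //.
  - by move=> x _; rewrite lee_fin powR_expRN_ge0.
  - by apply/measurable_EFinP; exact: measurable_powR_expRN.
  - by apply/measurable_EFinP; apply: measurable_funTS; exact: measurable_powR.
  - move=> x; rewrite /= in_itv/= => /andP[x0 _]; rewrite lee_fin ler_piMr ?powR_ge0//.
    by rewrite expR_le1 oppr_le0 ltW.
have i1 := integrable_powR_expRN (a := 0) ltac:(by rewrite lexx ler01).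
apply: (@le_lt_trans _ _ (\int[leb]_(x in `[0%R, +oo[) (x `^ 0 * expR (- x))%:E)%E); last first.
  by rewrite ltey_eq (integrable_fin_num _ i1).
apply: (@le_trans _ _ (\int[leb]_(x in `]1%R, +oo[) (x `^ 0 * expR (- x))%:E)%E).
  apply: ge0_le_integral => //.
  - by move=> x _; rewrite lee_fin powR_expRN_ge0.
  - by apply/measurable_EFinP; exact: measurable_powR_expRN.
  - by apply/measurable_EFinP; exact: measurable_powR_expRN.
  - move=> x; rewrite /= in_itv/= andbT => x1; rewrite lee_fin ler_wpM2r ?expR_ge0//.
    by apply: ler_powR => //; exact: ltW.
apply: ge0_subset_integral => //.
- by apply/measurable_EFinP; exact: measurable_powR_expRN.
- by move=> x _; rewrite lee_fin powR_expRN_ge0.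
- move=> x; rewrite /= !in_itv/= !andbT => h; apply: ltW; exact: lt_trans h.
Qed.

Lemma GammaE (a : R) : Gamma (a + 1) = \int[leb]_(x in `]0%R, +oo[) (x `^ a * expR (- x)).
Proof. by rewrite /Gamma addrK. Qed.

Lemma Gamma_gt0 (a : R) :
  leb.-integrable `]0%R, +oo[ (EFin \o (fun x => x `^ a * expR (- x))) ->
  0 < Gamma (a + 1).
Proof.
move=> ia; rewrite GammaE.
(* A lower bound of [x ^ a] on [[1, 2]] valid for either sign of [a]. *)
have m1 : 0 < Num.min ((1 : R) `^ a) (2 `^ a) by rewrite lt_min !powR_gt0.
set m := Num.min _ _ in m1.
have H : (\int[leb]_(x in `[1%R, 2%R]) (m * expR (- 2))%:E <=
    \int[leb]_(x in `]0%R, +oo[) (x `^ a * expR (- x))%:E)%E.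
  apply: (@le_trans _ _ (\int[leb]_(x in `[1%R, 2%R]) (x `^ a * expR (- x))%:E)%E).
    apply: ge0_le_integral => //.
    - by move=> x _; rewrite lee_fin mulr_ge0 ?expR_ge0// ltW.
    - by apply/measurable_EFinP; exact: measurable_powR_expRN.
    - move=> x; rewrite /= in_itv/= => /andP[h1 h2]; rewrite lee_fin.
      have x0 : 0 < x by exact: lt_le_trans h1.
      apply: ler_pM; rewrite ?expR_ge0 ?(ltW m1)//; last by rewrite ler_expR lerN2.
      rewrite /m ge_min; apply/orP; have [a0|a0] := leP 0 a.
        by left; apply: ge0_ler_powR => //; rewrite nnegrE ltW.
      right; rewrite -(opprK a) (powRN 2) (powRN x) lef_pV2 ?posrE ?powR_gt0//.
      by apply: ge0_ler_powR => //; rewrite ?nnegrE ?oppr_ge0 ltW.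
  apply: ge0_subset_integral => //.
  - by apply/measurable_EFinP; exact: measurable_powR_expRN.
  - by move=> x _; rewrite lee_fin powR_expRN_ge0.
  - by move=> x; rewrite /= !in_itv/= andbT => /andP[h _]; exact: lt_le_trans h.
have Jf : (\int[leb]_(x in `]0%R, +oo[) (x `^ a * expR (- x))%:E)%E \is a fin_num.
  exact: (integrable_fin_num _ ia).
rewrite -lte_fin /Rintegral fineK//; apply: lt_le_trans H.
rewrite integral_cst// [X in (_ * X)%E](_ : _ = (2 - 1)%:E); last first.
  by apply: lebesgue_itv_cc; rewrite ler1n.
by rewrite -EFinM lte_fin !mulr_gt0 ?expR_gt0// subr_gt0 ltr1n.
Qed.

Lemma Gamma2 : Gamma (1 + 1 : R) = 1.
Proof.
rewrite GammaE Rintegral_itv_obnd_cbnd; last first.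
  apply/integrable_itv_open/integrable_powR_expRN.
  by rewrite lexx ler01.
pose F (x : R) := - ((x + 1) * expR (- x)).
have dF (x : R) : is_derive x (1 : R) F (x * expR (- x)).
  rewrite /F; apply: is_derive_eq.
  by rewrite /GRing.scale/=; ring.
transitivity (\int[leb]_(x in `[0%R, +oo[) (x * expR (- x))).
  by apply: eq_Rintegral => x; rewrite inE/= in_itv/= andbT => x0; rewrite powRr1.
rewrite (@Rintegral_ge0_continuous_FTC2y _ _ F 0 0).
- by rewrite sub0r /F opprK add0r mul1r oppr0 expR0.
- by move=> x x0; rewrite mulr_ge0 ?expR_ge0.
- apply: continuous_subspaceT => x; apply: cvgM; first exact: cvg_id.
  exact: continuous_expRN.
- rewrite -[X in _ --> X]oppr0; apply: cvgN.
  apply: (@squeeze_cvgr _ _ _ _ (fun=> 0) (fun x => 2 * expR (- (x / 2)))).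
  + near=> x; have x0 : 0 <= x by near: x; exact: nbhs_pinfty_ge.
    rewrite mulr_ge0 ?addr_ge0 ?expR_ge0//=.
    have -> : expR (- x) = expR (- (x / 2)) * expR (- (x / 2)).
      by rewrite -expRD; congr expR; field.
    rewrite mulrA ler_wpM2r ?expR_ge0// expRN ler_pdivrMr ?expR_gt0//.
    exact: add1_le_expR_half.
  + exact: cvg_cst.
  + rewrite -[X in _ --> X](mulr0 2); apply: cvgM; first exact: cvg_cst.
    apply: (@cvg_comp _ _ _ (fun x => x / 2) (fun x => expR (- x)) _ +oo).
      exact: gt0_cvgMly.
    exact: cvgr_expR.
- by move=> x _; exact: (@ex_derive _ _ _ _ _ _ _ (dF x)).
- apply: cvg_at_right_filter; have dFa := dF 0.
  have : derivable F 0 1 by exact: (@ex_derive _ _ _ _ _ _ _ dFa).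
  by move=> /derivable1_diffP/differentiable_continuous.
- by move=> x _; rewrite derive1E; have D1 := dF x; exact: derive_val.
Unshelve. all: by end_near. Qed.

(** The substitution [x -> k * x]. At integer [k] it computes the moments of the limit function in
    the Tauberian argument. *)
Lemma integral_powR_scale (a k : R) : 0 < a <= 1 -> 0 < k ->
  \int[leb]_(x in `[0%R, +oo[) (x `^ a * expR (- (k * x))) =
  Gamma (a + 1) * k `^ (- (a + 1)).
Proof.
move=> /andP[a0 a1] k0.
have ia := integrable_powR_expRN (a := a) ltac:(by rewrite a1 ltW).
pose G (x : R) := x `^ a * expR (- x).
pose F (x : R) := k * x.
have dF (x : R) : is_derive x (1 : R) F k.
  by rewrite /F; apply: is_derive_eq; rewrite /GRing.scale/=; ring.
have F'E : F^`()%classic = fun=> k.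
  by apply/funext => x; rewrite derive1E; have D1 := dF x; exact: derive_val.
have cF : continuous F.
  by move=> x; apply: cvgM; [exact: cvg_cst|exact: cvg_id].
have H := @increasing_ge0_integration_by_substitutiony R F G 0.
have {}H : (\int[leb]_(x in `[F 0%R, +oo[) (G x)%:E =
    \int[leb]_(x in `[0%R, +oo[) (((G \o F) * F^`()%classic) x)%:E)%E.
  apply: H.
  - by move=> x y _ _ xy; rewrite /F ltr_pM2l.
  - by rewrite F'E => x _; exact: cvg_cst.
  - by rewrite F'E; exact: is_cvg_cst.
  - by rewrite F'E; exact: is_cvg_cst.
  - split.
    + by move=> x _; exact: (@ex_derive _ _ _ _ _ _ _ (dF x)).
    + by apply: cvg_at_right_filter; exact: cF.
  - exact: gt0_cvgMry.
  - rewrite /F mulr0; apply/continuous_within_itvcyP; split.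
      move=> x; rewrite in_itv/= andbT => x0; apply: cvgM.
        have D1 := is_derive1_powR a x0.
        have : derivable ((powR (R:=R))^~ a) x 1 by exact: (@ex_derive _ _ _ _ _ _ _ D1).
        by move=> /derivable1_diffP/differentiable_continuous.
      exact: continuous_expRN.
    apply: cvgM.
      rewrite powR0 ?gt_eqF//.
      apply: (@squeeze_cvgr _ _ _ _ (fun=> 0) (fun x : R => x `^ a)).
      + by near=> x; rewrite powR_ge0 lexx.
      + exact: cvg_cst.
      + apply/cvgrPdist_le => e e0; have [s0 s00 Hs] := powR_small a0 e0.
        near=> x; rewrite sub0r normrN ger0_norm ?powR_ge0// Hs//.
        by apply/andP; split; near: x; [exact: nbhs_right_gt|exact: nbhs_right_lt].
    by apply: cvg_at_right_filter; exact: continuous_expRN.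
  - by rewrite /F mulr0 => x _; exact: powR_expRN_ge0.
rewrite GammaE Rintegral_itv_obnd_cbnd; last exact: integrable_itv_open ia.
have F0 : F 0 = 0 by rewrite /F mulr0.
move: H; rewrite F0 F'E => H.
have kp : 0 < k `^ (a + 1) by exact: powR_gt0.
have GE x : 0 <= x -> (((G \o F) * (fun=> k)) x)%:E =
    ((k `^ (a + 1))%:E * (x `^ a * expR (- (k * x)))%:E)%E.
  move=> x0; rewrite -EFinM; congr EFin; rewrite /G /F.
  transitivity ((k * x) `^ a * expR (- (k * x)) * k) => //.
  rewrite powRM ?(ltW k0)// powRD; last by rewrite (gt_eqF k0) implybT.
  by rewrite powRr1 ?(ltW k0)//; ring.
have mI : measurable_fun (`[0%R, +oo[%classic : set R)
    (fun x : R => (x `^ a * expR (- (k * x)))%:E).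
  apply/measurable_EFinP; apply: measurable_funTS; apply: measurable_funM.
    exact: measurable_powR.
  by apply: continuous_measurable_fun; exact: continuous_expRNl.
have {}H : (\int[leb]_(x in `[0%R, +oo[) (G x)%:E =
    (k `^ (a + 1))%:E * \int[leb]_(x in `[0%R, +oo[) (x `^ a * expR (- (k * x)))%:E)%E.
  rewrite H -ge0_integralZl//; last 2 first.
  - by move=> x _; rewrite lee_fin mulr_ge0 ?powR_ge0 ?expR_ge0.
  - by rewrite lee_fin ltW.
  by apply: eq_integral => x; rewrite inE/= in_itv/= andbT => x0; rewrite GE.
have fG : (\int[leb]_(x in `[0%R, +oo[) (G x)%:E)%E \is a fin_num.
  exact: (integrable_fin_num _ ia).
have ZE : (\int[leb]_(x in `[0%R, +oo[) (x `^ a * expR (- (k * x)))%:E =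
    (k `^ (- (a + 1)))%:E * \int[leb]_(x in `[0%R, +oo[) (G x)%:E)%E.
  by rewrite H muleA -EFinM powRN mulVf ?gt_eqF// mul1e.
by rewrite {1}/Rintegral ZE fineM// mulrC.
Unshelve. all: by end_near. Qed.

End GammaIntegrals.
(** * Asymptotics of the Laplace transform of the tail *)

Section TailTransform.
Context {R : realType} {d : measure_display} {Y : measurableType d}.
Variable mu : probability Y R.
Local Notation leb := (@lebesgue_measure R).
Local Notation E := (E mu).
Variable tau : Y -> R.
Hypothesis mtau : measurable_fun [set: Y] tau.
Hypothesis tau0 : forall y, 0 <= tau y.

Definition tailf (t : R) : R := fine (mu [set y | t < tau y]).

Lemma measurable_tailset t : measurable [set y | t < tau y].
Proof. by apply: measurable_ltset => //; exact: measurable_cst. Qed.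

Lemma tailfE t : mu [set y | t < tau y] = (tailf t)%:E.
Proof.
rewrite /tailf fineK// ge0_fin_numE//.
by apply: le_lt_trans (probability_le1 mu (measurable_tailset t)) _; rewrite ltry.
Qed.

Lemma tailf01 t : 0 <= tailf t <= 1.
Proof.
rewrite -!lee_fin -tailfE measure_ge0/=.
exact: probability_le1 (measurable_tailset t).
Qed.

Lemma tailf_mono s t : s <= t -> tailf t <= tailf s.
Proof.
move=> st; rewrite -lee_fin -!tailfE; apply: le_measure; rewrite ?inE;
  do ?exact: measurable_tailset.
by move=> y /=; exact: le_lt_trans.
Qed.

Lemma measurable_tailf : measurable_fun [set: R] tailf.
Proof.
have H : measurable_fun [set: R] (fun x => - tailf x).
  apply: nondecreasing_measurable => // x y xy.
  by rewrite lerN2 tailf_mono.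
have := measurableT_comp (@oppr_measurable R setT) H.
by apply: eq_measurable_fun => x _ /=; rewrite opprK.
Qed.

(** This is [laplace_tail] at [l = 1] for the variable [tau / u]; in this form regular variation of
    the tail acts directly under the integral. *)
Lemma Phi_tailf (u : R) : 0 < u ->
  (\int[leb]_(x in `]0%R, +oo[) (expR (- x) * tailf (u * x))%:E)%E = (Phi mu tau u^-1)%:E.
Proof.
move=> u0; have ui0 : 0 < u^-1 by rewrite invr_gt0.
pose X y := u^-1 * tau y.
have mX : measurable_fun [set: Y] X by apply: measurable_funM.
have X0 y : 0 <= X y by rewrite mulr_ge0// ltW.
have := laplace_tail mu mX X0 ltr01.
rewrite integral_itv_obnd_cbnd; last first.
  apply/measurable_EFinP; apply: measurable_funTS; apply: measurable_funM.
    exact: measurable_expRN.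
  by apply: (measurableT_comp measurable_tailf); apply: measurable_funM.
rewrite (_ : E (fun y => 1 - expR (- (1 * X y))) = Phi mu tau u^-1); last first.
  by apply: E_ext => y; rewrite mul1r.
move=> <-; apply: eq_integral => x _; rewrite !mul1r EFinM -tailfE.
have e y : (x < X y) = (u * x < tau y) by rewrite /X ltr_pdivlMl.
by congr (_ * mu _)%E; apply/seteqP; split => y; rewrite /= e.
Qed.

Variable beta : R.
Hypothesis beta0 : 0 <= beta.
Hypothesis TRV : forall l : R, 0 < l ->
  tailf (l * t) / tailf t @[t --> +oo] --> l `^ (- beta).

Let T_gt0 := tail_gt0 tailf01 tailf_mono TRV.

Local Notation D := (`]0%R, +oo[%classic : set R).

(* Potter's bound dominates the integrand near [0]. *)
Lemma Phi_tailf_ratio : beta < 1 ->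
  Phi mu tau t^-1 / tailf t @[t --> +oo] --> Gamma (1 - beta).
Proof.
(* Potter's bound asks for [b > beta], and integrability of [x ^ (- b)] at [0] for [b < 1]. *)
move=> beta1; pose b := (beta + 1) / 2.
have bb : beta < b by rewrite /b; lra.
have b1 : b < 1 by rewrite /b; lra.
have b0 : 0 < b by exact: le_lt_trans bb.
have [t1 [C [t10 C0 pot]]] := potter beta0 tailf01 tailf_mono TRV bb.
have L (w : nat -> R) : (forall n, t1 <= w n) -> w n @[n --> \oo] --> +oo ->
    Phi mu tau (w n)^-1 / tailf (w n) @[n --> \oo] --> Gamma (1 - beta).
  move=> wt winf.
  have w0 n : 0 < w n by exact: lt_le_trans (wt n).
  pose f_ n (x : R) : \bar R := (expR (- x) * (tailf (w n * x) / tailf (w n)))%:E.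
  pose f (x : R) : \bar R := (x `^ (- beta) * expR (- x))%:E.
  (* The first summand dominates on []0, 1]] by Potter's bound, the second beyond [1], where the
     tail ratio is at most [1] by monotonicity. *)
  pose g (x : R) : \bar R := (C * (x `^ (- b) * expR (- x)) + x `^ 0 * expR (- x))%:E.
  have mf_ n : measurable_fun D (f_ n).
    apply/measurable_EFinP; apply: measurable_funTS; apply: measurable_funM.
      exact: measurable_expRN.
    apply: measurable_funM => //; apply: (measurableT_comp measurable_tailf).
    by apply: measurable_funM.
  have mf : measurable_fun D f.
    by apply/measurable_EFinP; exact: measurable_powR_expRN.
  have ig : leb.-integrable D g.
    have i1 := integrable_powR_expRN_neg (R := R) (a := - b) ltac:(by rewrite ltrN2 b1 oppr_le0 ltW).
    have i2 := integrable_powR_expRN_neg (R := R) (a := 0) ltac:(by rewrite lexx oppr_lt0 ltr01).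
    have i3 : leb.-integrable D (fun x => C%:E * (x `^ (- b) * expR (- x))%:E)%E.
      exact: integrableZl.
    exact: (integrableD _ i3 i2).
  have cf x : D x -> f_ ^~ x @ \oo --> f x.
    rewrite /= in_itv/= andbT => x0; apply: cvg_EFin; first exact: nearW.
    rewrite /f_ /=; rewrite mulrC; apply: cvgM; first exact: cvg_cst.
    move: (TRV x0) => /cvg_pinftyP /(_ w winf).
    by apply: cvg_trans; apply: near_eq_cvg; apply: nearW => n; rewrite [w n * x]mulrC.
  have dom x n : D x -> (`|f_ n x| <= g x)%E.
    rewrite /= in_itv/= andbT => x0; rewrite lee_fin ger0_norm; last first.
      by rewrite mulr_ge0 ?expR_ge0// divr_ge0 ?(ltW (T_gt0 _)).
    rewrite powRr0 [in leRHS]mulrA -mulrDl [leRHS]mulrC ler_wpM2l ?expR_ge0//.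
    rewrite ler_pdivrMr ?T_gt0//.
    have [x1|x1] := leP x 1.
      apply: (@le_trans _ _ (C * x `^ (- b) * tailf (w n))).
        have := pot (w n) (w n * x) (wt n) ltac:(by rewrite mulr_gt0//= ler_piMr// ltW).
        have -> : w n / (w n * x) = x^-1 by field; rewrite !gt_eqF.
        by rewrite -[x^-1]powR_inv1 ?(ltW x0)// -powRrM mulN1r.
      by rewrite ler_wpM2r ?(ltW (T_gt0 _))// lerDl.
    apply: (@le_trans _ _ (1 * tailf (w n))).
      by rewrite mul1r tailf_mono// ler_peMr ?ltW.
    by rewrite ler_wpM2r ?(ltW (T_gt0 _))// lerDr mulr_ge0 ?powR_ge0// ltW.
  have mD : measurable D by exact: measurable_itv.
  have [] := @dominated_convergence _ _ R leb D mD f_ f g mf_ mf.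
  - by apply: aeW => x; exact: cf.
  - exact: ig.
  - by apply: aeW => x Dx n; exact: dom.
  move=> ifi _; rewrite (_ : [sequence _]_n = fun n => (Phi mu tau (w n)^-1 / tailf (w n))%:E).
    move=> H; have {H} : (Phi mu tau (w n)^-1 / tailf (w n))%:E @[n --> \oo] --> (Gamma (1 - beta))%:E.
      move: H; rewrite (_ : (\int[leb]_(x in D) f x)%E = (Gamma (1 - beta))%:E)//.
      rewrite addrC GammaE /Rintegral fineK//.
      exact: (integrable_fin_num _ ifi).
    by move/fine_cvg.
  apply/funext => n; rewrite /= mulrC EFinM -Phi_tailf// -ge0_integralZl//; last 3 first.
  - apply/measurable_EFinP; apply: measurable_funTS; apply: measurable_funM.
      exact: measurable_expRN.
    by apply: (measurableT_comp measurable_tailf); apply: measurable_funM.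
  - by move=> x _; rewrite lee_fin mulr_ge0 ?expR_ge0//; case/andP: (tailf01 (w n * x)).
  - by rewrite lee_fin invr_ge0; case/andP: (tailf01 (w n)).
  by apply: eq_integral => x _; rewrite /f_ -EFinM; congr EFin; ring.
(* Raising the sequence to [t1] changes finitely many terms and makes Potter's bound available at
   every index. *)
apply/cvg_pinftyP => u uinf; pose w n := Num.max t1 (u n).
have wu : \forall n \near \oo, w n = u n.
  near=> n; rewrite /w; apply/max_idPr; near: n.
  exact: (cvgry_ge uinf).
have winf : w n @[n --> \oo] --> +oo.
  apply: cvg_trans uinf; apply: near_eq_cvg.
  by near=> n; apply/esym; near: n.
have wt n : t1 <= w n by rewrite le_max lexx.
have := L w wt winf; apply: cvg_trans; apply: near_eq_cvg.
by near=> n; congr (Phi _ _ _^-1 / tailf _); near: n.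
Unshelve. all: by end_near. Qed.

End TailTransform.

(** * The truncated mean, for tails of index one *)

Section TruncatedMean.
Context {R : realType} {d : measure_display} {Y : measurableType d}.
Variable mu : probability Y R.
Local Notation E := (E mu).
Variable tau : Y -> R.
Hypothesis mtau : measurable_fun [set: Y] tau.
Hypothesis tau0 : forall y, 0 <= tau y.
Local Notation T := (tailf mu tau).

(** The integral of the tail over [[0, t]], kept as an expectation so that its increments can be
    compared pointwise. *)
Definition trunc_mean (t : R) : R := E (fun y => Num.min (tau y) t).
Local Notation M := trunc_mean.

Lemma bmf_min t : 0 <= t -> bmf (fun y => Num.min (tau y) t).
Proof.
move=> t0; split; first exact: measurable_minr.
by exists t => y; rewrite ger0_norm ?le_min ?tau0//= ge_min lexx orbT.
Qed.

Lemma E_tail t : E (fun y => \1_[set y | t < tau y] y) = T t.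
Proof. by rewrite E_indic//; exact: measurable_tailset. Qed.

Let bmf_tail t : bmf (fun y => \1_[set y | t < tau y] y : R).
Proof. by apply: bmf_indic; exact: measurable_tailset. Qed.

Let indic_tail (t : R) (y : Y) :
  \1_[set y | t < tau y] y = (nat_of_bool (t < tau y)%R)%:R :> R.
Proof.
rewrite indicE; congr (_%:R); congr nat_of_bool.
by apply/idP/idP => [|h]; rewrite inE.
Qed.

Lemma trunc_mean_incr s t : 0 <= s <= t ->
  (t - s) * T t <= M t - M s <= (t - s) * T s.
Proof.
move=> /andP[s0 st]; have t0 := le_trans s0 st.
rewrite -E_sub; do ?exact: bmf_min.
have bm : bmf (fun y => Num.min (tau y) t - Num.min (tau y) s).
  by apply: bmf_sub; exact: bmf_min.
rewrite -!E_tail -!E_scale//.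
have bt c u : bmf (fun y => c * \1_[set y | u < tau y] y : R).
  by apply: bmf_mul => //; exact: bmf_cst.
apply/andP; split; apply: E_le => // y; rewrite indic_tail.
  case: (ltP t (tau y)) => h; case: (leP (tau y) t) => h1; case: (leP (tau y) s) => h2 /=; lra.
case: (ltP s (tau y)) => h; case: (leP (tau y) t) => h1; case: (leP (tau y) s) => h2 /=; lra.
Qed.

Lemma trunc_mean_unbounded : ~ mu.-integrable [set: Y] (EFin \o tau) ->
  forall K, exists A, forall t, A < t -> K <= M t.
Proof.
move=> nint K; apply: contrapT => H.
have HK n : M n%:R <= K.
  rewrite leNgt; apply/negP => lt; apply: H; exists n%:R => t nt.
  apply: (le_trans (ltW lt)); have n0 : 0 <= n%:R :> R by [].
  apply: E_le; [exact: bmf_min|by apply: bmf_min; exact: le_trans (ltW nt)|].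
  by move=> y; apply: le_min2 => //; exact: ltW.
apply: nint; apply/integrableP; split; first exact/measurable_EFinP.
pose g n y : \bar R := (Num.min (tau y) n%:R)%:E.
have mg n : measurable_fun [set: Y] (g n).
  by apply/measurable_EFinP; exact: (proj1 (bmf_min (ler0n R n))).
have g0 n y : [set: Y] y -> (0 <= g n y)%E.
  by move=> _; rewrite lee_fin le_min tau0 ler0n.
have nd y : [set: Y] y -> nondecreasing_seq (g^~ y).
  by move=> _ m n mn; rewrite lee_fin; apply: le_min2 => //; rewrite ler_nat.
have gl y : limn (g^~ y) = (tau y)%:E.
  apply: cvg_lim => //; apply: cvg_near_cst; near=> n.
  rewrite /g; congr EFin; apply/min_idPl; near: n; exact: nbhs_infty_ger.
rewrite (_ : (\int[mu]_y _)%E = \int[mu]_y limn (g^~ y))%E; last first.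
  by apply: eq_integral => y _; rewrite gl/= ger0_norm.
rewrite monotone_convergence//.
apply: (@le_lt_trans _ _ K%:E); last exact: ltry.
apply: lime_le.
  apply: ereal_nondecreasing_is_cvgn => m n mn; apply: ge0_le_integral => //.
  - by move=> y _; exact: g0.
  - by move=> y _; exact: nd.
apply: nearW => n; rewrite /g E_EFin; [exact: HK|exact: bmf_min].
Unshelve. all: by end_near. Qed.

Hypothesis TRV : forall l : R, 0 < l ->
  T (l * t) / T t @[t --> +oo] --> l `^ (- (1 : R)).

Let T_gt0 := tail_gt0 (tailf01 mu mtau) (tailf_mono mu mtau) TRV.

Lemma tail_ratio_bounds (l e : R) : 0 < l -> 0 < e -> exists A, forall t, A < t ->
  (l^-1 - e) * T t <= T (l * t) <= (l^-1 + e) * T t.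
Proof.
move=> l0 e0; move: (TRV l0) => /cvgrPdist_le /(_ e e0) [A [_ HA]].
exists A => t /HA; rewrite powRN powRr1 ?(ltW l0)// distrC ler_distl.
by rewrite ler_pdivlMr// ler_pdivrMr.
Qed.

Let tail_small_step (a X w m1 m2 z : R) : z <= m2 ->
  X - 2^-1 * X <= m1 - m2 -> a / 4 * X - w / 4 <= z -> w <= X ->
  (a + 1) / 4 * X <= m1.
Proof. by lra. Qed.

(** By induction, [k / 4 * (t * T t) <= M t] for large [t]. The step adds
    [M t - M (t / 2) >= t / 2 * T t] to the bound at [t / 2], where
    [T (t / 2) >= (2 - 2 / k.+1) * T t]: half of [t * T t] is gained and less than a quarter of it
    is lost. *)
Lemma tail_small (e : R) : 0 < e -> exists A, forall t, A < t -> t * T t <= e * M t.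
Proof.
have H (k : nat) : exists A, forall t, A < t -> k%:R / 4 * (t * T t) <= M t.
  elim: k => [|k [A IH]].
    exists 0 => t t0; rewrite !mul0r; apply: E_ge0 => y; rewrite le_min tau0/= ltW//.
  have e0 : 0 < 2 / k.+1%:R :> R by rewrite divr_gt0.
  have h2 : 0 < 2^-1 :> R by rewrite invr_gt0.
  have [B HB] := tail_ratio_bounds h2 e0.
  exists (Num.max 0 (Num.max B (2 * A))) => t; rewrite !gt_max => /and3P[t0 tB tA].
  have At : A < 2^-1 * t by rewrite ltr_pdivlMl.
  have /andP[h3 _] := HB t tB; rewrite invrK in h3.
  have h4 := IH _ At.
  have /andP[h5 _] : (t - 2^-1 * t) * T t <= M t - M (2^-1 * t) <= (t - 2^-1 * t) * T (2^-1 * t).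
    by apply: trunc_mean_incr; apply/andP; split; lra.
  have kk : k%:R / 4 * (2^-1 * t * ((2 - 2 / k.+1%:R) * T t)) <= k%:R / 4 * (2^-1 * t * T (2^-1 * t)).
    by apply: ler_wpM2l; [rewrite divr_ge0|apply: ler_wpM2l => //; lra].
  have e1 : k%:R / 4 * (2^-1 * t * ((2 - 2 / k.+1%:R) * T t)) =
      k%:R / 4 * (t * T t) - (k%:R / k.+1%:R) * (t * T t) / 4 by field.
  have e2 : k%:R / k.+1%:R * (t * T t) <= t * T t.
    rewrite ler_piMl ?mulr_ge0 ?(ltW t0) ?(ltW (T_gt0 t))//.
    by rewrite ler_pdivrMr// mul1r ler_nat.
  rewrite e1 in kk; rewrite -[k.+1%:R]natr1.
  move: h4 h5 kk e2; rewrite mulrBl.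
  have -> : 2^-1 * t * T t = 2^-1 * (t * T t) by rewrite mulrA.
  exact: tail_small_step.
move=> e0; have [A HA] := H (Num.truncn (4 / e)).+1.
exists (Num.max A 0) => t; rewrite gt_max => /andP[tA t0].
rewrite -ler_pdivrMl//; apply: le_trans (HA t tA).
rewrite ler_wpM2r ?mulr_ge0 ?(ltW t0) ?(ltW (T_gt0 t))//.
by rewrite ler_pdivlMr// mulrC ltW// truncnS_gt.
Qed.

(** [M t - M (l * t) <= t * T (l * t)], which for large [t] is at most a constant times [t * T t],
    negligible before [M t]. *)
Lemma trunc_mean_slow (l e : R) : 0 < l <= 1 -> 0 < e -> exists A, forall t, A < t ->
  (1 - e) * M t <= M (l * t) <= M t.
Proof.
move=> /andP[l0 l1] e0.
have li : 0 < l^-1 by rewrite invr_gt0.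
have [A HA] := tail_ratio_bounds l0 li.
have q0 : 0 < e / (2 * l^-1) by rewrite divr_gt0// mulr_gt0.
have [B HB] := tail_small q0.
exists (Num.max 0 (Num.max A B)) => t; rewrite !gt_max => /and3P[t0 tA tB].
have /andP[_ h1] := HA t tA; have h2 := HB t tB.
have lt : l * t <= t by rewrite ler_piMl// ltW.
have lt0 : 0 <= l * t by rewrite mulr_ge0// ltW.
have /andP[h3 h4] := trunc_mean_incr (s := l * t) (t := t) ltac:(by rewrite lt0).
have h5 : 0 <= (t - l * t) * T t by rewrite mulr_ge0 ?subr_ge0// ltW.
have h6 : (t - l * t) * T (l * t) <= e * M t.
  apply: (@le_trans _ _ (t * ((l^-1 + l^-1) * T t))).
    apply: ler_pM => //; rewrite ?subr_ge0 ?(ltW (T_gt0 _))//.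
    by rewrite gerBl.
  have -> : t * ((l^-1 + l^-1) * T t) = 2 * l^-1 * (t * T t) by ring.
  by rewrite -ler_pdivlMl ?mulr_gt0// mulrA [_^-1 * e]mulrC.
by apply/andP; split; lra.
Qed.

(** Above, [1 - exp (- x)] is at most [x] and at most [1]. Below, only [tau <= l * t] is kept: there
    [x = tau / t <= l] and [1 - exp (- x) >= x / (1 + x) >= x / (1 + l)]. The discarded part of
    [M t] is at most [t * T (l * t)], which is negligible by [tail_small]. *)
Lemma Phi_trunc_mean (e : R) : 0 < e -> exists A, forall t, A < t ->
  (1 - e) * M t <= t * Phi mu tau t^-1 <= M t.
Proof.
wlog e1 : e / e <= 1.
  move=> H e0; have [h|h] := leP e 1; first exact: H.
  have [A HA] := H 1 (lexx _) ltr01; exists (Num.max A 0) => t; rewrite gt_max => /andP[tA t0].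
  have /andP[h1 ->] := HA t tA; rewrite andbT; apply: le_trans h1.
  rewrite subrr mul0r mulr_le0_ge0//; first by rewrite subr_le0 ltW.
  by apply: E_ge0 => y; rewrite le_min tau0/= ltW.
(* [(1 + l) * (1 - e) <= 1 - e / 4], so a quarter of [e] remains for the discarded part. *)
move=> e0; pose l := e / 4.
have l0 : 0 < l by rewrite divr_gt0.
have l1 : l <= 1 by rewrite /l; lra.
have li : 0 < l^-1 by rewrite invr_gt0.
have [A HA] := tail_ratio_bounds l0 li.
have q0 : 0 < e / (4 * l^-1) / 2 by rewrite !divr_gt0// mulr_gt0.
have [B HB] := tail_small q0.
exists (Num.max 0 (Num.max A B)) => t; rewrite !gt_max => /and3P[t0 tA tB].
have /andP[_ h1] := HA t tA; have h2 := HB t tB.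
have tn0 : t != 0 by rewrite gt_eqF.
have ti : 0 <= t^-1 by rewrite invr_ge0 ltW.
have be := bmf_etau mtau tau0 ti.
have b1e : bmf (fun y => 1 - etau tau t^-1 y) by apply: bmf_sub => //; exact: bmf_cst.
have bte : bmf (fun y => t * (1 - etau tau t^-1 y)) by apply: bmf_mul => //; exact: bmf_cst.
have lt : l * t <= t by rewrite ler_piMl// ltW.
have lt0 : 0 <= l * t by rewrite mulr_ge0// ltW.
have -> : t * Phi mu tau t^-1 = E (fun y => t * (1 - etau tau t^-1 y)).
  by rewrite E_scale.
apply/andP; split; last first.
  apply: E_le => //; first by apply: bmf_min; exact: ltW.
  move=> y; rewrite le_min; apply/andP; split; last first.
    by rewrite ler_piMr ?(ltW t0)// gerBl etau_ge0.
  have := @expR_ge1Dx R (- (t^-1 * tau y)) => h; rewrite /etau.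
  have {}h : 1 - expR (- (t^-1 * tau y)) <= t^-1 * tau y by lra.
  by rewrite -ler_pdivlMl.
have bml : bmf (fun y => Num.min (tau y) (l * t)) by exact: bmf_min.
have btl : bmf (fun y => (l * t) * (\1_[set y | l * t < tau y] y : R)).
  by apply: bmf_mul => //; exact: bmf_cst.
have low : (1 + l)^-1 * (M (l * t) - l * t * T (l * t)) <= E (fun y => t * (1 - etau tau t^-1 y)).
  rewrite -E_tail -E_scale// -E_sub// -E_scale; last exact: bmf_sub.
  apply: E_le => //.
    by apply: bmf_mul; [exact: bmf_cst|exact: bmf_sub].
  move=> y; rewrite indic_tail.
  have [h|h] /= := ltP (l * t) (tau y).
    rewrite mulr1 subrr mulr0 mulr_ge0 ?(ltW t0)//.
    by rewrite subr_ge0 etau_le1.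
  rewrite mulr0 subr0 /etau.
  have [x xE] : exists x, x = t^-1 * tau y by eexists.
  have x0 : 0 <= x by rewrite xE mulr_ge0.
  have xl : x <= l by rewrite xE ler_pdivrMl// mulrC.
  have tauE : tau y = t * x by rewrite xE mulrA divff// mul1r.
  rewrite -xE tauE.
  rewrite mulrCA ler_pM2l// expRN mulrC.
  have hx := @expR_ge1Dx R x.
  have x1 : 0 < 1 + x by lra.
  apply: (@le_trans _ _ (1 - (1 + x)^-1)).
    have -> : 1 - (1 + x)^-1 = x / (1 + x) by field; rewrite gt_eqF.
    by rewrite ler_wpM2l// lef_pV2 ?posrE ?lerD2l//; lra.
  by rewrite lerD2l lerN2 lef_pV2 ?posrE ?expR_gt0.
apply: le_trans low.
have /andP[_ h4] := trunc_mean_incr (s := l * t) (t := t) ltac:(by rewrite lt0).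
have h6 : (t - l * t) * T (l * t) + l * t * T (l * t) <= e / 4 * M t.
  have -> : (t - l * t) * T (l * t) + l * t * T (l * t) = t * T (l * t) by ring.
  apply: (@le_trans _ _ (t * ((l^-1 + l^-1) * T t))); first by rewrite ler_pM2l.
  have -> : t * ((l^-1 + l^-1) * T t) = 2 * l^-1 * (t * T t) by ring.
  rewrite -ler_pdivlMl ?mulr_gt0//; apply: (le_trans h2).
  have M0 : 0 <= M t by apply: E_ge0 => y; rewrite le_min tau0/= ltW.
  by rewrite le_eqVlt; apply/orP; left; apply/eqP; field; rewrite gt_eqF.
rewrite ler_pdivlMl; last by lra.
have M0 : 0 <= M t by apply: E_ge0 => y; rewrite le_min tau0/= ltW.
have h7 : (1 + l) * ((1 - e) * M t) <= (1 - e / 4) * M t.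
  rewrite mulrA ler_wpM2r// /l; nra.
lra.
Qed.

End TruncatedMean.

(** * Norming functions and regular variation of [Phi] *)

Lemma cvg_pinfty_eq {R : realType} (f g : R -> R) (a b : R) :
  f x @[x --> +oo] --> a -> a = b -> (forall t, 0 < t -> f t = g t) ->
  g x @[x --> +oo] --> b.
Proof.
move=> fa <- fg; apply: cvg_trans fa; apply: near_eq_cvg.
by exists 0; split => // t t0; apply/esym/fg.
Qed.

Section Norming.
Context {R : realType} {d : measure_display} {Y : measurableType d}.
Variable mu : probability Y R.
Local Notation leb := (@lebesgue_measure R).
Local Notation E := (E mu).
Variable tau : Y -> R.
Hypothesis mtau : measurable_fun [set: Y] tau.
Hypothesis tau0 : forall y, 0 <= tau y.
Local Notation T := (tailf mu tau).
Local Notation M := (trunc_mean mu tau).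
Local Notation Phi := (Phi mu tau).
Variables (beta : R) (ell : R -> R).
Hypothesis beta01 : 0 < beta <= 1.
Hypothesis sv : slowly_varying ell.
Hypothesis htail : forall t : R, 0 < t ->
  mu [set y | t < tau y] = (ell t * t `^ (- beta))%:E.

Lemma tailf_ell t : 0 < t -> T t = ell t * t `^ (- beta).
Proof. by move=> t0; rewrite /tailf htail. Qed.

Lemma tailf_RV (l : R) : 0 < l -> T (l * t) / T t @[t --> +oo] --> l `^ (- beta).
Proof.
move=> l0; apply: (cvg_pinfty_eq (cvgM (sv l0) (cvg_cst (l `^ (- beta))))).
  by rewrite mul1r.
move=> t t0 /=.
rewrite !tailf_ell ?mulr_gt0// powRM ?(ltW l0) ?(ltW t0)// !invfM /=.
by move: (_^-1) (ell _) => x z; field; rewrite gt_eqF ?powR_gt0.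
Qed.

Let beta0 : 0 <= beta. Proof. by case/andP: beta01 => /ltW. Qed.
Let T01 := tailf01 mu mtau.
Let Tmono := tailf_mono mu mtau.
Let T_gt0 := tail_gt0 T01 Tmono tailf_RV.

Lemma Phi_ge_tail (s : R) : 0 < s -> (1 - expR (- 1)) * T s^-1 <= Phi s.
Proof.
move=> s0; have be := bmf_etau mtau tau0 (ltW s0).
have mt := measurable_tailset mtau s^-1.
have -> : T s^-1 = E (\1_[set y | s^-1 < tau y] : Y -> R) by rewrite E_indic.
rewrite -E_scale; last exact: bmf_indic.
apply: E_le.
- by apply: bmf_mul; [exact: bmf_cst|exact: bmf_indic].
- by apply: bmf_sub => //; exact: bmf_cst.
move=> y; rewrite indicE; case: (boolP (y \in _)) => [|_].
  rewrite inE /= => h; rewrite mulr1 lerD2l lerN2 ler_expR lerN2.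
  by rewrite -ler_pdivrMl// mulr1 ltW.
by rewrite mulr0 subr_ge0 etau_le1 ?(ltW s0).
Qed.

Let c1 : 0 < 1 - expR (- 1) :> R.
Proof. by rewrite subr_gt0 expR_lt1 oppr_lt0. Qed.

Lemma Phi_gt0 (s : R) : 0 < s -> 0 < Phi s.
Proof. by move=> s0; apply: lt_le_trans (Phi_ge_tail s0); rewrite mulr_gt0. Qed.

(** [Phi s] is at least a multiple of the tail at [1 / s], hence of [s ^ b] with [b] halfway between
    [beta] and [a]; the surplus [s ^ (a - b)] supplies the factor [e]. *)
Lemma powR_le_Phi (a e : R) : beta < a -> 0 < e ->
  exists2 s0, 0 < s0 & forall s, 0 < s < s0 -> s `^ a <= e * Phi s.
Proof.
move=> ba e0; pose b := (beta + a) / 2.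
have bb : beta < b by rewrite /b; lra.
have ab : 0 < a - b by rewrite /b; lra.
have [t1 [c [t10 c0 H]]] := tail_lower beta0 T01 Tmono tailf_RV bb.
have q0 : 0 < e * ((1 - expR (- 1)) * c) by rewrite !mulr_gt0.
have [s1 s10 H1] := powR_small ab q0.
exists (Num.min s1 t1^-1); first by rewrite lt_min s10 invr_gt0.
move=> s /andP[s0]; rewrite lt_min => /andP[ss1 st1].
have -> : s `^ a = s `^ (a - b) * s `^ b.
  by rewrite -powRD ?(gt_eqF s0) ?implybT// subrK.
have h1 := H1 s ltac:(by rewrite s0).
have h2 := H s^-1 ltac:(by rewrite -[t1]invrK lef_pV2 ?posrE ?invr_gt0// ltW).
have e1 : s^-1 `^ (- b) = s `^ b.
  by rewrite -[s^-1]powR_inv1 ?(ltW s0)// -powRrM mulN1r opprK.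
rewrite e1 in h2.
apply: (@le_trans _ _ (e * ((1 - expR (- 1)) * c) * s `^ b)).
  by rewrite ler_wpM2r ?powR_ge0.
rewrite -!mulrA ler_pM2l//; apply: le_trans (Phi_ge_tail s0).
by rewrite ler_pM2l.
Qed.

Hypothesis tau1 : {ae mu, forall y, 1 <= tau y}.
Hypothesis nint : ~ mu.-integrable [set: Y] (EFin \o tau).

Let cvg_scale (l : R) : 0 < l -> (l * t @[t --> +oo]) --> +oo.
Proof. by move=> l0; apply: gt0_cvgMry. Qed.

Lemma mfun_ell_trunc_mean t : beta = 1 -> 1 <= t -> mfun_ell beta ell t = M t - 1.
Proof.
move=> b1 t1; rewrite /mfun_ell b1 ltxx /Rintegral -[RHS]/(fine (M t - 1)%:E).
congr fine; rewrite -integral_tail_cut//; apply: eq_integral => x.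
rewrite inE/= in_itv/= => /andP[x1 _]; have x0 : 0 < x by exact: lt_le_trans x1.
by rewrite htail// b1 powR_inv1 ?(ltW x0).
Qed.

(** Unites the two regimes. For [beta < 1] the norming function is the tail and
    [c = Gamma (1 - beta)]; for [beta = 1], where that integral diverges, it is the truncated mean
    over [t], and [c = 1]. In the second case [mfun_ell] is the truncated mean minus [1], and
    nonintegrability of [tau] makes the [1] negligible. *)
Lemma norming : exists (N : R -> R) (c : R),
  [/\ (forall t, 0 < t -> 0 < N t) /\ 0 < c,
      Phi t^-1 / N t @[t --> +oo] --> c,
      (forall l, 0 < l <= 1 -> N (l * t) / N t @[t --> +oo] --> l `^ (- beta)),
      t^-1 * mfun_ell beta ell t / N t @[t --> +oo] --> (1 : R) &
      Dconst beta = (c * Gamma (1 + beta))^-1].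
Proof.
have /andP[b0 b1] := beta01.
have [blt|bge] := ltP beta 1.
  exists T, (Gamma (1 - beta)); split.
  - split; first by move=> t _; exact: T_gt0.
    rewrite addrC; apply: Gamma_gt0; apply: integrable_powR_expRN_neg.
    by rewrite ltrN2 blt oppr_le0.
  - exact: (Phi_tailf_ratio mtau tau0 beta0 tailf_RV blt).
  - by move=> l /andP[l0 _]; exact: tailf_RV.
  - apply: cvg_near_cst; exists 0; split => // t t0 /=.
    rewrite /mfun_ell blt tailf_ell// powRD; last by rewrite (gt_eqF t0) implybT.
    rewrite powRr1 ?(ltW t0)//.
    have : ell t * t `^ (- beta) != 0 by rewrite -tailf_ell// gt_eqF ?T_gt0.
    by rewrite mulf_eq0 negb_or => /andP[h1 h2]; field; rewrite h1 h2 gt_eqF.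
  - by rewrite /Dconst b0 blt.
have be1 : beta = 1 by apply/eqP; rewrite eq_le b1.
have TRV1 l (l0 : 0 < l) : T (l * t) / T t @[t --> +oo] --> l `^ (- (1 : R)).
  by have := tailf_RV l0; rewrite be1.
have M0 t : 0 < t -> 0 < M t.
  move=> t0; rewrite lt_def andbC E_ge0/=; last by move=> y; rewrite le_min tau0 ltW.
  have h : (0 : R) <= 0 <= t by rewrite lexx ltW.
  have /andP[h1 _] := trunc_mean_incr mu mtau tau0 h.
  have M00 : 0 <= M 0 by apply: E_ge0 => y; rewrite le_min tau0 lexx.
  rewrite gt_eqF//; apply: lt_le_trans (_ : (t - 0) * T t <= _).
    by rewrite subr0 mulr_gt0.
  by rewrite (le_trans h1)// gerBl.
exists (fun t => M t / t), 1; split.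
- by split => // t t0; rewrite divr_gt0// M0.
- apply/cvgrPdist_le => e e0.
  have [A HA] := Phi_trunc_mean mtau tau0 TRV1 e0.
  exists (Num.max 0 A); split; first exact: num_real.
  move=> t /=; rewrite gt_max => /andP[t0 tA].
  have /andP[h1 h2] := HA t tA.
  have -> : Phi t^-1 / (M t / t) = t * Phi t^-1 / M t.
    by field; rewrite !gt_eqF// M0.
  rewrite ler_distlC ler_pdivlMr ?ler_pdivrMr ?M0// h1/= (le_trans h2)//.
  by rewrite ler_peMl ?(ltW (M0 t t0))// lerDl ltW.
- move=> l ll; have /andP[l0 l1] := ll.
  have -> : l `^ (- beta) = 1 * l^-1 by rewrite be1 powR_inv1 ?(ltW l0) ?mul1r.
  have : M (l * t) / M t @[t --> +oo] --> (1 : R).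
    apply/cvgrPdist_le => e e0.
    have [A HA] := trunc_mean_slow mtau tau0 TRV1 ll e0.
    exists (Num.max 0 A); split; first exact: num_real.
  move=> t /=; rewrite gt_max => /andP[t0 tA].
    have /andP[h1 h2] := HA t tA.
    rewrite ler_distlC ler_pdivlMr ?ler_pdivrMr ?M0// h1/= (le_trans h2)//.
    by rewrite ler_peMl ?(ltW (M0 t t0))// lerDl ltW.
  move=> H; apply: (cvg_pinfty_eq (cvgM H (cvg_cst l^-1))) => // t t0 /=.
  by field; rewrite !gt_eqF// M0.
- apply/cvgrPdist_le => e e0.
  have [A HA] := trunc_mean_unbounded mtau tau0 nint e^-1.
  exists (Num.max 1 A); split; first exact: num_real.
  move=> t /=; rewrite gt_max => /andP[t1 tA].
  have t0 : 0 < t by exact: lt_trans t1.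
  have Mt0 := M0 t t0.
  have -> : t^-1 * mfun_ell beta ell t / (M t / t) = 1 - (M t)^-1.
    by rewrite mfun_ell_trunc_mean ?(ltW t1)//; field; rewrite !gt_eqF.
  rewrite opprB addrC subrK ger0_norm ?invr_ge0 ?(ltW Mt0)//.
  rewrite -[e]invrK lef_pV2 ?posrE ?invr_gt0//.
  exact: HA.
- by rewrite /Dconst be1 ltxx andbF Gamma2 mulr1 invr1.
Qed.

Lemma Phi_RV (l : R) : 0 < l <= 1 ->
  Phi (l * t)^-1 / Phi t^-1 @[t --> +oo] --> l `^ (- beta).
Proof.
move=> ll; have /andP[l0 l1] := ll.
have [N [c [[N0 c0] H1 H2 _ _]]] := norming.
have H3 := cvg_comp _ _ (@cvg_scale l l0) H1.
have cn : c != 0 by rewrite gt_eqF.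
apply: (cvg_pinfty_eq (cvgM (cvgM H3 (H2 l ll)) (cvgV cn H1))).
  by rewrite mulrAC mulfV// mul1r.
move=> t t0 /=.
have h1 := N0 t t0; have h2 := N0 _ (mulr_gt0 l0 t0).
have h3 : 0 < Phi t^-1 by rewrite Phi_gt0 ?invr_gt0.
rewrite /= /comp/= invf_div.
by field; rewrite !gt_eqF.
Qed.

Lemma norming_Phi : exists2 c : R,
  t^-1 * mfun_ell beta ell t / Phi t^-1 @[t --> +oo] --> c^-1 &
  Dconst beta = (c * Gamma (1 + beta))^-1.
Proof.
have [N [c [[N0 c0] H1 _ H2 D]]] := norming; exists c => //.
have cn : c != 0 by rewrite gt_eqF.
apply: (cvg_pinfty_eq (cvgM H2 (cvgV cn H1))); first by rewrite mul1r.
move=> t t0 /=.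
have h1 := N0 t t0.
have h3 : 0 < Phi t^-1 by rewrite Phi_gt0 ?invr_gt0.
by rewrite /= invf_div; field; rewrite !gt_eqF.
Qed.

End Norming.
(** * Renewal asymptotics *)

Section Renewal.
Context {R : realType} {d : measure_display} {Y : measurableType d}.
Variable mu : probability Y R.
Local Notation leb := (@lebesgue_measure R).
Local Notation D := (`[0%R, +oo[%classic : set R).
Local Notation E := (E mu).
Variables (F : Y -> Y) (Q : (Y -> R) -> Y -> R) (tau : Y -> R).
Local Notation eS := (eS F tau).
Local Notation GN := (GN F tau).
Local Notation Phi := (Phi mu tau).
Local Notation X := (birkhoff_sum F tau).
Hypothesis HQ : bounded_transfer mu F Q.
Hypothesis mtau : measurable_fun [set: Y] tau.
Hypothesis tau0 : forall y, 0 <= tau y.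
Hypothesis tau1 : {ae mu, forall y, 1 <= tau y}.
Variables A B : set Y.
Hypothesis mA : measurable A.
Hypothesis mB : measurable B.

Let C k : set Y := A `&` (iter k F) @^-1` B.

Let mC k : measurable (C k).
Proof.
by apply: measurableI => //; rewrite -[_ @^-1` _]setTI; apply: (measurable_iter HQ).
Qed.

Let mXle k x : measurable [set y | X k y <= x].
Proof.
apply: measurable_leset; last exact: measurable_cst.
exact: (measurable_birkhoff HQ mtau).
Qed.

Definition renewal_term k (x : R) : R := fine (mu (C k `&` [set y | X k y <= x])).

Lemma renewal_termE k x : mu (C k `&` [set y | X k y <= x]) = (renewal_term k x)%:E.
Proof.
have mS : measurable (C k `&` [set y | X k y <= x]) by exact: measurableI.
rewrite /renewal_term fineK// ge0_fin_numE//.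
by apply: le_lt_trans (probability_le1 mu mS) _; rewrite ltry.
Qed.

Lemma renewal_term_ge0 k x : 0 <= renewal_term k x.
Proof. by rewrite -lee_fin -renewal_termE. Qed.

Lemma renewal_term_mono k x y : x <= y -> renewal_term k x <= renewal_term k y.
Proof.
move=> xy; rewrite -lee_fin -!renewal_termE; apply: le_measure; rewrite ?inE.
- exact: measurableI.
- exact: measurableI.
- by move=> z [Cz zx]; split => //=; exact: le_trans xy.
Qed.

(** [tau_k >= k] almost everywhere. Hence the renewal series at [x] has finitely many nonzero terms,
    and [U] is real-valued. *)
Lemma renewal_term_eq0 k x : x < k%:R -> renewal_term k x = 0.
Proof.
move=> xk; suff H : mu (C k `&` [set y | X k y <= x]) = 0%E.
  by move: H; rewrite renewal_termE => -[].
apply/eqP; rewrite eq_le measure_ge0 andbT.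
have [N [mN N0 HN]] := birkhoff_geN HQ mtau tau1 k.
rewrite -N0; apply: le_measure; rewrite ?inE//; first exact: measurableI.
move=> z [_ /= zx]; apply: HN => /= h.
by have := lt_le_trans xk (le_trans h zx); rewrite ltxx.
Qed.

Lemma renewal_funE x :
  renewal_fun mu F tau A B x = (\sum_(0 <= k <oo) (renewal_term k x)%:E)%E.
Proof.
apply: eq_eseriesr => k _; rewrite -renewal_termE; congr (mu _).
apply/seteqP; split => y [h1 h2]; split => //; move: h2; rewrite /= in_itv/=.
  by case/andP.
by move=> ->; rewrite birkhoff_ge0.
Qed.

Lemma renewal_fun_fin x (K : nat) : x < K%:R ->
  renewal_fun mu F tau A B x = (\sum_(0 <= k < K) renewal_term k x)%:E.
Proof.
move=> xK; rewrite renewal_funE -sumEFin; apply: lim_near_cst => //.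
exists K => // n /= Kn; rewrite (big_cat_nat (leq0n K) Kn)/=.
have -> : (\sum_(K <= k < n) (renewal_term k x)%:E = 0)%E.
  rewrite big_nat big1// => k /andP[Kk _]; rewrite renewal_term_eq0//.
  by apply: lt_le_trans xK _; rewrite ler_nat.
by rewrite adde0.
Qed.

Definition renewal_real (x : R) : R := fine (renewal_fun mu F tau A B x).
Local Notation U := renewal_real.

Let lt_trunc (x : R) : x < (Num.truncn x).+1%:R.
Proof. exact: truncnS_gt. Qed.

Lemma renewal_realE x : renewal_fun mu F tau A B x = (U x)%:E.
Proof. by rewrite /renewal_real (renewal_fun_fin (lt_trunc x)). Qed.

Lemma renewal_real_fin x (K : nat) : x < K%:R ->
  U x = \sum_(0 <= k < K) renewal_term k x.
Proof. by move=> xK; rewrite /renewal_real (renewal_fun_fin xK). Qed.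

Lemma renewal_real_ge0 x : 0 <= U x.
Proof.
by rewrite (renewal_real_fin (lt_trunc x)); apply: sumr_ge0 => k _; exact: renewal_term_ge0.
Qed.

Lemma renewal_real_mono x y : x <= y -> U x <= U y.
Proof.
move=> xy; have yK := lt_trunc y; have xK := le_lt_trans xy yK.
rewrite (renewal_real_fin xK) (renewal_real_fin yK); apply: ler_sum => k _.
exact: renewal_term_mono.
Qed.

Let bA : bmf (\1_A : Y -> R). Proof. exact: bmf_indic. Qed.
Let bB : bmf (\1_B : Y -> R). Proof. exact: bmf_indic. Qed.

Let etm (s : R) k : R := E (fun y => \1_A y * (eS s k y * \1_B (iter k F y))).

Let betm s k : 0 <= s -> bmf (fun y => \1_A y * (eS s k y * \1_B (iter k F y)) : R).
Proof. by move=> s0; apply: bmf_mul => //; exact: (bmf_eSw HQ mtau tau0). Qed.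

Let indicC k y : \1_(C k) y = \1_A y * \1_B (iter k F y) :> R.
Proof. by rewrite /C indicI /= !indicE. Qed.

(** The terms are nonnegative, so series and integral are exchanged; each term is [laplace_cdf] for
    [tau_k / t]. *)
Lemma renewal_laplace (l t : R) : 0 < l -> 0 < t ->
  (\int[leb]_(x in D) ((l * expR (- (l * x)) * U (x * t))%:E) =
   \sum_(0 <= k <oo) (etm (l / t) k)%:E)%E.
Proof.
move=> l0 t0; have st0 : 0 <= l / t by rewrite divr_ge0 ?ltW.
have mt k : measurable_fun [set: R] (fun x => l * expR (- (l * x)) * renewal_term k (x * t)).
  apply: measurable_funM.
    apply: measurable_funM => //; apply: (measurableT_comp measurable_expRN).
    exact: measurable_funM.
  apply: (nondecreasing_measurable measurableT) => // x y xy.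
  by apply: renewal_term_mono; rewrite ler_pM2r.
rewrite (_ : (\int[leb]_(x in D) _)%E = (\int[leb]_(x in D)
    \sum_(0 <= k <oo) (l * expR (- (l * x)) * renewal_term k (x * t))%:E)%E); last first.
  apply: eq_integral => x _; rewrite EFinM -renewal_realE renewal_funE -nneseriesZl//.
  by move=> k _; rewrite lee_fin renewal_term_ge0.
rewrite integral_nneseries//; last 2 first.
- by move=> k; apply/measurable_EFinP; apply: measurable_funTS; apply: mt.
- move=> k x _; rewrite lee_fin mulr_ge0 ?renewal_term_ge0//.
  by rewrite mulr_ge0 ?expR_ge0// ltW.
apply: eq_eseriesr => k _.
have mX : measurable_fun [set: Y] (fun y => t^-1 * X k y).
  by apply: measurable_funM => //; exact: (measurable_birkhoff HQ mtau).
have X0 y : 0 <= t^-1 * X k y.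
  by rewrite mulr_ge0 ?invr_ge0 ?(ltW t0)//; exact: birkhoff_ge0.
have -> : etm (l / t) k = E (fun y => \1_(C k) y * expR (- (l * (t^-1 * X k y)))).
  by apply: E_ext => y; rewrite indicC /eS [l * (_ * _)]mulrA; ring.
rewrite -(laplace_cdf mu mX X0 (mC k) l0).
apply: eq_integral => x _; rewrite EFinM; congr (_ * _)%E.
rewrite -renewal_termE; congr (mu (_ `&` _)); apply/seteqP.
by split => y /=; rewrite ler_pdivrMl// mulrC.
Qed.

Hypothesis Phi_gt0 : forall s, 0 < s -> 0 < Phi s.
Local Notation kappa := (E (\1_A : Y -> R) * E (\1_B : Y -> R)).
Hypothesis corr : forall eta : R, 0 < eta ->
  exists2 s0, 0 < s0 & forall s N, 0 < s < s0 -> deep s N ->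
    `|E (fun y => \1_A y * GN s \1_B N y) * Phi s - kappa| <=
      expR (- (s * N%:R)) + eta.

Let H (s : R) : R := fine (\sum_(0 <= k <oo) (etm s k)%:E)%E.

Let sum_etm s N : 0 <= s ->
  \sum_(0 <= k < N) etm s k = E (fun y => \1_A y * GN s \1_B N y).
Proof.
move=> s0; rewrite big_mkord -E_sum; last by move=> k _; exact: betm.
by apply: E_ext => y; rewrite /GN mulr_sumr.
Qed.

Let etm_ge0 s k : 0 <= etm s k.
Proof. by apply: E_ge0 => y; rewrite !mulr_ge0 ?expR_ge0 ?indicE. Qed.

Let expRN_small (s e : R) : 0 < s -> 0 < e ->
  exists n0, forall N, (n0 <= N)%N -> expR (- (s * N%:R)) <= e.
Proof.
move=> s0 e0; exists (Num.truncn (s^-1 * e^-1)).+1 => N nN.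
have h : e^-1 <= s * N%:R.
  rewrite -ler_pdivrMl//; apply: (le_trans (ltW (truncnS_gt _))).
  by rewrite ler_nat.
rewrite expRN -[leRHS]invrK lef_pV2 ?posrE ?invr_gt0 ?expR_gt0//.
apply: (le_trans h); apply: le_trans (expR_ge1Dx _).
by rewrite lerDr.
Qed.

(** For fixed [s] every large [N] is [deep], so [corr] bounds all late partial sums. They increase,
    hence converge, and the truncation error [exp (- s N)] disappears in the limit. *)
Lemma renewal_transform (eta : R) : 0 < eta ->
  exists2 s0, 0 < s0 & forall s, 0 < s < s0 ->
    (\sum_(0 <= k <oo) (etm s k)%:E)%E = (H s)%:E /\
    `|H s * Phi s - kappa| <= eta.
Proof.
move=> eta0; have e4 : 0 < eta / 4 by rewrite divr_gt0.
have [s0 s00 H0] := corr e4; exists s0 => // s ss; have /andP[sp _] := ss.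
have s0' := ltW sp; have P0 := Phi_gt0 sp.
pose g N := \sum_(0 <= k < N) etm s k.
have [n1 Hn1] := expRN_small sp e4.
have h2 : 0 < 2^-1 :> R by rewrite invr_gt0.
have [n2 Hn2] := expRN_small sp h2.
pose n3 := maxn 1 (maxn n1 n2).
have Hg N : (n3 <= N)%N -> `|g N * Phi s - kappa| <= eta / 2.
  rewrite !geq_max => /and3P[N0 Nn1 Nn2]; rewrite /g sum_etm//.
  apply: (le_trans (H0 s N ss (conj N0 (Hn2 N Nn2)))).
  by have := Hn1 N Nn1 => h; lra.
have ndg : nondecreasing_seq g.
  apply/nondecreasing_seqP => n; rewrite /g big_nat_recr//= lerDl.
  exact: etm_ge0.
have cg : cvgn g.
  apply: nondecreasing_is_cvgn => //.
  exists ((kappa + eta / 2) / Phi s) => _ [n _ <-].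
  apply: (le_trans (ndg _ _ (leq_maxl n n3))).
  rewrite ler_pdivlMr//; have := Hg _ (leq_maxr n n3).
  by rewrite ler_distl => /andP[].
have E1 : (\sum_(0 <= k <oo) (etm s k)%:E)%E = (limn g)%:E.
  apply: cvg_lim => //.
  rewrite (_ : (fun n => _) = EFin \o g); last first.
    by apply/funext => n; rewrite /= /g -sumEFin.
  by apply: cvg_EFin; [exact: nearW|exact: cg].
have HE : H s = limn g by rewrite /H E1.
split; first by rewrite HE.
rewrite HE; have q0 : 0 < eta / 2 / Phi s by rewrite !divr_gt0.
move/cvgrPdist_le : cg => /(_ _ q0) [n4 _ Hn4].
have h3 := Hn4 _ (leq_maxr n3 n4); have h4 := Hg _ (leq_maxl n3 n4).
have h5 : `|limn g * Phi s - g (maxn n3 n4) * Phi s| <= eta / 2.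
  by rewrite -mulrBl normrM (gtr0_norm P0) -ler_pdivlMr.
apply: le_trans (ler_distD (g (maxn n3 n4) * Phi s) _ _) _.
by apply: (le_trans (lerD h5 h4)); lra.
Qed.

(** The renewal function with its argument rescaled by [t] and its size by [Phi t^-1]: the family to
    which the Tauberian theorem is applied. *)
Let V t x : R := Phi t^-1 * U (x * t).

(** True for infinite [x] as well, since [fine] sends both infinities to [0]: constants can be
    pulled out before finiteness is known. *)
Let fineZ (c : R) (x : \bar R) : fine (c%:E * x)%E = c * fine x.
Proof.
case: x => [r||]; first by [].
  have [c0|c0|->] := ltrgt0P c; last by rewrite mul0e mul0r.
    by rewrite gt0_muley ?lte_fin//= mulr0.
  by rewrite lt0_muley ?lte_fin//= mulr0.
have [c0|c0|->] := ltrgt0P c; last by rewrite mul0e mul0r.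
  by rewrite gt0_muleNy ?lte_fin//= mulr0.
by rewrite lt0_muleNy ?lte_fin//= mulr0.
Qed.

Lemma laplace_test_renewal t j : 0 < t ->
  laplace_test (V t) (fun y => y ^+ j) = Phi t^-1 / j.+1%:R * H (j.+1%:R / t).
Proof.
move=> t0; have j0 : 0 < j.+1%:R :> R by [].
rewrite /H -(renewal_laplace j0 t0) -fineZ /laplace_test /Rintegral.
have P0 : 0 < Phi t^-1 by rewrite Phi_gt0 ?invr_gt0.
congr fine; rewrite -ge0_integralZl//; last 3 first.
- apply/measurable_EFinP; apply: measurable_funTS; apply: measurable_funM.
    apply: measurable_funM => //; apply: (measurableT_comp measurable_expRN).
    exact: measurable_funM.
  apply: (nondecreasing_measurable measurableT) => // x y xy.
  by apply: renewal_real_mono; rewrite ler_pM2r.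
- by move=> x _; rewrite lee_fin !mulr_ge0 ?expR_ge0 ?renewal_real_ge0.
- by rewrite lee_fin divr_ge0// ltW.
apply: eq_integral => x _; rewrite -EFinM; congr EFin.
rewrite /laplace_weight /V -expRM_natl.
have -> : expR (- (j.+1%:R * x)) = expR (j%:R * - x) * expR (- x).
  by rewrite -expRD; congr expR; rewrite -natr1; ring.
by field; rewrite gt_eqF.
Qed.

Variable beta : R.
Hypothesis beta01 : 0 < beta <= 1.
Hypothesis PRV : forall l : R, 0 < l <= 1 ->
  Phi (l * t)^-1 / Phi t^-1 @[t --> +oo] --> l `^ (- beta).

(** Normalized so that its Laplace transform at [k] is [kappa * k ^ - (beta + 1)]. *)
Let V0 x : R := kappa / Gamma (beta + 1) * x `^ beta.

Let kappa0 : 0 <= kappa.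
Proof. by rewrite mulr_ge0// E_ge0// => y; rewrite indicE. Qed.

Let ib : leb.-integrable D (EFin \o (fun x => x `^ beta * expR (- x))).
Proof. by apply: integrable_powR_expRN; case/andP: beta01 => /ltW ->. Qed.

Let G0 : 0 < Gamma (beta + 1).
Proof. by apply: Gamma_gt0; exact: integrable_itv_open. Qed.

Let aV0 : laplace_adm V0.
Proof.
have /andP[b0 _] := beta01.
have c0 : 0 <= kappa / Gamma (beta + 1) by rewrite divr_ge0// ltW.
split.
- by apply: measurable_funM => //; exact: measurable_powR.
- by move=> x _; rewrite mulr_ge0 ?powR_ge0.
- move=> x y /andP[x0 xy]; rewrite ler_wpM2l//.
  by apply: ge0_ler_powR; rewrite ?nnegrE ?(ltW b0)// (le_trans x0).
- have h : leb.-integrable D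
      (fun x => (kappa / Gamma (beta + 1))%:E * (x `^ beta * expR (- x))%:E)%E.
    exact: integrableZl.
  apply: eq_integrable h => // x _; rewrite /= /laplace_weight /V0 -EFinM.
  by congr EFin; ring.
Qed.

Let test_V0 j : laplace_test V0 (fun y => y ^+ j) =
  kappa * j.+1%:R `^ (- (beta + 1)).
Proof.
have j0 : 0 < j.+1%:R :> R by [].
have := integral_powR_scale beta01 j0 => h.
have -> : kappa * j.+1%:R `^ (- (beta + 1)) = kappa / Gamma (beta + 1) *
    (Gamma (beta + 1) * j.+1%:R `^ (- (beta + 1))) by field; rewrite gt_eqF.
rewrite -h -fineZ /laplace_test; congr fine.
rewrite -ge0_integralZl//; last 3 first.
- apply/measurable_EFinP; apply: measurable_funTS; apply: measurable_funM.
    exact: measurable_powR.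
  by apply: (measurableT_comp measurable_expRN); exact: measurable_funM.
- by move=> x _; rewrite lee_fin mulr_ge0 ?powR_ge0 ?expR_ge0.
- by rewrite lee_fin divr_ge0// ltW.
apply: eq_integral => x _; rewrite -EFinM; congr EFin.
rewrite /laplace_weight /V0 -expRM_natl.
have -> : expR (- (j.+1%:R * x)) = expR (j%:R * - x) * expR (- x).
  by rewrite -expRD; congr expR; rewrite -natr1; ring.
by field; rewrite gt_eqF.
Qed.

Let HPhi : H t^-1 * Phi t^-1 @[t --> +oo] --> kappa.
Proof.
apply/cvgrPdist_le => e e0; have [s0 s00 H0] := renewal_transform e0.
exists s0^-1; split; first exact: num_real.
move=> t /= st; have t0 : 0 < t by apply: lt_trans st; rewrite invr_gt0.
have [] := H0 t^-1; last by move=> _; rewrite distrC.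
by rewrite invr_gt0 t0 -[s0]invrK ltf_pV2 ?posrE ?invr_gt0.
Qed.

(** With [l = 1 / j.+1] one has [j.+1 / t = 1 / (l * t)]. The expression is [l] times [H * Phi] at
    that point, which tends to [kappa], divided by the ratio of the two values of [Phi], which tends
    to [l ^ - beta]. *)
Let moment_cvg j : Phi t^-1 / j.+1%:R * H (j.+1%:R / t) @[t --> +oo] -->
  laplace_test V0 (fun y => y ^+ j).
Proof.
have j0 : 0 < j.+1%:R :> R by [].
pose l : R := j.+1%:R^-1.
have l0 : 0 < l by rewrite invr_gt0.
have l1 : l <= 1 by rewrite invf_le1// ler1n.
have ll : 0 < l <= 1 by rewrite l0.
have cl : (l * t @[t --> +oo]) --> +oo by apply: gt0_cvgMry.
have h1 : H (l * t)^-1 * Phi (l * t)^-1 @[t --> +oo] --> kappa.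
  exact: cvg_comp _ _ cl HPhi.
have ln : l `^ (- beta) != 0 by rewrite gt_eqF// powR_gt0.
apply: (cvg_pinfty_eq (cvgM (cvg_cst l) (cvgM h1 (cvgV ln (@PRV l ll))))).
  rewrite test_V0 mulrCA; congr (_ * _).
  rewrite opprD powRD ?(gt_eqF j0) ?implybT// mulrC powR_inv1 ?(ltW j0)//.
  congr (_ * _); rewrite powRN invrK /l -[X in X `^ _]powR_inv1 ?(ltW j0)//.
  by rewrite -powRrM mulN1r.
move=> t t0 /=; have lt0 : 0 < l * t by rewrite mulr_gt0.
have -> : j.+1%:R / t = (l * t)^-1 by rewrite invfM invrK.
have h4 : 0 < Phi t^-1 by rewrite Phi_gt0 ?invr_gt0.
have h5 : 0 < Phi (l * t)^-1 by rewrite Phi_gt0 ?invr_gt0.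
rewrite -/l invf_div; move: h4 h5; rewrite /comp/=.
by move: (Phi _) (Phi _) => x y x0 y0; field; rewrite !gt_eqF.
Qed.

Lemma renewal_asymptotic :
  Phi t^-1 * U t @[t --> +oo] --> kappa / Gamma (beta + 1).
Proof.
have [s0 s00 H0] := renewal_transform ltr01.
(* Beyond [t1] the point [1 / t] is below [s0], where the transform is finite; this is what makes
   the rescaled functions integrable against [exp (- x)]. *)
pose t1 := s0^-1 + 1.
have t10 : 0 < t1 by rewrite addr_gt0// invr_gt0.
have L (w : nat -> R) : (forall n, t1 <= w n) -> w n @[n --> \oo] --> +oo ->
    Phi (w n)^-1 * U (w n) @[n --> \oo] --> kappa / Gamma (beta + 1).
  move=> wt winf.
  have w0 n : 0 < w n by exact: lt_le_trans (wt n).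
  have aV n : laplace_adm (V (w n)).
    have wi : 0 < (w n)^-1 by rewrite invr_gt0.
    have mU : measurable_fun [set: R] (fun x => U (x * w n)).
      apply: (nondecreasing_measurable measurableT) => // x y xy.
      by apply: renewal_real_mono; rewrite ler_pM2r.
    have mV : measurable_fun [set: R] (V (w n)) by exact: measurable_funM.
    have V_ge0 x : 0 <= V (w n) x.
      by rewrite mulr_ge0 ?renewal_real_ge0// ltW// Phi_gt0.
    split => //.
      move=> x y /andP[_ xy]; rewrite ler_wpM2l ?(ltW (Phi_gt0 wi))//.
      by apply: renewal_real_mono; rewrite ler_pM2r.
    apply/integrableP; split.
      apply/measurable_EFinP; apply: measurable_funTS; exact: measurable_weight.
    have HU := renewal_laplace ltr01 (w0 n).
    have ws : 0 < (w n)^-1 < s0.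
      rewrite wi -[s0]invrK ltf_pV2 ?posrE ?invr_gt0//.
      by apply: lt_le_trans (wt n); rewrite /t1 ltrDl ltr01.
    have [HE _] := H0 _ ws; rewrite -[in LHS]div1r in HE.
    rewrite HE in HU.
    rewrite (_ : (\int[leb]_(x in D) _)%E = ((Phi (w n)^-1)%:E *
        \int[leb]_(x in D) (1 * expR (- (1 * x)) * U (x * w n))%:E)%E).
      by rewrite HU -EFinM ltry.
    rewrite -ge0_integralZl//.
    - apply: eq_integral => x _; rewrite /= ger0_norm; last first.
        by rewrite mulr_ge0 ?expR_ge0.
      by rewrite -EFinM /laplace_weight /V !mul1r; congr EFin; ring.
    - apply/measurable_EFinP; apply: measurable_funTS; apply: measurable_funM => //.
      apply: measurable_funM => //; apply: (measurableT_comp measurable_expRN).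
      exact: measurable_funM.
    - by move=> x _; rewrite lee_fin mul1r mulr_ge0 ?expR_ge0 ?renewal_real_ge0.
    - by rewrite lee_fin ltW// Phi_gt0.
  have mom j : laplace_test (V (w n)) (fun y => y ^+ j) @[n --> \oo] -->
      laplace_test V0 (fun y => y ^+ j).
    under eq_cvg do rewrite laplace_test_renewal//.
    by move: (@moment_cvg j) => /cvg_pinftyP /(_ w winf).
  have cV0 : V0 x @[x --> (1 : R)] --> V0 1.
    apply: cvgM; first exact: cvg_cst.
    have d1 : derivable (fun x : R => x `^ beta) 1 1.
      by apply: derivable_powR; rewrite in_itv/= ltr01.
    by move/derivable1_diffP : d1 => /differentiable_continuous.
  have := laplace_tauberian aV aV0 mom cV0.
  rewrite /V0 powR1 mulr1 /V; under eq_cvg do rewrite mul1r; exact.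
apply/cvg_pinftyP => u uinf; pose w n := Num.max t1 (u n).
have wu : \forall n \near \oo, w n = u n.
  near=> n; rewrite /w; apply/max_idPr; near: n.
  exact: (cvgry_ge uinf).
have wt n : t1 <= w n by rewrite le_max lexx.
have winf : w n @[n --> \oo] --> +oo.
  apply: cvg_trans uinf; apply: near_eq_cvg.
  by near=> n; apply/esym; near: n.
have := L w wt winf; apply: cvg_trans; apply: near_eq_cvg.
by near=> n; congr (Phi _^-1 * U _); near: n.
Unshelve. all: by end_near. Qed.

End Renewal.

(** * The renewal theorem for bounded real functions *)

Section RenewalTheorem.
Context {R : realType} {d : measure_display} {Y : measurableType d}.
Variable mu : probability Y R.
Local Notation E := (E mu).
Variables (F : Y -> Y) (Q : (Y -> R) -> Y -> R) (tau : Y -> R).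
Hypothesis HQ : bounded_transfer mu F Q.
Hypothesis mixF : bmf_mixing mu F.
Hypothesis mtau : measurable_fun [set: Y] tau.
Hypothesis tau0 : forall y, 0 <= tau y.
Hypothesis tau1 : {ae mu, forall y, 1 <= tau y}.
Hypothesis nint : ~ mu.-integrable [set: Y] (EFin \o tau).
Variables (beta : R) (ell : R -> R).
Hypothesis beta01 : 0 < beta <= 1.
Hypothesis sv : slowly_varying ell.
Hypothesis htail : forall t : R, 0 < t ->
  mu [set y | t < tau y] = (ell t * t `^ (- beta))%:E.
Variables (p gamma C alpha delta : R) (BN : (Y -> R) -> R -> Prop).
Hypothesis p2 : 2 <= p.
Hypothesis gamma0 : 0 < gamma.
Hypothesis gammap : beta < gamma / 2 * p.
Hypothesis HB : banach_bound mu p BN.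
Hypothesis C0 : 0 < C.
Hypothesis delta0 : 0 < delta.
Hypothesis alpha01 : 0 < alpha < 1.
Hypothesis LY : forall s f x n, 0 <= s < delta -> bmf f -> BN f x ->
  (1 <= n)%N -> BN (iter n (Qs Q tau s) f) (C * (Np mu p f + alpha ^+ n * x)).
Hypothesis moment : forall s f x, 0 < s -> bmf f -> ale mu (fun=> 0) f ->
  BN f x -> Np mu p (Q (fun y => (1 - etau tau s y) * f y)) <= C * s `^ gamma * x.
Variables A B : set Y.
Hypothesis mA : measurable A.
Hypothesis mB : measurable B.
Hypothesis decay : forall e, 0 < e -> exists n,
  E (fun y => `|iter n Q \1_A y - E \1_A|) <= e.

Let p1 : 1 < p. Proof. by apply: lt_le_trans p2; rewrite ltr1n. Qed.

(** The decay of the iterates of [1_A] is a hypothesis of its own because [1_A] is not assumed to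
    belong to the space that [BN] describes. The condition [beta < gamma / 2 * p] makes the
    Chebyshev error negligible before [Phi]. *)
Theorem renewal_fun_asymptotic :
  ((t^-1 * mfun_ell beta ell t)%:E * renewal_fun mu F tau A B t)%E
    @[t --> +oo] --> ((Dconst beta)%:E * mu A * mu B)%E.
Proof.
have Phi0 s (s0 : 0 < s) := Phi_gt0 mtau tau0 sv htail s0.
have PRV l (ll : 0 < l <= 1) := @Phi_RV _ _ _ _ _ mtau tau0 _ _ beta01 sv htail tau1 nint l ll.
have [s1 [M [/andP[s10 s1d] M0 rate]]] :=
  vN_rate p1 gamma0 HQ mixF mtau tau0 tau1 HB C0 delta0 alpha01 LY moment.
have key eta : 0 < eta -> exists2 s0, 0 < s0 & forall s N, 0 < s < s0 -> deep s N ->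
    Np mu p (fun y => vN Q tau s N y - E (vN Q tau s N)) <= eta * E (vN Q tau s N) /\
    `|E (vN Q tau s N) * Phi mu tau s - 1| <=
      expR (- (s * N%:R)) + eta * (E (vN Q tau s N) * Phi mu tau s).
  move=> eta0.
  have HPhi e (e0 : 0 < e) := powR_le_Phi mtau tau0 beta01 sv htail gammap e0.
  have [s0 /andP[s00 _] H] := E_vN_Phi p1 gamma0 HQ mixF mtau tau0 tau1 HB C0
    delta0 alpha01 LY moment eta0 HPhi.
  by exists s0.
have rate' : exists s1 M, [/\ 0 < s1, 0 < M & forall s N, 0 < s < s1 -> deep s N ->
    Np mu p (vN Q tau s N) <= M * E (vN Q tau s N)].
  by exists s1, M; split => // s N ss dN; have [] := rate s N ss dN.
have i01 (S : set Y) z : 0 <= (\1_S z : R) <= 1.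
  by rewrite indicE ler0n lern1 leq_b1.
have corr := laplace_correlation p2 HQ mtau tau0 rate' key
  (bmf_indic mA) (i01 A) (bmf_indic mB) (i01 B) decay.
have HU := renewal_asymptotic HQ mtau tau0 tau1 mA mB Phi0 corr beta01 PRV.
have [c Hc Dc] := norming_Phi mtau tau0 beta01 sv htail tau1 nint.
have fE (S : set Y) : measurable S -> mu S = (E \1_S)%:E.
  move=> mS; rewrite E_indic// fineK// ge0_fin_numE//.
  by apply: le_lt_trans (probability_le1 mu mS) _; rewrite ltry.
have H : t^-1 * mfun_ell beta ell t * renewal_real mu F tau A B t @[t --> +oo] -->
    Dconst beta * E \1_A * E \1_B.
  apply: (cvg_pinfty_eq (cvgM Hc HU)).
    by rewrite Dc invfM [beta + 1]addrC; ring.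
  move=> t t0 /=; have := Phi0 t^-1; rewrite invr_gt0 => /(_ t0) h.
  by field; rewrite !gt_eqF.
rewrite !fE// -!EFinM; under eq_cvg do rewrite (renewal_realE HQ mtau tau0 tau1 mA mB) -EFinM.
by apply: cvg_EFin; [exact: nearW|exact: H].
Qed.

End RenewalTheorem.
(** * From the complex Banach spaces to bounded real functions *)

(** The sum rounds [x] down to a multiple of [e]; the [K] steps leave room for one more cell at the
    top of the range. *)
Lemma staircase {R : realType} (e : R) (K : nat) (x : R) : 0 < e ->
  0 <= x <= K.+1%:R * e ->
  0 <= x - \sum_(j < K) e * (nat_of_bool (j.+1%:R * e <= x))%:R <= e.
Proof.
move=> e0; elim: K x => [|K IH] x /andP[x0 xK].
  by rewrite big_ord0 subr0 x0 (le_trans xK)// mul1r.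
have [h|h] := leP (K.+1%:R * e) x; last first.
  rewrite big_ord_recr/= (lt_geF h) mulr0 addr0; apply: IH.
  by rewrite x0 ltW.
rewrite (eq_bigr (fun=> e)); last first.
  move=> j _; rewrite (le_trans _ h) ?mulr1// ler_pM2r// ler_nat.
  exact: ltn_ord.
rewrite sumr_const card_ord -mulr_natl subr_ge0 h/= lerBlDr.
by apply: (le_trans xK); rewrite -[K.+2%:R]natr1 mulrDl mul1r addrC.
Qed.

Section BoundedMixing.
Context {R : realType} {d : measure_display} {Y : measurableType d}.
Variable mu : probability Y R.
Local Notation E := (E mu).
Implicit Types f g w : Y -> R.

(** [f] is approximated by staircases of mesh [e], combinations of indicators of the level sets of
    [f + M]; the shift by the bound [M] makes the function nonnegative. *)
Lemma bmf_uniform_ind (Pr : (Y -> R) -> Prop) :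
  (forall S : set Y, measurable S -> Pr \1_S) ->
  (forall a f g, bmf f -> bmf g -> Pr f -> Pr g -> Pr (fun y => f y + a * g y)) ->
  (forall f, bmf f -> (forall e, 0 < e -> exists g, [/\ bmf g, Pr g &
    forall y, `|f y - g y| <= e]) -> Pr f) ->
  forall f, bmf f -> Pr f.
Proof.
move=> Pind Plin Plim f bf; apply: Plim => // e e0.
have [M fM] := proj2 bf.
have Pcst c : Pr (fun=> c).
  rewrite (_ : (fun=> c) = fun y => \1_set0 y + c * \1_[set: Y] y); last first.
    by apply/funext => y; rewrite indic0 indicT add0r mulr1.
  by apply: Plin; [exact: bmf_indic|exact: bmf_indic|exact: Pind|exact: Pind].
pose S j := [set y | j.+1%:R * e <= f y + M].
have mS j : measurable (S j).
  apply: measurable_leset; first exact: measurable_cst.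
  by apply: measurable_funD => //; exact: (proj1 bf).
pose g K y := - M + \sum_(j < K) e * \1_(S j) y.
have bg K : bmf (g K).
  apply: bmf_add; first exact: bmf_cst.
  apply: bmf_sum => j _; apply: bmf_mul; first exact: bmf_cst.
  exact: bmf_indic.
have Pg K : Pr (g K).
  elim: K => [|K IH].
    rewrite (_ : g 0 = fun=> - M)//.
    by apply/funext => y; rewrite /g big_ord0 addr0.
  rewrite (_ : g K.+1 = fun y => g K y + e * \1_(S K) y).
    by apply: Plin; [exact: bg|exact: bmf_indic|exact: IH|exact: Pind].
  by apply/funext => y; rewrite /g big_ord_recr/= addrA.
exists (g (Num.truncn (2 * M / e))); split => // y.
have /andP[h1 h2] : - M <= f y <= M by rewrite -ler_norml.
have h : 0 <= f y + M <= (Num.truncn (2 * M / e)).+1%:R * e.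
  apply/andP; split; first lra.
  apply: (@le_trans _ _ (2 * M)); first lra.
  by rewrite -ler_pdivrMr// ltW// truncnS_gt.
have := staircase e0 h.
rewrite (_ : \sum_(j < _) _ = \sum_(j < (Num.truncn (2 * M / e))) e * \1_(S j) y).
  move=> /andP[h3 h4]; rewrite /g opprD opprK addrA ger0_norm//.
apply: eq_bigr => j _; rewrite indicE; congr (_ * _%:R); congr nat_of_bool.
by apply/idP/idP => [k|]; rewrite ?inE.
Qed.

Variable F : Y -> Y.
Hypothesis mpF : measure_preserving mu F.

Let mF n : measurable_fun [set: Y] (iter n F).
Proof.
elim: n => [|n IH]; first exact: measurable_id.
exact: (measurableT_comp (proj1 mpF) IH).
Qed.

Lemma E_measure_preserving f : bmf f -> E (fun y => f (F y)) = E f.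
Proof.
case: mpF => mF1 inv bf; have mf := proj1 bf.
have bfF : bmf (fun y => f (F y)) by exact: bmf_comp.
suff : ((E (fun y => f (F y)))%:E = (E f)%:E)%E by case.
rewrite -!E_EFin//.
have := @integral_pushforward _ _ _ _ R F mF1 mu setT (EFin \o f).
rewrite preimage_setT => <- //; last 2 first.
- exact/measurable_EFinP.
- exact: bmf_integrable bfF.
by apply: eq_measure_integral => S mS _; exact: inv.
Qed.

Hypothesis mixF : mixing mu F.

Let c n f w := E (fun y => f y * w (iter n F y)) - E f * E w.

Let bfw n f w : bmf f -> bmf w -> bmf (fun y => f y * w (iter n F y)).
Proof. by move=> bf bw; apply: bmf_mul => //; exact: bmf_comp. Qed.

Let c_le n f w a b : bmf f -> bmf w -> (forall y, `|f y| <= a) ->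
  (forall y, `|w y| <= b) -> `|c n f w| <= 2 * (a * b).
Proof.
move=> bf bw fa wb; apply: (le_trans (ler_normB _ _)).
have le_E g M : bmf g -> (forall y, `|g y| <= M) -> `|E g| <= M.
  move=> bg gM; apply: (le_trans (E_norm mu bg)); rewrite -[M](E_cst mu).
  by apply: E_le => //; [exact: bmf_abs|exact: bmf_cst].
have h1 := le_E _ (a * b) (bfw n bf bw).
have h2 : `|E f * E w| <= a * b by rewrite normrM ler_pM// le_E.
suff : `|E (fun y => f y * w (iter n F y))| <= a * b by lra.
by apply: h1 => y; rewrite normrM ler_pM.
Qed.

Let c_linl n a f g w : bmf f -> bmf g -> bmf w ->
  c n (fun y => f y + a * g y) w = c n f w + a * c n g w.
Proof.
move=> bf bg bw; have bag : bmf (fun y => a * g y) by apply: bmf_mul => //; exact: bmf_cst.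
rewrite /c E_add// E_scale//.
rewrite (_ : E _ = E (fun y => f y * w (iter n F y) + a * (g y * w (iter n F y)))).
  rewrite E_add; [|exact: bfw|by apply: bmf_mul; [exact: bmf_cst|exact: bfw]].
  by rewrite E_scale; [ring|exact: bfw].
by apply: E_ext => y; ring.
Qed.

Let c_linr n a f g w : bmf f -> bmf g -> bmf w ->
  c n w (fun y => f y + a * g y) = c n w f + a * c n w g.
Proof.
move=> bf bg bw; have bag : bmf (fun y => a * g y) by apply: bmf_mul => //; exact: bmf_cst.
rewrite /c E_add// E_scale//.
rewrite (_ : E _ = E (fun y => w y * f (iter n F y) + a * (w y * g (iter n F y)))).
  rewrite E_add; [|exact: bfw|by apply: bmf_mul; [exact: bmf_cst|exact: bfw]].
  by rewrite E_scale; [ring|exact: bfw].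
by apply: E_ext => y; ring.
Qed.

Let c_lim (u : nat -> R) : (forall e, 0 < e -> exists2 v : nat -> R,
  v @ \oo --> 0 & forall n, `|u n - v n| <= e) -> u @ \oo --> 0.
Proof.
move=> H; apply/cvgrPdist_le => e e0; have e2 : 0 < e / 2 by rewrite divr_gt0.
have [v /cvgrPdist_le /(_ _ e2) [N _ HN] uv] := H _ e2.
exists N => // n /HN/=; rewrite !sub0r !normrN => h.
by have := uv n; have := ler_normD (u n - v n) (v n); rewrite subrK; lra.
Qed.

(** Two nested inductions, on [w] and, for [w] an indicator, on [f]. Uniform limits pass through
    uniformly in [n], because the covariance [c] is at most twice the product of the bounds. *)
Lemma mixing_bmf : bmf_mixing mu F.
Proof.
have lin (u v : nat -> R) a : u @ \oo --> 0 -> v @ \oo --> 0 ->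
    (fun n => u n + a * v n) @ \oo --> 0.
  move=> hu hv; rewrite (_ : 0 = 0 + a * 0); last by rewrite mulr0 addr0.
  by apply: cvgD => //; apply: cvgMr.
have c_mix f w : bmf f -> bmf w -> (fun n => c n f w) @ \oo --> 0.
  move=> bf; move: w; apply: bmf_uniform_ind => [S mS|a w1 w2 b1 b2 h1 h2|w bw H].
  - move: f bf; apply: bmf_uniform_ind => [T mT|a f1 f2 b1 b2 h1 h2|f bf H].
    + have := mixF mT mS; rewrite -[mu T]fineK ?fin_num_measure//.
      rewrite -[mu S]fineK ?fin_num_measure// -!E_indic// -EFinM => /fine_cvg h.
      rewrite -(subrr (E \1_T * E \1_S)); apply: cvgB; last exact: cvg_cst.
      move: h; apply: cvg_trans; apply: near_eq_cvg; apply: nearW => n /=.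
      rewrite -E_indic; last first.
        by apply: measurableI => //; rewrite -[_ @^-1` _]setTI; exact: mF.
      by apply: E_ext => y; rewrite indicI /= !indicE.
    + have bS : bmf (\1_S : Y -> R) by exact: bmf_indic.
      under eq_cvg do rewrite c_linl//.
      exact: lin.
    + apply: c_lim => e e0; have e4 : 0 < e / 2 by rewrite divr_gt0.
      have [g [bg hg fg]] := H _ e4; exists (fun n => c n g \1_S) => // n.
      have bS : bmf (\1_S : Y -> R) by exact: bmf_indic.
      have -> : c n f \1_S - c n g \1_S = c n (fun y => f y + (-1) * g y) \1_S.
        by rewrite c_linl// mulN1r.
      have -> : e = 2 * (e / 2 * 1) by field.
      apply: c_le => //.
      * by apply: bmf_add => //; apply: bmf_mul => //; exact: bmf_cst.
      * by move=> y; rewrite mulN1r.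
      * by move=> y; rewrite indicE ger0_norm ?lern1 ?leq_b1.
  - under eq_cvg do rewrite c_linr//.
    exact: lin.
  - apply: c_lim => e e0; have [M fM] := proj2 bf.
    have M0 : 0 <= M by apply: le_trans (fM point).
    have e4 : 0 < e / (2 * (M + 1)) by rewrite divr_gt0// mulr_gt0// ltr_wpDl.
    have [g [bg hg fg]] := H _ e4; exists (fun n => c n f g) => // n.
    have -> : c n f w - c n f g = c n f (fun y => w y + (-1) * g y).
      by rewrite c_linr// mulN1r.
    have -> : e = 2 * ((M + 1) * (e / (2 * (M + 1)))).
      by field; rewrite gt_eqF// ltr_wpDl.
    apply: c_le => //.
    * by apply: bmf_add => //; apply: bmf_mul => //; exact: bmf_cst.
    * by move=> y; apply: (le_trans (fM y)); rewrite lerDl.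
    * by move=> y; rewrite mulN1r.
move=> f w bf bw; rewrite -[E f * E w]add0r.
rewrite (_ : (fun n => _) = fun n => c n f w + E f * E w).
  by apply: cvgD; [exact: c_mix|exact: cvg_cst].
by apply/funext => n; rewrite /c subrK.
Qed.

End BoundedMixing.

(** * From the complex operator on [L^1] to a real operator on bounded functions *)

Section IntegrableTests.
Context {R : realType} {d : measure_display} {Y : measurableType d}.
Variable mu : probability Y R.
Local Notation E := (E mu).
Local Notation itg f := (mu.-integrable [set: Y] (EFin \o f)).
Implicit Types f g h w : Y -> R.

Lemma integrable_bmfM f w : itg f -> bmf w -> itg (fun y => f y * w y).
Proof.
move=> itf [mw [M wM]].
have := integrableMr measurableT mw _ itf.
rewrite (_ : (_ \* _)%E = EFin \o (fun y => f y * w y)); last first.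
  by apply/funext => y; rewrite /= -EFinM mulrC.
apply; exists M; split; first exact: num_real.
by move=> K MK y _; apply: (le_trans (wM y)); exact: ltW.
Qed.

Lemma E_sub_itg f g : itg f -> itg g -> E (fun y => f y - g y) = E f - E g.
Proof. by move=> itf itg_; rewrite !EE RintegralB. Qed.

Lemma E_aeq_itg f g : measurable_fun [set: Y] f -> measurable_fun [set: Y] g ->
  aeq mu f g -> E f = E g.
Proof.
move=> mf mg fg; rewrite !EE /Rintegral; congr fine.
apply: ae_eq_integral => //; try exact/measurable_EFinP.
by apply: filterS fg => y -> _.
Qed.

(** For integrable functions the positive part of [f - g] may be unbounded and is not an admissible
    test; the indicator of [g < f] takes its place. *)
Lemma ale_test_itg f g : itg f -> itg g ->
  (forall w, bmf w -> (forall y, 0 <= w y) ->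
    E (fun y => f y * w y) <= E (fun y => g y * w y)) -> ale mu f g.
Proof.
move=> itf itg_ H.
have mf : measurable_fun [set: Y] f by exact/measurable_EFinP/(measurable_int _ itf).
have mg : measurable_fun [set: Y] g by exact/measurable_EFinP/(measurable_int _ itg_).
pose w y : R := \1_[set y | g y < f y] y.
have bw : bmf w by apply: bmf_indic; exact: measurable_ltset.
have w0 y : 0 <= w y by rewrite /w indicE.
pose h y := f y * w y - g y * w y.
have h0 y : 0 <= h y.
  rewrite /h -mulrBl /w indicE; case: (boolP (y \in _)) => [|_]; last by rewrite mulr0.
  by rewrite inE /= => gf; rewrite mulr1 subr_ge0 ltW.
have ih : itg h.
  by have := integrableB measurableT (integrable_bmfM itf bw) (integrable_bmfM itg_ bw).
have Eh : E h = 0.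
  apply/eqP; rewrite eq_le; apply/andP; split.
    by rewrite E_sub_itg ?subr_le0 ?H//; exact: integrable_bmfM.
  by rewrite EE; apply: Rintegral_ge0 => y _; exact: h0.
have /(ae_eq_integral_abs mu measurableT) : measurable_fun [set: Y] (EFin \o h).
  exact: measurable_int ih.
move=> [] K _; have {K}/K : (\int[mu]_y `|(EFin \o h) y| = 0)%E.
  rewrite (_ : (fun y => _) = EFin \o h); last first.
    by apply/funext => y; rewrite /= ger0_norm.
  by move: Eh; rewrite EE /Rintegral => Eh; rewrite -[LHS]fineK ?Eh//; exact: integrable_fin_num.
apply: filterS => y /(_ I)[]; rewrite /h -mulrBl /w indicE leNgt.
case: (boolP (y \in _)) => [|]; rewrite ?inE /=.
  by move=> gf; rewrite mulr1 => /eqP; rewrite subr_eq0 gt_eqF.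
by move=> /negP gf _; apply/negP => k; apply: gf; rewrite inE.
Qed.

Lemma aeq_test_itg f g : itg f -> itg g ->
  (forall w, bmf w -> E (fun y => f y * w y) = E (fun y => g y * w y)) ->
  aeq mu f g.
Proof.
move=> bf bg H; have fg : ale mu f g by apply: ale_test_itg => // w bw _; rewrite H.
have gf : ale mu g f by apply: ale_test_itg => // w bw _; rewrite H.
by apply: filterS2 fg gf => y ? ?; apply/eqP; rewrite eq_le; apply/andP.
Qed.

Implicit Types v : Y -> R[i].

Lemma Re_le_normc (z : R[i]) : `|complex.Re z| <= Normc.normc z.
Proof. by case: z => a b /=; rewrite -sqrtr_sqr ler_wsqrtr// lerDl sqr_ge0. Qed.

Lemma Im_le_normc (z : R[i]) : `|complex.Im z| <= Normc.normc z.
Proof. by case: z => a b /=; rewrite -sqrtr_sqr ler_wsqrtr// lerDr sqr_ge0. Qed.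

Lemma normc_le (z : R[i]) : Normc.normc z <= `|complex.Re z| + `|complex.Im z|.
Proof.
case: z => a b /=; rewrite -[leRHS]ger0_norm ?addr_ge0// -sqrtr_sqr ler_wsqrtr//.
rewrite sqrrD !real_normK ?num_real// addrAC lerDl.
by rewrite mulrn_wge0// mulr_ge0.
Qed.

Lemma normc_ge0 (z : R[i]) : 0 <= Normc.normc z.
Proof. by apply: le_trans (Re_le_normc z). Qed.

Lemma normcR (a : R) : Normc.normc a%:C = `|a|.
Proof. by rewrite /= expr0n/= addr0 sqrtr_sqr. Qed.

Lemma measurable_normc v : cmeasurable v ->
  measurable_fun [set: Y] (fun y => Normc.normc (v y)).
Proof.
move=> [mr mi]; rewrite (_ : (fun y => _) =
    (fun y => Num.sqrt (complex.Re (v y) ^+ 2 + complex.Im (v y) ^+ 2))).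
  apply: (measurableT_comp (continuous_measurable_fun (@sqrt_continuous R))).
  by apply: measurable_funD; exact: measurable_funX.
by apply/funext => y; case: (v y).
Qed.

Lemma in_L1P v : in_Lp mu 1 v <->
  itg (fun y => complex.Re (v y)) /\ itg (fun y => complex.Im (v y)).
Proof.
split=> [[[mr mi]]|[ir ii]].
  have mn := measurable_normc (conj mr mi).
  rewrite /cLnorm Lnorm1 => h.
  have itn : itg (fun y => Normc.normc (v y)).
    by apply/integrableP; split => //; exact/measurable_EFinP.
  split; apply: le_integrable itn => //; do ?exact/measurable_EFinP.
  - by move=> y _; rewrite lee_fin [leRHS]ger0_norm ?normc_ge0// Re_le_normc.
  - by move=> y _; rewrite lee_fin [leRHS]ger0_norm ?normc_ge0// Im_le_normc.
have mr : measurable_fun [set: Y] (fun y => complex.Re (v y)).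
  exact/measurable_EFinP/(measurable_int _ ir).
have mi : measurable_fun [set: Y] (fun y => complex.Im (v y)).
  exact/measurable_EFinP/(measurable_int _ ii).
split; first by [].
rewrite /cLnorm Lnorm1.
have is_ : itg (fun y => `|complex.Re (v y)| + `|complex.Im (v y)|).
  by have := integrableD measurableT (integrable_abse ir) (integrable_abse ii).
have : itg (fun y => Normc.normc (v y)).
  apply: le_integrable is_ => //; first exact/measurable_EFinP/measurable_normc.
  move=> y _; rewrite lee_fin [leRHS]ger0_norm ?addr_ge0//.
  by rewrite ger0_norm ?normc_ge0// normc_le.
by case/integrableP.
Qed.

Lemma in_Loo_bmf w : bmf w -> in_Lp mu +oo (fun y => (w y)%:C).
Proof.
move=> [mw [M wM]]; split; first by split => //; exact: measurable_cst.
rewrite /cLnorm unlock; case: ifP => _; last exact: ltry.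
apply: (@le_lt_trans _ _ M%:E); last exact: ltry.
by apply/ess_supP; apply: aeW => y; rewrite /comp normcR abse_EFin lee_fin normr_id.
Qed.

Lemma in_L1_bmf f : bmf f -> in_Lp mu 1 (fun y => (f y)%:C).
Proof.
move=> bf; apply/in_L1P; split; first exact: bmf_integrable.
exact: (bmf_integrable mu (bmf_cst 0)).
Qed.

End IntegrableTests.

Section RealTransfer.
Context {R : realType} {d : measure_display} {Y : measurableType d}.
Variable mu : probability Y R.
Local Notation E := (E mu).
Local Notation itg f := (mu.-integrable [set: Y] (EFin \o f)).
Local Notation "v =c w" := (ae_eq mu [set: Y] v w) (at level 70).
Variables (F : Y -> Y) (P : (Y -> R[i]) -> Y -> R[i]).
Hypothesis mpF : measure_preserving mu F.
Hypothesis hP : transfer_operator mu F P.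
Implicit Types (f g w : Y -> R) (v : Y -> R[i]).

Let bmfF f : bmf f -> bmf (fun y => f (F y)).
Proof. exact: bmf_comp (proj1 mpF). Qed.

Let ReM (z : R[i]) (a : R) : complex.Re (z * a%:C) = complex.Re z * a.
Proof. by case: z => x y /=; rewrite mulr0 subr0. Qed.

Let ImM (z : R[i]) (a : R) : complex.Im (z * a%:C) = complex.Im z * a.
Proof. by case: z => x y /=; rewrite mulr0 add0r. Qed.

Lemma transfer_L1 v : in_Lp mu 1 v -> in_Lp mu 1 (P v).
Proof. by move=> /hP[]. Qed.

Lemma transfer_dual v w : in_Lp mu 1 v -> bmf w ->
  E (fun y => complex.Re (P v y) * w y) = E (fun y => complex.Re (v y) * w (F y)) /\
  E (fun y => complex.Im (P v y) * w y) = E (fun y => complex.Im (v y) * w (F y)).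
Proof.
move=> /hP[_ +] bw => /(_ _ (in_Loo_bmf mu bw)); rewrite /cintegral => -[].
rewrite !EE => h1 h2; split; [move: h1|move: h2].
  by under eq_Rintegral do rewrite ReM; under [in RHS]eq_Rintegral do rewrite ReM.
by under eq_Rintegral do rewrite ImM; under [in RHS]eq_Rintegral do rewrite ImM.
Qed.

(** [P] acts on representatives and is specified through duality alone; testing real and imaginary
    parts shows that it respects almost everywhere classes. *)
Lemma transfer_ae v v' : in_Lp mu 1 v -> in_Lp mu 1 v' -> v =c v' -> P v =c P v'.
Proof.
move=> Lv Lv' vv'.
have [r1 i1] := (in_L1P mu (P v)).1 (transfer_L1 Lv).
have [r2 i2] := (in_L1P mu (P v')).1 (transfer_L1 Lv').
have [r3 i3] := (in_L1P mu v).1 Lv; have [r4 i4] := (in_L1P mu v').1 Lv'.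
have mM f w : itg f -> bmf w -> measurable_fun [set: Y] (fun y => f y * w y).
  by move=> itf bw; exact/measurable_EFinP/(measurable_int _ (integrable_bmfM itf bw)).
have hr : aeq mu (fun y => complex.Re (P v y)) (fun y => complex.Re (P v' y)).
  apply: aeq_test_itg => // w bw; have bwF := bmfF bw.
  rewrite (transfer_dual Lv bw).1 (transfer_dual Lv' bw).1.
  apply: E_aeq_itg; [exact: (mM _ _ r3)|exact: (mM _ _ r4)|].
  by apply: filterS vv' => y ->.
have hi : aeq mu (fun y => complex.Im (P v y)) (fun y => complex.Im (P v' y)).
  apply: aeq_test_itg => // w bw; have bwF := bmfF bw.
  rewrite (transfer_dual Lv bw).2 (transfer_dual Lv' bw).2.
  apply: E_aeq_itg; [exact: (mM _ _ i3)|exact: (mM _ _ i4)|].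
  by apply: filterS vv' => y ->.
apply: filterS2 hr hi => y h1 h2 _.
by apply/eqP; rewrite eq_complex h1 h2 !eqxx.
Qed.

(** Some pointwise bound obtained by choice, not necessarily the least one. *)
Definition sup_bound f : R := get [set M | forall y, `|f y| <= M].

Lemma sup_boundP f : bmf f -> forall y, `|f y| <= sup_bound f.
Proof. by move=> [_ [M fM]]; apply: (@getI _ [set M | forall y, `|f y| <= M] M). Qed.

(* Clipping makes the operator preserve boundedness everywhere, and not only
   almost everywhere. *)
Definition real_transfer f (y : Y) : R :=
  if `[< bmf f >] then Num.max (- sup_bound f)
    (Num.min (sup_bound f) (complex.Re (P (fun z => (f z)%:C) y)))
  else 0.
Local Notation Q := real_transfer.

Lemma bmf_real_transfer f : bmf (Q f).
Proof.
rewrite /real_transfer; case: asboolP => bf; last exact: bmf_cst.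
have [[mr _] _] := transfer_L1 (in_L1_bmf mu bf).
have M0 : 0 <= sup_bound f by apply: le_trans (sup_boundP bf point).
split.
  apply: measurable_maxr; first exact: measurable_cst.
  by apply: measurable_minr => //; exact: measurable_cst.
exists (sup_bound f) => y; rewrite ler_norml le_max lexx/= ge_max ge_min lexx andbT.
by rewrite (le_trans _ M0)// oppr_le0.
Qed.

(** Duality against nonnegative tests places the real part of [P f] between the constants
    [- sup_bound f] and [sup_bound f], so the clipping is inactive almost everywhere; the same
    duality gives imaginary part [0]. *)
Lemma transfer_real f : bmf f -> P (fun y => (f y)%:C) =c (fun y => (Q f y)%:C).
Proof.
move=> bf; have Lf := in_L1_bmf mu bf.
have [ir ii] := (in_L1P mu _).1 (transfer_L1 Lf).
have M0 : 0 <= sup_bound f by apply: le_trans (sup_boundP bf point).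
have ic c : itg (fun=> c) by exact: (bmf_integrable mu (bmf_cst c)).
have bcF c w : bmf w -> bmf (fun y => c * w (F y)).
  by move=> bw; apply: bmf_mul; [exact: bmf_cst|exact: bmfF].
have cF c w : bmf w -> E (fun y => c * w y) = E (fun y => c * w (F y)).
  move=> bw; rewrite E_scale// E_scale; last exact: bmfF.
  by rewrite (E_measure_preserving mpF).
have bfF w : bmf w -> bmf (fun y => f y * w (F y)).
  by move=> bw; apply: bmf_mul => //; exact: bmfF.
have up : ale mu (fun y => complex.Re (P (fun z => (f z)%:C) y)) (fun=> sup_bound f).
  apply: ale_test_itg => // w bw w0; rewrite (transfer_dual Lf bw).1 cF//=.
  apply: E_le; [exact: bfF|exact: bcF|move=> y].
  by rewrite ler_wpM2r//; apply: le_trans (sup_boundP bf y); exact: ler_norm.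
have lo : ale mu (fun=> - sup_bound f) (fun y => complex.Re (P (fun z => (f z)%:C) y)).
  apply: ale_test_itg => // w bw w0; rewrite (transfer_dual Lf bw).1 cF//=.
  apply: E_le; [exact: bcF|exact: bfF|move=> y].
  rewrite ler_wpM2r//; have := sup_boundP bf y; rewrite ler_norml.
  by case/andP.
have im : aeq mu (fun y => complex.Im (P (fun z => (f z)%:C) y)) (fun=> 0).
  apply: aeq_test_itg => // w bw; rewrite (transfer_dual Lf bw).2/=.
  exact: esym (cF 0 w bw).
apply: filterS2 (filterI up lo) im => y [h1 h2] h3 _.
apply/eqP; rewrite eq_complex /= h3 eqxx andbT /real_transfer asboolT//.
by rewrite (min_idPr h1) (max_idPr h2).
Qed.

Lemma bounded_real_transfer : bounded_transfer mu F Q.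
Proof.
split; [exact: (proj1 mpF)|exact: E_measure_preserving|by move=> f _; exact: bmf_real_transfer|].
move=> f w bf bw; have Lf := in_L1_bmf mu bf.
have [ir _] := (in_L1P mu _).1 (transfer_L1 Lf).
rewrite -[RHS](transfer_dual Lf bw).1; apply: E_aeq_itg.
- by apply: measurable_funM; [exact: (proj1 (bmf_real_transfer f))|exact: (proj1 bw)].
- exact/measurable_EFinP/(measurable_int _ (integrable_bmfM ir bw)).
- by apply: filterS (transfer_real bf) => y ->.
Qed.

End RealTransfer.

(** * Banach space bounds read on bounded real functions *)

Lemma oneB_expRN_le {R : realType} (g x : R) : 0 < g <= 1 -> 0 <= x ->
  1 - expR (- x) <= x `^ g.
Proof.
move=> /andP[g0 g1]; rewrite le_eqVlt => /predU1P[<-|x0].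
  by rewrite oppr0 expR0 subrr powR_ge0.
have [x1|x1] := leP 1 x.
  apply: (@le_trans _ _ 1); first by rewrite gerBl expR_ge0.
  rewrite (_ : 1 = 1 `^ g); last by rewrite powR1.
  apply: ge0_ler_powR; rewrite ?nnegrE//.
  - exact: ltW.
  - exact: ltW.
apply: (@le_trans _ _ x); first by have := expR_ge1Dx (- x); lra.
rewrite -{1}[x]powRr1 ?(ltW x0)// /powR gt_eqF// ler_expR.
by rewrite ler_wnM2r// ln_le0// ltW.
Qed.

Section NormTransfer.
Context {R : realType} {d : measure_display} {Y : measurableType d}.
Variable mu : probability Y R.
Local Notation E := (E mu).
Local Notation "v =c w" := (ae_eq mu [set: Y] v w) (at level 70).
Implicit Types (f g w : Y -> R) (v : Y -> R[i]).

Lemma Np_le_Lnorm (p : R) f g : 1 <= p -> bmf f -> measurable_fun [set: Y] g ->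
  {ae mu, forall y, `|f y| <= `|g y|} ->
  ((Np mu p f)%:E <= 'N[mu]_p%:E[EFin \o g])%E.
Proof.
move=> p1 bf mg fg; have p0 : 0 <= p by exact: le_trans p1.
rewrite -NpE// unlock; apply: gt0_ler_poweR.
- by rewrite invr_ge0.
- by rewrite in_itv/= leey andbT integral_ge0// => y _; exact: poweR_ge0.
- by rewrite in_itv/= leey andbT integral_ge0// => y _; exact: poweR_ge0.
have mp (h : Y -> R) : measurable_fun [set: Y] h ->
    measurable_fun [set: Y] (fun y => (`|(EFin \o h) y| `^ p)%E).
  move=> mh; apply: (measurableT_comp (measurable_poweR p)).
  by apply: (measurableT_comp (@abse_measurable R setT)); exact/measurable_EFinP.
apply: ae_ge0_le_integral => //.
- by move=> y _; exact: poweR_ge0.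
- by apply: mp; exact: (proj1 bf).
- by move=> y _; exact: poweR_ge0.
- exact: mp.
apply: filterS fg => y fg _; rewrite !abse_EFin !poweR_EFin lee_fin.
by apply: ge0_ler_powR; rewrite ?nnegrE.
Qed.

Lemma cLnorm_real (p : R) v f : 1 <= p -> cmeasurable v -> bmf f ->
  v =c (fun y => (f y)%:C) -> cLnorm mu p%:E v = (Np mu p f)%:E.
Proof.
move=> p1 mv bf vf; rewrite -NpE// /cLnorm unlock.
apply: (congr1 (fun z => z `^ p^-1)%E).
apply: ae_eq_integral => //.
- apply: (measurableT_comp (measurable_poweR p)).
  apply: (measurableT_comp (@abse_measurable R setT)).
  exact/measurable_EFinP/measurable_normc.
- apply: (measurableT_comp (measurable_poweR p)).
  apply: (measurableT_comp (@abse_measurable R setT)).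
  exact/measurable_EFinP/(proj1 bf).
apply: filterS vf => y vf _; rewrite vf// normcR.
by rewrite /= normr_id.
Qed.

Lemma in_L1_real v f : cmeasurable v -> bmf f ->
  v =c (fun y => (f y)%:C) -> in_Lp mu 1 v.
Proof. by move=> mv bf vf; split => //; rewrite (cLnorm_real _ mv bf vf)// ltry. Qed.

End NormTransfer.

Section FunctionSpaceBound.
Context {R : realType} {d : measure_display} {Y : measurableType d}.
Variable mu : probability Y R.
Local Notation E := (E mu).
Local Notation "v =c w" := (ae_eq mu [set: Y] v w) (at level 70).
Implicit Types (f g w : Y -> R) (v : Y -> R[i]).
Variable S : function_space mu.
Implicit Type u : S.

Definition fs_bound f (x : R) : Prop :=
  exists2 u : S, fs_fun u =c (fun y => (f y)%:C) & fs_norm u <= x.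

Lemma fs_norm_ge0 u : 0 <= fs_norm u.
Proof. by have := normr_ge0 u; rewrite lecE => /andP[_]. Qed.

Lemma fs_normD u1 u2 : fs_norm (u1 + u2) <= fs_norm u1 + fs_norm u2.
Proof.
have := ler_normD u1 u2; rewrite lecE => /andP[_]; rewrite /fs_norm.
by case: (`|u1|) => a b; case: (`|u2|).
Qed.

Lemma fs_normZ (a : R) u : fs_norm (a%:C *: u) = `|a| * fs_norm u.
Proof.
rewrite /fs_norm normrZ normc_def /= expr0n addr0 sqrtr_sqr.
by case: (`|u|) => x y /=; rewrite mul0r subr0.
Qed.

Lemma fs_funD u1 u2 : fs_fun (u1 + u2) =c (fun y => fs_fun u1 y + fs_fun u2 y).
Proof.
have := fs_linear 1 u1 u2; rewrite scale1r; apply: filterS => y h /h ->.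
by rewrite mul1r.
Qed.

Lemma fs_fun0 : fs_fun (0 : S) =c (fun=> 0).
Proof.
have := fs_funD 0 0; rewrite addr0; apply: filterS => y h /h {}h.
by apply: (addrI (fs_fun 0 y)); rewrite /= addr0; symmetry; exact: h.
Qed.

Lemma fs_funZ (a : R[i]) u : fs_fun (a *: u) =c (fun y => a * fs_fun u y).
Proof.
have := fs_linear a u 0; rewrite addr0 => h; apply: filterS2 h fs_fun0 => y h1 h2 D.
by rewrite h1// h2// addr0.
Qed.

Lemma banach_fs_bound (p : R) : 1 <= p -> contains_constants S ->
  compactly_embedded S p -> banach_bound mu p fs_bound.
Proof.
move=> p1 Scst [SLp Scomp]; split.
- move=> f g x fg [u uf ux]; exists u => //.
  by apply: filterS2 fg uf => y <- .
- by move=> f x z [u uf ux] xz; exists u => //; exact: le_trans xz.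
- by move=> f x [u _ ux]; exact: le_trans (fs_norm_ge0 u) ux.
- move=> f g x z [u uf ux] [w wg wz]; exists (u + w); last first.
    by apply: (le_trans (fs_normD u w)); exact: lerD.
  apply: filterS2 (fs_funD u w) (filterI uf wg) => y h1 [h2 h3] D.
  by rewrite h1// h2// h3// rmorphD.
- move=> a f x [u uf ux]; exists (a%:C *: u); last first.
    by rewrite fs_normZ ler_wpM2l.
  apply: filterS2 (fs_funZ a%:C u) uf => y h1 h2 D.
  by rewrite h1// h2// rmorphM.
- by have [u u1] := Scst 1; exists (fs_norm u), u.
- move=> f a b x0 a0 b2 [u uf _] H.
  have [w wf wx] := H (fs_norm u) (ex_intro2 _ _ u uf (lexx _)).
  have uw : u = w.
    by apply: fs_inj; apply: filterS2 uf wf => y h1 h2 D; rewrite h1// h2.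
  exists u => //; rewrite -uw in wx; have u0 := fs_norm_ge0 u.
  have : b * fs_norm u <= 2^-1 * fs_norm u by rewrite ler_wpM2r.
  by lra.
move=> f_ M bf_ Bf_.
have [u_ Hu] : exists u_ : nat -> S, forall n,
    fs_fun (u_ n) =c (fun y => (f_ n y)%:C) /\ fs_norm (u_ n) <= M.
  have H n : exists u : S, fs_fun u =c (fun y => (f_ n y)%:C) /\ fs_norm u <= M.
    by have [u uf uM] := Bf_ n; exists u.
  exists (fun n => sval (cid (H n))) => n; exact: (svalP (cid (H n))).
have [|phi [w [hphi [[mw _] cw]]]] := Scomp u_.
  by exists M => n; case: (Hu n).
exists phi; split => // e e0; have e2 : 0 < e / 2 by rewrite divr_gt0.
have [hfin /cvgrPdist_le /(_ _ e2) hc] := (fine_cvgP _ _).1 cw.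
have [n0 _ Hn0] : \forall n \near \oo,
    (cLnorm mu p%:E (fun y => fs_fun (u_ (phi n)) y - w y)%R <= (e / 2)%:E)%E.
  apply: filterS2 hfin hc => n h1; rewrite sub0r normrN /= => h2.
  by rewrite -(fineK h1) lee_fin; exact: le_trans (ler_norm _) h2.
have md n : measurable_fun [set: Y] (fun y => Normc.normc (fs_fun (u_ (phi n)) y - w y)).
  apply: measurable_normc; have [mr mi] := fs_measurable (u_ (phi n)).
  case: mw => wr wi; split.
    rewrite (_ : (fun y => _) = (fun y => complex.Re (fs_fun (u_ (phi n)) y) - complex.Re (w y))).
      exact: measurable_funB.
    by apply/funext => y; rewrite raddfB.
  rewrite (_ : (fun y => _) = (fun y => complex.Im (fs_fun (u_ (phi n)) y) - complex.Im (w y))).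
    exact: measurable_funB.
  by apply/funext => y; rewrite raddfB.
exists n0 => m n mn nn; rewrite -lee_fin.
(* The limit [w] is only known to be a complex [L^p] function. Minkowski's inequality eliminates it:
   two terms close to [w] are close to each other. *)
pose h k y := Normc.normc (fs_fun (u_ (phi k)) y - w y).
apply: (@le_trans _ _ ('N[mu]_p%:E[EFin \o (h m \+ h n)%R])%E).
  apply: Np_le_Lnorm => //; [exact: bmf_sub|exact: (measurable_funD (md m) (md n))|].
  have [Hm _] := Hu (phi m); have [Hn _] := Hu (phi n).
  apply: filterS2 Hm Hn => y h1 h2; rewrite [leRHS]ger0_norm ?addr_ge0 ?normc_ge0//.
  have -> : `|f_ (phi m) y - f_ (phi n) y| =
      Normc.normc ((fs_fun (u_ (phi m)) y - w y) - (fs_fun (u_ (phi n)) y - w y)).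
    by rewrite opprB addrA subrK h1// h2// -rmorphB normcR.
  have := le_normcD (fs_fun (u_ (phi m)) y - w y) (- (fs_fun (u_ (phi n)) y - w y)).
  by rewrite normcN.
apply: (le_trans (minkowski_EFin mu (md m) (md n) p1)).
have -> : e%:E = ((e / 2)%:E + (e / 2)%:E)%E by rewrite -EFinD; congr EFin; lra.
by apply: leeD; [exact: (Hn0 m)|exact: (Hn0 n)].
Qed.

End FunctionSpaceBound.
Section OperatorBounds.
Context {R : realType} {d : measure_display} {Y : measurableType d}.
Variable mu : probability Y R.
Local Notation E := (E mu).
Local Notation itg f := (mu.-integrable [set: Y] (EFin \o f)).
Local Notation "v =c w" := (ae_eq mu [set: Y] v w) (at level 70).
Variables (F : Y -> Y) (P : (Y -> R[i]) -> Y -> R[i]) (tau : Y -> R).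
Hypothesis mpF : measure_preserving mu F.
Hypothesis hP : transfer_operator mu F P.
Hypothesis mtau : measurable_fun [set: Y] tau.
Hypothesis tau0 : forall y, 0 <= tau y.
Local Notation Q := (real_transfer P).
Implicit Types (f g w : Y -> R) (v : Y -> R[i]).

Lemma cexp_real (x : R) : cexp x%:C = (expR x)%:C.
Proof. by rewrite /cexp /= cos0 sin0 mulr1. Qed.

(** For real [s >= 0] the complex twisted operator sends real bounded functions to such functions up
    to null sets. Measurability is carried through the induction because equal classes may be
    exchanged under [P] only within [L^1]. *)
Lemma Rhat_iter (s : R) f v n : 0 <= s -> bmf f -> cmeasurable v ->
  v =c (fun y => (f y)%:C) ->
  [/\ bmf (iter n (Qs Q tau s) f), cmeasurable (iter n (Rhat P tau s%:C) v) &
   iter n (Rhat P tau s%:C) v =c (fun y => (iter n (Qs Q tau s) f y)%:C)].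
Proof.
move=> s0 bf mv vf; elim: n => [//|n [bg mw wg]] /=.
set g := iter n (Qs Q tau s) f in bg wg *; set w := iter n (Rhat P tau s%:C) v in mw wg *.
have be := bmf_etau mtau tau0 s0.
have beg : bmf (fun y => etau tau s y * g y) by exact: bmf_mul.
have wE : (fun y => cexp (- s%:C * (tau y)%:C) * w y) = (fun y => (etau tau s y)%:C * w y).
  apply/funext => y; congr (_ * _).
  by rewrite -rmorphN -rmorphM cexp_real mulNr.
have mew : cmeasurable (fun y => (etau tau s y)%:C * w y).
  case: mw => mr mi; split.
    rewrite (_ : (fun y => _) = (fun y => etau tau s y * complex.Re (w y))).
      by apply: measurable_funM => //; exact: (proj1 be).
    by apply/funext => y; case: (w y) => a b /=; rewrite mul0r subr0.
  rewrite (_ : (fun y => _) = (fun y => etau tau s y * complex.Im (w y))).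
    by apply: measurable_funM => //; exact: (proj1 be).
  by apply/funext => y; case: (w y) => a b /=; rewrite mul0r addr0.
have ewg : (fun y => (etau tau s y)%:C * w y) =c (fun y => (etau tau s y * g y)%:C).
  by apply: filterS wg => y h D; rewrite h// rmorphM.
have Lw := in_L1_real mew beg ewg.
have Lg := in_L1_bmf mu beg.
split.
- exact: (bmf_real_transfer hP).
- by rewrite /Rhat wE; case: (transfer_L1 hP Lw).
- rewrite /Rhat wE.
  apply: filterS2 (transfer_ae mpF hP Lw Lg ewg) (transfer_real mpF hP beg) => y h1 h2 D.
  by rewrite h1// h2.
Qed.

Variable S : function_space mu.
Variables p L delta alpha C : R.
Hypothesis p1 : 1 <= p.
Hypothesis C0 : 0 < C.
Hypothesis alpha01 : 0 < alpha < 1.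

Lemma lasota_yorke_real : lasota_yorke P tau S p L delta alpha C ->
  forall s f x n, 0 <= s < delta -> bmf f -> fs_bound S f x -> (1 <= n)%N ->
    fs_bound S (iter n (Qs Q tau s) f) (C * (Np mu p f + alpha ^+ n * x)).
Proof.
move=> LY s f x n /andP[s0 sd] bf [u uf ux] n1.
have Hs : Hregion delta L s%:C by left; split => //; rewrite normcR ger0_norm.
have [w wu] := LY s%:C u n Hs n1.
have mu_ := fs_measurable u.
rewrite (cLnorm_real p1 mu_ bf uf) -EFinD -EFinM lee_fin => wle.
have [_ _ it] := Rhat_iter n s0 bf mu_ uf.
exists w; first by apply: filterS2 wu it => y h1 h2 D; rewrite h1// h2.
apply: (le_trans wle); rewrite ler_pM2l// lerD2l ler_wpM2l//.
by rewrite exprn_ge0//; case/andP: alpha01 => /ltW.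
Qed.

Variable gamma : R.
Hypothesis gamma01 : 0 < gamma <= 1.

(** For [f >= 0], the inequality [1 - exp (- s tau) <= (s tau) ^ gamma] and positivity bound
    [Q ((1 - etau s) * f)] by [s ^ gamma] times the real part of [P (tau ^ gamma * f)], whose norm
    the moment condition controls. *)
Lemma moment_bound_real : moment_bound P tau S p gamma C ->
  forall s f x, 0 < s -> bmf f -> ale mu (fun=> 0) f -> fs_bound S f x ->
    Np mu p (Q (fun y => (1 - etau tau s y) * f y)) <= C * s `^ gamma * x.
Proof.
move=> mb s f x s0 bf f0 [u uf ux]; have [Ltv le_tv] := mb u.
set tv := (fun y => _) in Ltv le_tv; have sg0 : 0 < s `^ gamma by exact: powR_gt0.
have be := bmf_etau mtau tau0 (ltW s0).
have b1e : bmf (fun y => (1 - etau tau s y) * f y).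
  by apply: bmf_mul => //; apply: bmf_sub => //; exact: bmf_cst.
set g := Q _; have bg : bmf g by exact: (bmf_real_transfer hP).
have HQ := bounded_real_transfer mpF hP.
have [ir _] := (in_L1P mu _).1 (transfer_L1 hP Ltv).
have [it _] := (in_L1P mu _).1 Ltv.
have bs : bmf (fun _ : Y => s `^ gamma) by exact: bmf_cst.
have isr : itg (fun y => complex.Re (P tv y) * s `^ gamma) by exact: integrable_bmfM.
have g0 : ale mu (fun=> 0) g.
  have := tr_ale HQ (bmf_cst 0) b1e; have t0 := tr_cst HQ 0.
  have h0 : ale mu (fun=> 0) (fun y => (1 - etau tau s y) * f y).
    apply: filterS f0 => y fy; rewrite mulr_ge0// subr_ge0 etau_le1//.
    exact: ltW.
  by move=> /(_ h0); apply: filterS2 t0 => y ->.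
have g1 : ale mu g (fun y => complex.Re (P tv y) * s `^ gamma).
  apply: ale_test_itg => //; first exact: bmf_integrable.
  move=> w bw w0; rewrite (tr_dual HQ b1e bw).
  have bsw : bmf (fun y => s `^ gamma * w y) by exact: bmf_mul.
  have -> : E (fun y => complex.Re (P tv y) * s `^ gamma * w y) =
      E (fun y => complex.Re (tv y) * (s `^ gamma * w (F y))).
    by rewrite -(transfer_dual hP Ltv bsw).1; apply: E_ext => y; rewrite mulrA.
  have bwF : bmf (fun y => w (F y)) by exact: (bmf_comp (proj1 mpF) bw).
  have i1 : itg (fun y => (1 - etau tau s y) * f y * w (F y)).
    by apply: bmf_integrable; exact: bmf_mul.
  have i2 : itg (fun y => complex.Re (tv y) * (s `^ gamma * w (F y))).
    by apply: integrable_bmfM => //; exact: bmf_mul.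
  rewrite -subr_ge0 -E_sub_itg//.
  pose h y := complex.Re (tv y) * (s `^ gamma * w (F y)) -
    (1 - etau tau s y) * f y * w (F y).
  have i3 : itg h by have := integrableB measurableT i2 i1.
  have m3 : measurable_fun [set: Y] h by exact/measurable_EFinP/(measurable_int _ i3).
  rewrite -/h (@E_aeq_itg _ _ _ mu h (fun y => `|h y|)).
  - by rewrite EE; apply: Rintegral_ge0.
  - exact: m3.
  - exact: (measurableT_comp (@normr_measurable R setT) m3).
  apply: filterS2 uf f0 => y h1 h2; rewrite ger0_norm// /h /tv h1//.
  rewrite /= mulr0 subr0 mulrA -mulrBl mulr_ge0// subr_ge0.
  have -> : tau y `^ gamma * f y * s `^ gamma = (s * tau y) `^ gamma * f y.
    by rewrite powRM ?(ltW s0)//; ring.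
  by rewrite ler_wpM2r// oneB_expRN_le// mulr_ge0// ltW.
have bsg : bmf (fun y => (s `^ gamma)^-1 * g y) by apply: bmf_mul => //; exact: bmf_cst.
have H : (Np mu p (fun y => (s `^ gamma)^-1 * g y) <= C * fs_norm u).
  rewrite -lee_fin; apply: le_trans le_tv.
  apply: (Np_le_Lnorm p1 bsg).
    by apply: measurable_normc; case: (transfer_L1 hP Ltv).
  apply: filterS2 g0 g1 => y h1 h2; rewrite [leRHS]ger0_norm ?normc_ge0//.
  apply: le_trans (Re_le_normc _); rewrite ger0_norm; last first.
    by rewrite mulr_ge0// invr_ge0 ltW.
  apply: le_trans (ler_norm _).
  by rewrite ler_pdivrMl// mulrC.
move: H; rewrite Np_scale// gtr0_norm ?invr_gt0// ler_pdivrMl// => H.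
apply: (le_trans H); rewrite mulrA [s `^ _ * _]mulrC.
by rewrite ler_wpM2l// mulr_ge0 ?ltW.
Qed.

End OperatorBounds.

(** * Choice of the parameters and conclusion *)

Theorem theorem2p6 (R : realType) (d : measure_display) (Y : measurableType d)
    (mu : probability Y R) (F : Y -> Y) (tau : Y -> R) (ell : R -> R)
    (beta : R) (P : (Y -> R[i]) -> (Y -> R[i]))
    (p0 : R) (BB : R -> R -> R -> function_space mu)
    (hF : measure_preserving mu F)
    (hFerg : ergodic mu F)
    (hFmix : mixing mu F)
    (htau : measurable_fun [set: Y] tau)
    (htau0 : forall y, 0 <= tau y)
    (htau_nonint : ~ mu.-integrable [set: Y] (EFin \o tau))
    (htau_inf : (1 < ess_inf mu (EFin \o tau))%E)
    (hell : measurable_fun (`[0, +oo[ : set R) ell)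
    (hell0 : forall t, 0 <= t -> 0 <= ell t)
    (hell_sv : slowly_varying ell)
    (hbeta : 0 <= beta <= 1)
    (htail : forall t : R, 0 < t ->
       mu [set y | t < tau y] = (ell t * t `^ (- beta))%:E)
    (hP : transfer_operator mu F P)
    (hH : hypothesis_H P tau beta p0 BB)
    (A B : set Y) (hA : measurable A) (hB : measurable B)
    (p gamma L : R) (hpgL : admissible p0 beta p gamma L)
    (hAB : in_space (BB p gamma L) (fun y => (\1_A y : R)%:C)) :
  ((t^-1 * mfun_ell beta ell t)%:E * renewal_fun mu F tau A B t)%E
    @[t --> +oo] --> ((Dconst beta)%:E * mu A * mu B)%E.
Proof.
have [pp0 [/andP[g0 gb] _]] := hpgL; have [p01 HH] := hH.
have b0 : 0 < beta by exact: lt_trans gb.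
have b1 : beta <= 1 by case/andP: hbeta.
have beta01 : 0 < beta <= 1 by rewrite b0.
have tau1 : {ae mu, forall y, 1 <= tau y}.
  have /ess_infP := ltW htau_inf; apply: filterS => y /=.
  by rewrite lee_fin.
have HQ := bounded_real_transfer hF hP.
have mixF := mixing_bmf hF hFmix.
(* This is proved in the space attached to [(p, gamma, L)], the one that contains [1_A]. The
   spectral estimates below take place in a space for other parameters, to which [1_A] need not
   belong. *)
have decay e : 0 < e -> exists n,
    E mu (fun y => `|iter n (real_transfer P) \1_A y - E mu \1_A|) <= e.
  move=> e0; have p1 : 1 < p by exact: le_lt_trans pp0.
  have [Scst [delta [alpha [C [[/andP[d0 _] al C0] [Sco LY _]]]]]] := HH p gamma L hpgL.
  have HB := banach_fs_bound (ltW p1) Scst Sco.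
  have bA : bmf (\1_A : Y -> R) by exact: bmf_indic.
  have bc : bmf (fun _ : Y => E mu \1_A) by exact: bmf_cst.
  have bAc := bmf_sub bA bc.
  have LY0 f x n : bmf f -> fs_bound (BB p gamma L) f x -> (1 <= n)%N ->
      fs_bound (BB p gamma L) (iter n (real_transfer P) f)
        (C * (Np mu p f + alpha ^+ n * x)).
    move=> bf Bf n1.
    have := lasota_yorke_real hF hP htau htau0 (ltW p1) C0 al LY
      (s := 0) (f := f) (x := x) (n := n).
    rewrite lexx d0 => /(_ isT bf Bf n1).
    rewrite (_ : iter n _ f = iter n (real_transfer P) f)//.
    by elim: n {n1} => //= n ->; rewrite Qs_at0.
  have [u uA] := hAB; have [K B1] := BN_one HB.
  have BA : fs_bound (BB p gamma L) \1_A (fs_norm u) by exists u.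
  have Bc := BN_scale HB (E mu \1_A) B1.
  have BAc := BN_sub HB BA Bc.
  have BAc' : fs_bound (BB p gamma L) (fun y => \1_A y - E mu \1_A)
      (fs_norm u + `|E mu \1_A| * K).
    by apply: BN_aeq HB _ _ _ _ BAc; apply: aeW => y; rewrite mulr1.
  have E0 : E mu (fun y => \1_A y - E mu \1_A) = 0 by rewrite E_sub// E_cst subrr.
  have [n Hn] := Np_decay p1 HQ mixF HB C0 al LY0 bAc BAc' E0 e0.
  exists n; apply: le_trans (Hn n (leqnn n)).
  apply: le_trans (E_abs_le_Np mu (ltW p1) (bmf_iterQ HQ n bAc)).
  apply: E_le_ae.
  - by apply/bmf_abs/bmf_sub => //; exact: (bmf_iterQ HQ).
  - by apply/bmf_abs; exact: (bmf_iterQ HQ).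
  have h1 := tr_iter_sub HQ n bA bc; have h2 := tr_iter_cst HQ n (E mu \1_A).
  by apply: filterS2 h1 h2 => y -> ->.
(* Then [g' / 2 * p' = beta / 4 * (p0 + 4) > beta], as the Chebyshev step requires, and [p' >= 2],
   as the [L^2] bounds require. *)
pose p' := p0 + 4; pose g' := beta / 2.
have adm : admissible p0 beta p' g' 1.
  split; first by rewrite ltrDl.
  by split => //; rewrite divr_gt0//= ltr_pdivrMr// ltr_pMr// ltr1n.
have p1 : 1 <= p' by rewrite /p'; lra.
have p2 : 2 <= p' by rewrite /p'; lra.
have g0' : 0 < g' by rewrite divr_gt0.
have g01 : 0 < g' <= 1 by rewrite g0' /g'; lra.
have gp : beta < g' / 2 * p' by rewrite /g' /p'; nra.
have [Scst [delta [alpha [C [[/andP[d0 _] al C0] [Sco LY mb]]]]]] := HH p' g' 1 adm.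
have HB := banach_fs_bound p1 Scst Sco.
have LY' := lasota_yorke_real hF hP htau htau0 p1 C0 al LY.
have mb' := moment_bound_real hF hP htau htau0 p1 C0 g01 mb.
exact: (renewal_fun_asymptotic HQ mixF htau htau0 tau1 htau_nonint beta01 hell_sv
  htail p2 g0' gp HB C0 d0 al LY' mb' hA hB decay).
Qed.
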